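(* Let $n\ge 1$. The elements $\sigma_1,\dots,\sigma_{n-1}$ of $UW_n=\pi_1\,\mathcal{UW}_n$ generate a subgroup isomorphic to the braid group $B_n$, and the elements $\rho_1,\dots,\rho_{n-1}$ of $UW_n$ also generate a subgroup isomorphic to $B_n$.
   Context: $\mathbb R^3_+=\{(x,y,z): z\ge 0\}$. A wicket is a semicircle in $\mathbb R^3_+$ that is the upper half of a round circle lying in a vertical plane with center in the $xy$-plane. $\mathcal{UW}_n$ is the space of unordered configurations of $n$ disjoint wickets in $\mathbb R^3_+$ all lying in planes perpendicular to the $x$-axis (a path-connected manifold). $B_n=\pi_1$ of the space of unordered configurations of $n$ distinct points in $\mathbb R^2$. Take as basepoint a configuration in which the $i$th wicket has radius $1$ and center $(4i,0,0)$, $i=1,\dots,n$ (the subspace of configurations whose wickets lie in distinct planes is contractible). For $1\le i\le n-1$, $\rho_i$ and $\sigma_i$ are represented by loops in $\mathcal{UW}_n$ in which all wickets other than the $i$th and $(i+1)$st are fixed and the $i$th and $(i+1)$st wickets exchange places, their planes coinciding at exactly one moment and not coinciding with the planes of other wickets. For $\rho_i$, at that moment the $i$th wicket (the one moving in the positive $x$-direction) is nested inside the $(i+1)$st, so it passes through the $(i+1)$st wicket. For $\sigma_i$, at that moment the two wickets are not nested and the $i$th wicket lies on the side of larger $y$-coordinate, so it passes around the $(i+1)$st wicket. *)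

(* Defs.v *)
From HB Require Import structures.
From mathcomp Require Import all_boot all_order all_algebra generic_quotient perm.
From mathcomp Require Import all_classical all_reals all_analysis.
From mathcomp Require Import continuous_path ring lra.

Set Implicit Arguments.
Unset Strict Implicit.
Unset Printing Implicit Defensive.

Import Order.TTheory GRing.Theory Num.Theory.
Import numFieldNormedType.Exports.

Local Open Scope classical_set_scope.
Local Open Scope ring_scope.
Local Open Scope quotient_scope.

Section UnitInterval.
Context (R : realType).

Definition I01 : Type := (`[0%R, 1%R]%classic : set R).

HB.instance Definition _ := Topological.copy I01 (`[0%R, 1%R]%classic : set R).

(* Retraction of R onto [0, 1], used to write maps into I01 by formulas in R. *)
Definition clamp_val (r : R) : R := Num.min 1 (Num.max 0 r).

Lemma clamp_subproof (r : R) : clamp_val r \in (`[0%R, 1%R]%classic : set R).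
Proof.
rewrite inE /= in_itv /= /clamp_val le_min ler01 le_max lexx /=.
by rewrite ge_min lexx.
Qed.

Definition clamp (r : R) : I01 := exist _ (clamp_val r) (clamp_subproof r).

Definition I01val (t : I01) : R := val t.

Lemma I01P (t : I01) : 0 <= I01val t <= 1.
Proof. by case: t => r /=; rewrite /I01val /= inE /= in_itv. Qed.

Lemma clamp_valE r : 0 <= r <= 1 -> clamp_val r = r.
Proof. by case/andP=> r0 r1; rewrite /clamp_val (max_idPr r0) (min_idPr r1). Qed.

Lemma clampK r : 0 <= r <= 1 -> I01val (clamp r) = r.
Proof. exact: clamp_valE. Qed.

Lemma I01valK t : clamp (I01val t) = t.
Proof. by apply: val_inj => /=; rewrite clamp_valE// I01P. Qed.

Lemma clamp01_neq : clamp 0 != clamp 1.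
Proof.
apply/eqP => /(congr1 I01val); rewrite !clampK ?lexx ?ler01//.
by move/eqP; rewrite eq_sym oner_eq0.
Qed.

HB.instance Definition _ := isBiPointed.Build I01 clamp01_neq.

Lemma I01val_continuous : continuous I01val.
Proof. exact: (@initial_continuous _ _ (set_val : I01 -> R)). Qed.

End UnitInterval.

Lemma continuous_set_type (T U : topologicalType) (A : set U) (f : T -> A) :
  continuous (fun t => val (f t)) -> continuous f.
Proof.
move=> /continuousP cf; apply/continuousP => B [C oC <-].
exact: (cf C oC).
Qed.

Lemma clamp_continuous (R : realType) : continuous (@clamp R).
Proof.
apply: continuous_set_type => /=.
apply: (@min_fun_continuous _ R R (cst 1) (Num.max 0)); first exact: cst_continuous.
apply: (@max_fun_continuous _ R R (cst 0) id); first exact: cst_continuous.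
by move=> r; exact: cvg_id.
Qed.

Lemma continuous_paste (R : realType) (T U : topologicalType) (h : T -> R) c
    (f g : T -> U) :
  continuous h -> continuous f -> continuous g ->
  (forall t, h t = c -> f t = g t) ->
  continuous (fun t => if h t <= c then f t else g t).
Proof.
move=> ch cf cg fg.
pose A := h @^-1` [set x | x <= c]; pose B := h @^-1` [set x | x >= c].
have AB : A `|` B = setT.
  by apply/seteqP; split=> // t _; case: (lerP (h t) c) => [|/ltW]; [left|right].
apply/continuous_subspace_setT; rewrite -AB; apply: withinU_continuous.
- by apply: closed_comp; [move=> x _; exact: ch|exact: closed_le].
- by apply: closed_comp; [move=> x _; exact: ch|exact: closed_ge].
- apply: (@subspace_eq_continuous _ _ _ f); last exact: continuous_subspaceT.
  by move=> t; rewrite inE /A /= /from_subspace => ->.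
- apply: (@subspace_eq_continuous _ _ _ g); last exact: continuous_subspaceT.
  move=> t; rewrite inE /B /= /from_subspace => ht.
  by case: ifP => // th; rewrite fg//; apply/eqP; rewrite eq_le th ht.
Qed.

Section FundamentalGroup.
Context (R : realType) (X : topologicalType) (x : X).

Local Notation I := (I01 R).

Definition loop : Type := {path I from x to x}.

HB.instance Definition _ := Choice.on loop.

Definition homotopic (f g : loop) : Prop :=
  exists H : I * I -> X,
    [/\ continuous H,
        forall t, H (zero, t) = f t,
        forall t, H (one, t) = g t &
        forall s, H (s, zero) = x /\ H (s, one) = x].

Lemma homotopic_refl f : homotopic f f.
Proof.
exists (fun st => f st.2); split=> //.
- move=> [s t]; apply: continuous_comp; first exact: cvg_snd.
  exact: cts_fun.
- by move=> s; rewrite path_zero path_one.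
Qed.

Lemma I01_zeroE : I01val (zero : I) = 0.
Proof. by rewrite clampK ?lexx ?ler01. Qed.

Lemma I01_oneE : I01val (one : I) = 1.
Proof. by rewrite clampK ?lexx ?ler01. Qed.

Lemma clamp0 r : r <= 0 -> clamp r = zero :> I.
Proof.
move=> r0; apply: val_inj; rewrite /= /clamp_val (max_idPl r0).
by rewrite (max_idPl (lexx _)).
Qed.

Lemma clamp1 r : 1 <= r -> clamp r = one :> I.
Proof.
move=> r1; apply: val_inj; rewrite /= /clamp_val.
by rewrite !(max_idPr _) ?(min_idPl _)// ?ler01// (le_trans ler01).
Qed.

Lemma I01val_cont (T : topologicalType) (h : T -> I) :
  continuous h -> continuous (fun t => I01val (h t)).
Proof.
by move=> ch t; apply: continuous_comp; [exact: ch|exact: I01val_continuous].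
Qed.

Lemma clamp_cont (T : topologicalType) (h : T -> R) :
  continuous h -> continuous (fun t => clamp (h t)).
Proof.
by move=> ch t; apply: continuous_comp; [exact: ch|exact: clamp_continuous].
Qed.

Lemma path_cont (T : topologicalType) (f : loop) (h : T -> I) :
  continuous h -> continuous (fun t => f (h t)).
Proof.
by move=> ch t; apply: continuous_comp; [exact: ch|exact: cts_fun].
Qed.

Lemma pair_cont (T U V : topologicalType) (f : T -> U) (g : T -> V) :
  continuous f -> continuous g -> continuous (fun t => (f t, g t)).
Proof. by move=> cf cg t; apply: cvg_pair; [exact: cf|exact: cg]. Qed.

Lemma affine_cont (T : topologicalType) (h : T -> R) (a b : R) :
  continuous h -> continuous (fun t => a * h t + b).
Proof.
move=> ch t; apply: cvgD; last exact: cvg_cst.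
by apply: cvgM; [exact: cvg_cst|exact: ch].
Qed.

Lemma homotopic_sym f g : homotopic f g -> homotopic g f.
Proof.
move=> [H [cH H0 H1 Hx]].
exists (fun st => H (clamp (1 - I01val st.1), st.2)); split.
- have c : continuous (fun st : I * I => (clamp (1 - I01val st.1) : I, st.2)).
    apply: pair_cont; last by move=> ?; exact: cvg_snd.
    apply: clamp_cont => st; apply: cvgB; first exact: cvg_cst.
    by apply: I01val_cont => ?; exact: cvg_fst.
  by move=> st; apply: continuous_comp; [exact: c|exact: cH].
- by move=> t /=; rewrite I01_zeroE subr0 clamp1.
- by move=> t /=; rewrite I01_oneE subrr clamp0.
- by move=> s /=.
Qed.

Lemma homotopic_trans f g h :
  homotopic f g -> homotopic g h -> homotopic f h.
Proof.
move=> [H [cH H0 H1 Hx]] [K [cK K0 K1 Kx]].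
exists (fun st => if I01val st.1 <= 1 / 2
  then H (clamp (2 * I01val st.1 + 0), st.2)
  else K (clamp (2 * I01val st.1 + (- 1)), st.2)).
have c1 : continuous (fun st : I * I => I01val st.1).
  by apply: I01val_cont => ?; exact: cvg_fst.
have c2 b : continuous (fun st : I * I => (clamp (2 * I01val st.1 + b) : I, st.2)).
  apply: pair_cont; last by move=> ?; exact: cvg_snd.
  exact/clamp_cont/affine_cont.
split.
- apply: (continuous_paste c1).
  + by move=> st; apply: continuous_comp; [exact: c2|exact: cH].
  + by move=> st; apply: continuous_comp; [exact: c2|exact: cK].
  + by move=> st ->; rewrite clamp1 ?clamp0 ?H1 ?K0//; lra.
- by move=> t /=; rewrite I01_zeroE ifT ?clamp0 ?H0//; lra.
- by move=> t /=; rewrite I01_oneE ifF ?clamp1 ?K1//; lra.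
- by move=> s /=; case: ifP.
Qed.

Definition homotopicb (f g : loop) : bool := `[< homotopic f g >].

Lemma homotopicb_refl : reflexive homotopicb.
Proof. by move=> f; apply/asboolP/homotopic_refl. Qed.

Lemma homotopicb_sym : symmetric homotopicb.
Proof. by move=> f g; apply: asbool_equiv_eq; split=> /homotopic_sym. Qed.

Lemma homotopicb_trans : transitive homotopicb.
Proof.
by move=> g f h /asboolP fg /asboolP gh; apply/asboolP/(homotopic_trans fg).
Qed.

Canonical homotopic_equiv :=
  EquivRel homotopicb homotopicb_refl homotopicb_sym homotopicb_trans.

Definition pi1 : Type := {eq_quot homotopic_equiv}.

HB.instance Definition _ := Choice.on pi1.
HB.instance Definition _ := Quotient.on pi1.
HB.instance Definition _ := EqQuotient.on pi1.

Definition loop_class (f : loop) : pi1 := \pi_pi1 f.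

Lemma loop_classP f g : loop_class f = loop_class g <-> homotopic f g.
Proof.
split=> [/eqquotP/asboolP//|fg]; first by apply/eqquotP/asboolP.
Qed.

Definition const_loop : loop := cst x.

Definition rev_loop_fun (f : loop) (t : I) : X := f (clamp (- 1 * I01val t + 1)).

Lemma rev_loop_cont f : continuous (rev_loop_fun f).
Proof.
by apply/path_cont/clamp_cont/affine_cont; exact: I01val_continuous.
Qed.

Lemma rev_loop0 f : rev_loop_fun f zero = x.
Proof. by rewrite /rev_loop_fun I01_zeroE clamp1 ?path_one//; lra. Qed.

Lemma rev_loop1 f : rev_loop_fun f one = x.
Proof. by rewrite /rev_loop_fun I01_oneE clamp0 ?path_zero//; lra. Qed.

Definition rev_loop f : loop :=
  mk_path (@rev_loop_cont f) (rev_loop0 f) (rev_loop1 f).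

Definition concat_fun (f g : loop) (t : I) : X :=
  if I01val t <= 1 / 2 then f (clamp (2 * I01val t))
  else g (clamp (2 * I01val t + (- 1))).

Lemma concat_cont f g : continuous (concat_fun f g).
Proof.
apply: continuous_paste; first exact: I01val_continuous.
- apply/path_cont/clamp_cont.
  have -> : (fun t : I => 2 * I01val t) = (fun t : I => 2 * I01val t + 0).
    by apply/funext => t; rewrite addr0.
  by apply: affine_cont; exact: I01val_continuous.
- by apply/path_cont/clamp_cont/affine_cont; exact: I01val_continuous.
- by move=> t ->; rewrite clamp1 ?clamp0 ?path_zero ?path_one//; lra.
Qed.

Lemma concat0 f g : concat_fun f g zero = x.
Proof. by rewrite /concat_fun I01_zeroE ifT ?clamp0 ?path_zero//; lra. Qed.

Lemma concat1 f g : concat_fun f g one = x.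
Proof. by rewrite /concat_fun I01_oneE ifF ?clamp1 ?path_one//; lra. Qed.

Definition concat f g : loop :=
  mk_path (@concat_cont f g) (concat0 f g) (concat1 f g).

Lemma homotopic_concat f f' g g' :
  homotopic f f' -> homotopic g g' -> homotopic (concat f g) (concat f' g').
Proof.
move=> [H [cH H0 H1 Hx]] [K [cK K0 K1 Kx]].
exists (fun st => if I01val st.2 <= 1 / 2
  then H (st.1, clamp (2 * I01val st.2 + 0))
  else K (st.1, clamp (2 * I01val st.2 + (- 1)))).
have c1 : continuous (fun st : I * I => I01val st.2).
  by apply: I01val_cont => ?; exact: cvg_snd.
have c2 b : continuous (fun st : I * I => (st.1, clamp (2 * I01val st.2 + b) : I)).
  apply: pair_cont; first by move=> ?; exact: cvg_fst.
  exact/clamp_cont/affine_cont.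
split.
- apply: (continuous_paste c1).
  + by move=> st; apply: continuous_comp; [exact: c2|exact: cH].
  + by move=> st; apply: continuous_comp; [exact: c2|exact: cK].
  + by move=> [s t] /= ->; rewrite clamp1 ?clamp0 ?(Hx _).2 ?(Kx _).1//; lra.
- by move=> t /=; rewrite H0 K0 addr0.
- by move=> t /=; rewrite H1 K1 addr0.
- move=> s /=; rewrite I01_zeroE I01_oneE ifT; last lra.
  rewrite ifF; last lra.
  rewrite clamp0; last lra.
  by rewrite clamp1 ?(Hx _).1 ?(Kx _).2//; lra.
Qed.

Lemma homotopic_reparam (phi psi : I -> I) (f g h : loop) :
  continuous phi -> continuous psi ->
  phi zero = psi zero -> phi one = psi one ->
  (forall t, g t = f (phi t)) -> (forall t, h t = f (psi t)) ->
  homotopic g h.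
Proof.
move=> cphi cpsi e0 e1 gE hE.
exists (fun st => f (clamp ((1 - I01val st.1) * I01val (phi st.2)
                            + I01val st.1 * I01val (psi st.2)))).
have c1 : continuous (fun st : I * I => I01val st.1).
  by apply: I01val_cont => ?; exact: cvg_fst.
have c2 (k : I -> I) : continuous k ->
    continuous (fun st : I * I => I01val (k st.2)).
  move=> ck; apply: I01val_cont => st.
  by apply: continuous_comp; [exact: cvg_snd|exact: ck].
split.
- apply/path_cont/clamp_cont => st; apply: cvgD; apply: cvgM.
  + by apply: cvgB; [exact: cvg_cst|exact: c1].
  + exact: c2.
  + exact: c1.
  + exact: c2.
- by move=> t /=; rewrite I01_zeroE subr0 mul1r mul0r addr0 I01valK gE.
- by move=> t /=; rewrite I01_oneE subrr mul1r mul0r add0r I01valK hE.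
- move=> s /=; rewrite -e0 -e1 -!mulrDl subrK !mul1r !I01valK.
  by rewrite -!gE path_zero path_one.
Qed.

Lemma concat_fA f g h :
  homotopic (concat f (concat g h)) (concat (concat f g) h).
Proof.
pose k (r : R) : R := Num.min (2 * r) (Num.min (1 * r + 1 / 4) ((1 / 2) * r + 1 / 2)).
pose phi (t : I) : I := clamp (k (I01val t)).
have cphi : continuous phi.
  apply: clamp_cont.
  have ca a b : continuous (fun t : I => a * I01val t + b).
    by apply: affine_cont; exact: I01val_continuous.
  apply: (@min_fun_continuous _ I R (fun t => 2 * I01val t)).
    have -> : (fun t : I => 2 * I01val t) = (fun t : I => 2 * I01val t + 0).
      by apply/funext => t; rewrite addr0.
    exact: ca.
  exact: (@min_fun_continuous _ I R (fun t => 1 * I01val t + 1 / 4)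
    (fun t => 1 / 2 * I01val t + 1 / 2)).
have k01 r : 0 <= r <= 1 -> 0 <= k r <= 1.
  move=> /andP[r0 r1]; rewrite /k /Num.min.
  by do !case: ifP => /=; lra.
have kr1 r : 0 <= r -> r <= 1/4 -> k r = 2 * r.
  by move=> r0 r1; rewrite /k /Num.min; do !case: ifP => /=; lra.
have kr2 r : 1/4 <= r -> r <= 1/2 -> k r = r + 1/4.
  by move=> r0 r1; rewrite /k /Num.min; do !case: ifP => /=; lra.
have kr3 r : 1/2 <= r -> k r = (r + 1)/2.
  by move=> r0; rewrite /k /Num.min; do !case: ifP => /=; lra.
apply/homotopic_sym.
apply: (@homotopic_reparam phi id (concat f (concat g h))) => //.
- by move=> t; exact: cvg_id.
- by rewrite /phi I01_zeroE clamp0// /k /Num.min; do !case: ifP => /=; lra.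
- by rewrite /phi I01_oneE clamp1// /k /Num.min; do !case: ifP => /=; lra.
move=> t; have /andP[t0 t1] := I01P t.
rewrite /= /mk_path /= /concat_fun /= /mk_path /concat_fun.
have -> : I01val (phi t) = k (I01val t) by rewrite clampK ?k01 ?t0.
have [th|th] := lerP (I01val t) (1 / 2).
  rewrite clampK; last by lra.
  have [tq|tq] := lerP (2 * I01val t) (1 / 2).
    rewrite kr1; [|lra..].
    by rewrite ifT; last lra.
  rewrite kr2; [|lra..]; rewrite ifF; last by lra.
  rewrite clampK; last by lra.
  rewrite ifT; last by lra.
  by congr (g (clamp _)); lra.
rewrite kr3; last by lra.
rewrite ifF; last by lra.
rewrite clampK; last by lra.
rewrite ifF; last by lra.
by congr (h (clamp _)); lra.
Qed.

Lemma concat_1f f : homotopic (concat const_loop f) f.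
Proof.
apply: (@homotopic_reparam (fun t => clamp (2 * I01val t + (- 1))) id f) => //.
- by apply: clamp_cont; apply: affine_cont; exact: I01val_continuous.
- by move=> t; exact: cvg_id.
- by rewrite I01_zeroE clamp0//; lra.
- by rewrite I01_oneE clamp1//; lra.
move=> t; rewrite /= /mk_path /concat_fun.
by case: ifP => // th; rewrite [clamp (_ + _)]clamp0 ?path_zero//; lra.
Qed.

Lemma concat_f1 f : homotopic (concat f const_loop) f.
Proof.
apply: (@homotopic_reparam (fun t => clamp (2 * I01val t + 0)) id f) => //.
- by apply: clamp_cont; apply: affine_cont; exact: I01val_continuous.
- by move=> t; exact: cvg_id.
- by rewrite I01_zeroE clamp0//; lra.
- by rewrite I01_oneE clamp1//; lra.
move=> t; rewrite /= /mk_path /concat_fun addr0.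
case: ifP => // /negbT; rewrite -ltNge => th.
by rewrite [X in f X]clamp1 ?path_one//; lra.
Qed.

Lemma concat_fV f : homotopic (concat f (rev_loop f)) const_loop.
Proof.
pose k (r : R) : R := Num.min (2 * r + 0) (- 2 * r + 2).
apply: (@homotopic_reparam (fun t => clamp (k (I01val t))) (cst zero) f) => //.
- apply/clamp_cont/(@min_fun_continuous _ I R (fun t => 2 * I01val t + 0));
    by apply: affine_cont; exact: I01val_continuous.
- exact: cst_continuous.
- by rewrite I01_zeroE clamp0// /k /Num.min; case: ifP => /=; lra.
- by rewrite I01_oneE clamp0// /k /Num.min; case: ifP => /=; lra.
- move=> t; have /andP[t0 t1] := I01P t.
  rewrite /= /mk_path /concat_fun; case: (lerP (I01val t) (1 / 2)) => th.
    by congr (f (clamp _)); rewrite /k /Num.min; case: ifP => /=; lra.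
  rewrite /= /mk_path /rev_loop_fun clampK; last by lra.
  by congr (f (clamp _)); rewrite /k /Num.min; case: ifP => /=; lra.
- by move=> t; rewrite /= path_zero.
Qed.

Lemma rev_loopK f : rev_loop (rev_loop f) = f.
Proof.
apply/path_eqP => t; rewrite /= /mk_path /rev_loop_fun.
have /andP[t0 t1] := I01P t.
rewrite /= /mk_path /rev_loop_fun clampK; last by lra.
by rewrite -[in RHS](I01valK t); congr (f (clamp _)); lra.
Qed.

Lemma concat_Vf f : homotopic (concat (rev_loop f) f) const_loop.
Proof. by rewrite -[in X in concat _ X](rev_loopK f); exact: concat_fV. Qed.

Lemma homotopic_rev f g : homotopic f g -> homotopic (rev_loop f) (rev_loop g).
Proof.
move=> [H [cH H0 H1 Hx]].
exists (fun st => H (st.1, clamp (- 1 * I01val st.2 + 1))); split.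
- have c : continuous (fun st : I * I => (st.1, clamp (- 1 * I01val st.2 + 1) : I)).
    apply: pair_cont; first by move=> ?; exact: cvg_fst.
    by apply/clamp_cont/affine_cont/I01val_cont => ?; exact: cvg_snd.
  by move=> st; apply: continuous_comp; [exact: c|exact: cH].
- by move=> t /=; rewrite H0.
- by move=> t /=; rewrite H1.
- move=> s /=; rewrite I01_zeroE I01_oneE clamp1; last lra.
  by rewrite clamp0 ?(Hx _).1 ?(Hx _).2//; lra.
Qed.

Definition pi1_one : pi1 := loop_class const_loop.
Definition pi1_mul (a b : pi1) : pi1 := loop_class (concat (repr a) (repr b)).
Definition pi1_inv (a : pi1) : pi1 := loop_class (rev_loop (repr a)).

Lemma repr_loop_class f : homotopic (repr (loop_class f)) f.
Proof. by apply/loop_classP; rewrite /loop_class reprK. Qed.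

Lemma pi1_mulE f g :
  pi1_mul (loop_class f) (loop_class g) = loop_class (concat f g).
Proof. by apply/loop_classP/homotopic_concat; exact: repr_loop_class. Qed.

Lemma pi1_invE f : pi1_inv (loop_class f) = loop_class (rev_loop f).
Proof. by apply/loop_classP/homotopic_rev; exact: repr_loop_class. Qed.

Lemma pi1_ind (P : pi1 -> Prop) : (forall f, P (loop_class f)) -> forall a, P a.
Proof. by move=> Pf a; rewrite -[a]reprK; exact: Pf. Qed.

Lemma pi1_mulA : associative pi1_mul.
Proof.
elim/pi1_ind => f; elim/pi1_ind => g; elim/pi1_ind => h.
by rewrite !pi1_mulE; apply/loop_classP/concat_fA.
Qed.

Lemma pi1_mul1g : left_id pi1_one pi1_mul.
Proof.
by elim/pi1_ind => f; rewrite pi1_mulE; apply/loop_classP/concat_1f.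
Qed.

Lemma pi1_mulg1 : right_id pi1_one pi1_mul.
Proof.
by elim/pi1_ind => f; rewrite pi1_mulE; apply/loop_classP/concat_f1.
Qed.

Lemma pi1_mulVg : left_inverse pi1_one pi1_inv pi1_mul.
Proof.
by elim/pi1_ind => f; rewrite pi1_invE pi1_mulE; apply/loop_classP/concat_Vf.
Qed.

Lemma pi1_mulgV : right_inverse pi1_one pi1_inv pi1_mul.
Proof.
by elim/pi1_ind => f; rewrite pi1_invE pi1_mulE; apply/loop_classP/concat_fV.
Qed.

HB.instance Definition _ :=
  isGroup.Build pi1 pi1_mulA pi1_mul1g pi1_mulg1 pi1_mulVg pi1_mulgV.

End FundamentalGroup.
Arguments pi1 R {X} x.

(* Smallest subgroup containing S, G being possibly infinite. *)
Definition generated (G : groupType) (S : set G) : set G :=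
  smallest (fun H : set G => group_closed (mem H)) S.

(* An isomorphism from K onto the subgroup H is recorded as an injective
   homomorphism K -> G with image H. *)
Definition isomorphic_to_subgroup (K G : groupType) (H : set G) : Prop :=
  exists f : {multiplicative K -> G}, injective f /\ range f = H.

Section Configurations.
Context (X : topologicalType) (D : X -> X -> Prop) (n : nat).

(* Configurations are n-tuples of pairwise D-related elements of X with the
   subspace topology of the product X^n; the unordered ones form the quotient
   space under the symmetric group. *)
Definition ordered_conf : Type :=
  [set p : {ptws 'I_n -> X} | forall i j, i != j -> D (p i) (p j)].

HB.instance Definition _ := Topological.copy ordered_conf
  [set p : {ptws 'I_n -> X} | forall i j, i != j -> D (p i) (p j)].

Definition conf_fun (p : ordered_conf) : 'I_n -> X := val p.
Coercion conf_fun : ordered_conf >-> Funclass.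

Definition mk_conf (p : 'I_n -> X) (pD : forall i j, i != j -> D (p i) (p j)) :
  ordered_conf := exist _ (p : {ptws 'I_n -> X}) (mem_set pD).

Lemma ordered_confP (p : ordered_conf) i j : i != j -> D (p i) (p j).
Proof. exact: (set_mem (valP p)). Qed.

Lemma ordered_conf_inj (p q : ordered_conf) : p =1 q -> p = q.
Proof. by move=> pq; apply: val_inj; apply/funext. Qed.

Definition relabel (p q : ordered_conf) : bool :=
  `[< exists s : 'S_n, forall i, q i = p (s i) >].

Lemma relabel_refl : reflexive relabel.
Proof. by move=> p; apply/asboolP; exists 1%g => i; rewrite perm1. Qed.

Lemma relabel_sym : symmetric relabel.
Proof.
have h p q : relabel p q -> relabel q p.
  move=> /asboolP[s sE]; apply/asboolP; exists s^-1%g => i.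
  by rewrite sE permKV.
by move=> p q; apply/idP/idP; exact: h.
Qed.

Lemma relabel_trans : transitive relabel.
Proof.
move=> q p r /asboolP[s sE] /asboolP[u uE]; apply/asboolP.
by exists (u * s)%g => i; rewrite uE sE permM.
Qed.

Canonical relabel_equiv :=
  EquivRel relabel relabel_refl relabel_sym relabel_trans.

Definition unordered_conf : Type :=
  quotient_topology {eq_quot relabel_equiv}.

HB.instance Definition _ := Topological.on unordered_conf.
HB.instance Definition _ := Quotient.on unordered_conf.

Definition forget_order (p : ordered_conf) : unordered_conf :=
  \pi_unordered_conf p.

Lemma forget_order_continuous : continuous forget_order.
Proof. exact: pi_continuous. Qed.

Lemma forget_orderP (p q : ordered_conf) : forget_order p = forget_order q <->
  exists s : 'S_n, forall i, q i = p (s i).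
Proof.
split=> [/eqquotP/asboolP//|pq]; exact/eqquotP/asboolP.
Qed.

End Configurations.

Section Braid.
Context (R : realType) (n : nat).

Definition distinct_points (p q : R * R) : Prop := p <> q.

Lemma base_points_subproof (i j : 'I_n) :
  i != j -> distinct_points ((i : nat)%:R, 0) ((j : nat)%:R, 0).
Proof.
by move=> + [] /eqP; rewrite eqr_nat => /[swap] /eqP/ord_inj ->; rewrite eqxx.
Qed.

Definition base_points : unordered_conf distinct_points n :=
  forget_order (mk_conf base_points_subproof).

Definition braid_group : groupType := pi1 R base_points.

End Braid.

Section Wicket.
Context (R : realType).

(* A wicket in a plane perpendicular to the x-axis is the triple (x, y, r) of its
   center (x, y, 0) and its radius r > 0; spaces of wickets get their topology
   from these parameters. wicket_set is the semicircle itself, which contains its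
   two end points in the plane z = 0. *)
Definition wicket : Type := [set w : R * R * R | 0 < w.2].

HB.instance Definition _ := Topological.copy wicket [set w : R * R * R | 0 < w.2].

Definition wx (w : wicket) : R := (val w).1.1.
Definition wy (w : wicket) : R := (val w).1.2.
Definition wr (w : wicket) : R := (val w).2.

Definition mk_wicket (x y r : R) (r0 : 0 < r) : wicket :=
  exist _ (x, y, r) (mem_set r0).

Definition wicket_set (w : wicket) : set (R * R * R) :=
  [set p | [/\ p.1.1 = wx w,
               (p.1.2 - wy w) ^+ 2 + p.2 ^+ 2 = wr w ^+ 2 &
               0 <= p.2]].

(* The part of the vertical half plane that the semicircle bounds, the
   semicircle itself being excluded. *)
Definition half_disc (w : wicket) : set (R * R * R) :=
  [set p | [/\ p.1.1 = wx w,
               (p.1.2 - wy w) ^+ 2 + p.2 ^+ 2 < wr w ^+ 2 &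
               0 <= p.2]].

Definition disjoint_wickets (v w : wicket) : Prop :=
  wicket_set v `&` wicket_set w = set0.

Definition nested (v w : wicket) : Prop := wicket_set v `<=` half_disc w.

Lemma wicket_inj (v w : wicket) :
  wx v = wx w -> wy v = wy w -> wr v = wr w -> v = w.
Proof.
case: v w => [[[a b] c] vP] [[[d e] f] wP]; rewrite /wx /wy /wr /= => ad be cf.
by apply: val_inj; rewrite /= ad be cf.
Qed.

Lemma disjoint_wx (v w : wicket) : wx v <> wx w -> disjoint_wickets v w.
Proof. by move=> vw; apply/seteqP; split=> // p [[+ _ _] [+ _ _]] => ->. Qed.

End Wicket.

Section WicketGroup.
Context (R : realType) (n : nat).

Local Notation OW := (ordered_conf (@disjoint_wickets R) n).

(* Indices are shifted: i : 'I_n is the (i+1)-st wicket, centered at 4(i+1). *)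
Definition base_wicket (i : 'I_n) : wicket R :=
  mk_wicket (4 * i.+1%:R) 0 ltr01.

Lemma base_wickets_subproof (i j : 'I_n) :
  i != j -> disjoint_wickets (base_wicket i) (base_wicket j).
Proof.
move=> ij; apply: disjoint_wx; rewrite /wx /= => /eqP.
rewrite (inj_eq (mulfI _)) ?pnatr_eq0// eqr_nat eqSS => /eqP/ord_inj/eqP.
exact/negP.
Qed.

Definition base_ordered : OW := mk_conf base_wickets_subproof.

Definition base_wickets : unordered_conf (@disjoint_wickets R) n :=
  forget_order base_ordered.

Definition wicket_group : groupType := pi1 R base_wickets.

(* For i : 'I_n.-1, lo i and hi i are the consecutive indices i and i+1 of 'I_n. *)
Definition lo (i : 'I_n.-1) : 'I_n := widen_ord (leq_pred n) i.

Lemma hi_subproof (i : 'I_n.-1) : (i.+1 < n)%N.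
Proof. by rewrite -ltn_predRL. Qed.

Definition hi (i : 'I_n.-1) : 'I_n := Ordinal (hi_subproof i).

(* w is the lift of f to ordered configurations that starts at base_ordered: it
   says which wicket is which along the loop. Wickets lie in the same plane iff
   they have the same wx. *)
Definition exchange_loop (crossing : wicket R -> wicket R -> Prop)
    (i : 'I_n.-1) (f : loop R base_wickets) : Prop :=
  exists w : I01 R -> OW,
    [/\ continuous w,
        forall t, f t = forget_order (w t),
        w zero = base_ordered,
        w one (lo i) = base_wicket (hi i) /\ w one (hi i) = base_wicket (lo i) &
        [/\ forall t k, k != lo i -> k != hi i -> w t k = base_wicket k,
            forall t k, k != lo i -> k != hi i ->
              wx (w t (lo i)) <> wx (w t k) /\ wx (w t (hi i)) <> wx (w t k) &
            exists t0,
              (forall t, wx (w t (lo i)) = wx (w t (hi i)) <-> t = t0) /\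
              crossing (w t0 (lo i)) (w t0 (hi i))]].

Definition rho_crossing (v w : wicket R) : Prop := nested v w.

Definition sigma_crossing (v w : wicket R) : Prop :=
  [/\ ~ nested v w, ~ nested w v & wy w < wy v].

(* Any two loops satisfying exchange_loop for the same data are homotopic; this
   is not built into the definitions, which accept the class of any such loop. *)
Definition is_rho (i : 'I_n.-1) (a : wicket_group) : Prop :=
  exists2 f, exchange_loop rho_crossing i f & a = loop_class f.

Definition is_sigma (i : 'I_n.-1) (a : wicket_group) : Prop :=
  exists2 f, exchange_loop sigma_crossing i f & a = loop_class f.

Lemma ptws_continuous (T X : topologicalType) (f : T -> {ptws 'I_n -> X}) :
  (forall i, continuous (fun t => f t i)) -> continuous f.
Proof.
move=> cf t; apply/cvg_sup => i; apply/cvg_image; last first.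
  move=> A /cf; rewrite nbhs_simpl /= => fA.
  exists (fun p : 'I_n -> X => A (p i)) => //.
  apply/seteqP; split=> [_ [p /= Ap <-]//|a Aa].
  by exists (fun=> a).
by apply/seteqP; split=> // a _; exists (fun=> a).
Qed.

Lemma wicket_continuous (T : topologicalType) (f : T -> wicket R) :
  continuous (fun t => wx (f t)) -> continuous (fun t => wy (f t)) ->
  continuous (fun t => wr (f t)) -> continuous f.
Proof.
move=> cx cy cr; apply: continuous_set_type.
have -> : (fun t => val (f t)) = (fun t => (wx (f t), wy (f t), wr (f t))).
  by apply/funext => t; rewrite /wx /wy /wr -!surjective_pairing.
by do 2?apply: pair_cont.
Qed.

Section Exchange.
Context (i : 'I_n.-1) (crossing : wicket R -> wicket R -> Prop).
Context (h r : R -> R).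
Context (hc : continuous h).
Context (rc : continuous r).
Context (h0 : h 0 = 0).
Context (h1 : h 1 = 0).
Context (r0 : r 0 = 1).
Context (r1 : r 1 = 1).
Context (rpos : forall t, 0 <= t <= 1 -> 0 < r t).

Let rI (t : I01 R) : 0 < r (I01val t). Proof. exact/rpos/I01P. Qed.

Let W (t : I01 R) (k : 'I_n) : wicket R :=
  if k == lo i then mk_wicket (4 * i.+1%:R + 4 * I01val t) (h (I01val t)) (rI t)
  else if k == hi i then
    mk_wicket (4 * i.+1%:R + 4 - 4 * I01val t) (- h (I01val t)) ltr01
  else base_wicket k.

Let hi_lo : (hi i == lo i) = false.
Proof. by apply/eqP => /(congr1 val)/=; exact/eqP/negbT/gtn_eqF. Qed.

Context (Hdis : forall v w : wicket R, wx v = wx w ->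
  wy v = h (1 / 2) -> wr v = r (1 / 2) -> wy w = - h (1 / 2) -> wr w = 1 ->
  disjoint_wickets v w /\ crossing v w).

Let Wlo t : W t (lo i) =
  mk_wicket (4 * i.+1%:R + 4 * I01val t) (h (I01val t)) (rI t).
Proof. by rewrite /W eqxx. Qed.

Let Whi t : W t (hi i) =
  mk_wicket (4 * i.+1%:R + 4 - 4 * I01val t) (- h (I01val t)) ltr01.
Proof. by rewrite /W hi_lo eqxx. Qed.

Let Wother t k : k != lo i -> k != hi i -> W t k = base_wicket k.
Proof. by rewrite /W => /negbTE -> /negbTE ->. Qed.

Let other_neq (k : 'I_n) (x : R) : k != lo i -> k != hi i ->
  4 * i.+1%:R <= x <= 4 * i.+1%:R + 4 -> x <> 4 * k.+1%:R.
Proof.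
move=> klo khi /andP[x0 x1] xE; move: x0 x1; rewrite {}xE.
have -> : 4 * i.+1%:R + 4 = 4 * i.+2%:R :> R by rewrite -(natr1 i.+1); ring.
rewrite !ler_pM2l// !ler_nat => ik ki; case/negP: khi; rewrite -val_eqE /=.
by rewrite eqn_leq -ltnS ki ltn_neqAle eq_sym klo -ltnS ik.
Qed.

Let WH t : I01val t = 1 / 2 ->
  disjoint_wickets (W t (lo i)) (W t (hi i)) /\ crossing (W t (lo i)) (W t (hi i)).
Proof.
by move=> th; rewrite Wlo Whi; apply: Hdis; rewrite /wx /wy /wr /= ?th//; lra.
Qed.

Let WD t (j k : 'I_n) : j != k -> disjoint_wickets (W t j) (W t k).
Proof.
have sym v w : disjoint_wickets v w -> disjoint_wickets w v :> Prop.
  by rewrite /disjoint_wickets setIC.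
have /andP[t0 t1] := I01P t.
have Dlo l : l != lo i -> l != hi i -> disjoint_wickets (W t (lo i)) (W t l).
  move=> llo lhi; apply: disjoint_wx; rewrite Wlo Wother// /wx /=.
  by apply: other_neq => //; lra.
have Dhi l : l != lo i -> l != hi i -> disjoint_wickets (W t (hi i)) (W t l).
  move=> llo lhi; apply: disjoint_wx; rewrite Whi Wother// /wx /=.
  by apply: other_neq => //; lra.
have Dlohi : disjoint_wickets (W t (lo i)) (W t (hi i)).
  have [th|th] := eqVneq (I01val t) (1 / 2); first exact: (WH th).1.
  apply: disjoint_wx; rewrite Wlo Whi /wx /= => e.
  by move/eqP: th; apply; lra.
have [-> | jlo] := eqVneq j (lo i).
  have [-> _ // | khi klo] := eqVneq k (hi i).
  by apply: Dlo => //; rewrite eq_sym.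
have [-> | jhi] := eqVneq j (hi i).
  have [-> _ | klo khi] := eqVneq k (lo i); first exact: sym.
  by apply: Dhi => //; rewrite eq_sym.
have [-> _ | klo] := eqVneq k (lo i); first exact/sym/Dlo.
have [-> _ | khi] := eqVneq k (hi i); first exact/sym/Dhi.
by rewrite !Wother// => jk; exact: base_wickets_subproof.
Qed.

Let conf t : OW := mk_conf (@WD t).

Let conf_continuous : continuous conf.
Proof.
apply: continuous_set_type; apply: ptws_continuous => k.
have vc := @I01val_continuous R.
have vcomp (g : R -> R) : continuous g -> continuous (fun t => g (I01val t)).
  by move=> gc t; apply: continuous_comp; [exact: vc|exact: gc].
have [->|klo] := eqVneq k (lo i).
  have -> : (fun t => val (conf t) (lo i)) = W ^~ (lo i) by [].
  apply: wicket_continuous.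
  - rewrite (_ : (fun t => _) = (fun t => 4 * I01val t + 4 * i.+1%:R)).
      exact: affine_cont.
    by apply/funext => t; rewrite Wlo /wx /= addrC.
  - rewrite (_ : (fun t => _) = (fun t => h (I01val t))); first exact: vcomp.
    by apply/funext => t; rewrite Wlo.
  - rewrite (_ : (fun t => _) = (fun t => r (I01val t))); first exact: vcomp.
    by apply/funext => t; rewrite Wlo.
have [->|khi] := eqVneq k (hi i).
  have -> : (fun t => val (conf t) (hi i)) = W ^~ (hi i) by [].
  apply: wicket_continuous.
  - rewrite (_ : (fun t => _) = (fun t => (- 4) * I01val t + (4 * i.+1%:R + 4))).
      exact: affine_cont.
    by apply/funext => t; rewrite Whi /wx /=; ring.
  - rewrite (_ : (fun t => _) = (fun t => - h (I01val t))).
      by apply: (vcomp (fun x => - h x)) => x; apply: cvgN; exact: hc.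
    by apply/funext => t; rewrite Whi.
  - rewrite (_ : (fun t => _) = cst 1); first exact: cst_continuous.
    by apply/funext => t; rewrite Whi.
have -> : (fun t => val (conf t) k) = cst (base_wicket k).
  by apply/funext => t; rewrite /= Wother.
exact: cst_continuous.
Qed.

Let conf0 : conf zero = base_ordered.
Proof.
apply: ordered_conf_inj => k; rewrite /conf_fun /=.
have [->|klo] := eqVneq k (lo i).
  rewrite Wlo; apply: wicket_inj; rewrite /wx /wy /wr /= ?I01_zeroE//.
  by rewrite mulr0 addr0.
have [->|khi] := eqVneq k (hi i); last exact: Wother.
rewrite Whi; apply: wicket_inj; rewrite /wx /wy /wr /= ?I01_zeroE ?h0 ?oppr0//.
by rewrite -[in RHS](natr1 i.+1); ring.
Qed.

Let conf1lo : conf one (lo i) = base_wicket (hi i).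
Proof.
rewrite /conf_fun /= Wlo; apply: wicket_inj; rewrite /wx /wy /wr /= ?I01_oneE//.
by rewrite -[in RHS](natr1 i.+1); ring.
Qed.

Let conf1hi : conf one (hi i) = base_wicket (lo i).
Proof.
rewrite /conf_fun /= Whi; apply: wicket_inj; rewrite /wx /wy /wr /= ?I01_oneE ?h1 ?oppr0//.
by ring.
Qed.

Let path0 : forget_order (conf zero) = base_wickets.
Proof. by rewrite conf0. Qed.

Let path1 : forget_order (conf one) = base_wickets.
Proof.
apply/forget_orderP; exists (tperm (lo i) (hi i)) => k.
have [->|klo] := eqVneq k (lo i); first by rewrite tpermL conf1hi.
have [->|khi] := eqVneq k (hi i); first by rewrite tpermR conf1lo.
by rewrite tpermD 1?eq_sym// /conf_fun /= Wother.
Qed.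

Let path_continuous : continuous (fun t => forget_order (conf t)).
Proof.
move=> t; apply: continuous_comp; first exact: conf_continuous.
exact: forget_order_continuous.
Qed.

Lemma exchange_loop_exists : exists f, exchange_loop crossing i f.
Proof.
exists (mk_path path_continuous path0 path1), conf; split=> //.
split=> [t k klo khi|t k klo khi|].
- exact: Wother.
- have /andP[t0 t1] := I01P t.
  rewrite /conf_fun /= Wlo Whi Wother// /wx /=.
  by split; apply: other_neq => //; lra.
- have ht : I01val (clamp (1 / 2) : I01 R) = 1 / 2 by rewrite clampK//; lra.
  exists (clamp (1 / 2)); split; last exact: (WH ht).2.
  move=> t; rewrite /conf_fun /= Wlo Whi /wx /=; split=> [e|->].
    by rewrite -[LHS]I01valK; congr clamp; lra.
  by rewrite ht; lra.
Qed.

End Exchange.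

(* The descriptions of rho_i and sigma_i are satisfiable. *)
Lemma is_rho_exists (i : 'I_n.-1) : exists a, is_rho i a.
Proof.
pose r (t : R) : R := 1 - 2 * (t * (1 - t)).
have rc : continuous r.
  move=> t; apply: cvgB; first exact: cvg_cst.
  apply: cvgM; first exact: cvg_cst.
  by apply: cvgM; [exact: cvg_id|apply: cvgB; [exact: cvg_cst|exact: cvg_id]].
have r0 : r 0 = 1 by rewrite /r; ring.
have r1 : r 1 = 1 by rewrite /r; ring.
have rpos t : 0 <= t <= 1 -> 0 < r t by rewrite /r => ?; nra.
have hc : continuous (cst 0 : R -> R) by exact: cst_continuous.
have [|f fP] := @exchange_loop_exists i rho_crossing _ r hc rc erefl erefl r0 r1 rpos.
  move=> v w xvw /= yv rv yw rw.
  have N : nested v w.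
    move=> p [px e pz]; split=> //; first by rewrite px.
    by move: e; rewrite yv rv yw rw !oppr0 /r => ->; lra.
  split=> //; apply/seteqP; split=> // p [/N[_ /= n1 _] [_ /= n2 _]].
  by move: n1; rewrite n2 ltxx.
by exists (loop_class f), f.
Qed.

Lemma is_sigma_exists (i : 'I_n.-1) : exists a, is_sigma i a.
Proof.
pose h (t : R) : R := 8 * (t * (1 - t)).
have hc : continuous h.
  move=> t; apply: cvgM; first exact: cvg_cst.
  by apply: cvgM; [exact: cvg_id|apply: cvgB; [exact: cvg_cst|exact: cvg_id]].
have h0 : h 0 = 0 by rewrite /h; ring.
have h1 : h 1 = 0 by rewrite /h; ring.
have hh : h (1 / 2) = 2 by rewrite /h; field.
have rc : continuous (cst 1 : R -> R) by exact: cst_continuous.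
have rpos t : 0 <= t <= 1 -> 0 < (cst 1 : R -> R) t by move=> _ /=.
have [|f fP] := @exchange_loop_exists i sigma_crossing h _ hc rc h0 h1 erefl erefl rpos.
  rewrite hh => v w xvw /= yv rv yw rw; split.
    apply/seteqP; split=> // -[[x y] z] [[_ /= e1 _] [_ /= e2 _]].
    by move: e1 e2; rewrite yv rv yw rw => e1 e2; nra.
  split; last by rewrite yv yw; lra.
  - move=> /(_ (wx v, wy v, 1)); case=> /=; first split => //=.
    + by rewrite rv; ring.
    + by move=> _; rewrite yv yw rw => e _; lra.
  - move=> /(_ (wx w, wy w, 1)); case=> /=; first split => //=.
    + by rewrite rw; ring.
    + by move=> _; rewrite yv yw rv => e _; lra.
by exists (loop_class f), f.
Qed.

End WicketGroup.

(* Main.v *)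
(* Wickets in one plane perpendicular to the x-axis are disjoint iff the
   intervals [y - r, y + r] cut out by their end points are strictly nested or
   disjoint; in both cases their right ends y + r differ. So a configuration of
   wickets yields the configuration of points (x, y + r) of the plane, in which sigma_i
   is sent to a half twist and rho_i to an inverse half twist. Conversely a
   configuration of points yields small wickets around the points, or nested
   concentric wickets in each plane, with radius exp (- y); these maps send half
   twists to sigma_i, resp. rho_i, and are split by maps back to points, up to
   an isotopy. As linear interpolation shows, the loops described by
   exchange_loop are determined up to homotopy by i and the kind of crossing.
   It remains to see that half twists generate the braid group: this can be
   checked in small boxes around a configuration, where any path is homotopic to
   one that sorts the abscissas by adjacent exchanges. *)

Require Import Defs.
From HB Require Import structures.
From mathcomp Require Import all_boot all_order all_algebra generic_quotient perm.
From mathcomp Require Import all_classical all_reals all_analysis.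
From mathcomp Require Import continuous_path ring lra zify.

Set Implicit Arguments.
Unset Strict Implicit.
Unset Printing Implicit Defensive.

Import Order.TTheory GRing.Theory Num.Theory.
Import numFieldNormedType.Exports.

Local Open Scope classical_set_scope.
Local Open Scope ring_scope.
Local Open Scope quotient_scope.


(** * The path groupoid *)

(** No presentation of the braid group enters, and no relation between the [sigma i] or the [rho i]
    is ever computed. Since [pi1] is pointed, the maps between points and wickets have to match the
    base configurations exactly: this dictates the scaling [4 * x + 4] of the abscissas and the
    constants 1 in the ordinates. Points know a single kind of crossing, [above], and both families
    are compared with it; for nested wickets the map back to points therefore changes the sign of
    the right end, so that the inner wicket becomes the upper point. The obstacle in generating the
    braid group is that a merely continuous path may make abscissas coincide in arbitrarily
    complicated ways, and no general position is available. So crossings of a given path are never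
    inspected: short detours bring the ends of small pieces to distinct abscissas, and each piece,
    lying in a convex box, is replaced as a whole by a piecewise linear sorting path with the same
    ends. *)

Section PathOperations.
Context (R : realType) (X : Type).
Local Notation I := (I01 R).
Implicit Types (f g : I -> X).

(** Paths are bare functions, with continuity and matching ends as side conditions, so that end
    points never occur in types. The formula is that of [concat_fun], which makes [path_cat] of two
    loops convertible to [concat]. *)
Definition path_cat f g (t : I) : X :=
  if I01val t <= 1 / 2 then f (clamp (2 * I01val t))
  else g (clamp (2 * I01val t + (- 1))).

Definition path_rev f (t : I) : X := f (clamp (- 1 * I01val t + 1)).

(** The case [b < a] is meaningful: the piece is run backwards. Reachability is propagated to both
    sides of a time in this way. *)
Definition path_seg f (a b : R) (t : I) : X := f (clamp ((b - a) * I01val t + a)).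

Lemma path_cat0 f g : path_cat f g zero = f zero.
Proof. by rewrite /path_cat I01_zeroE ifT ?clamp0//; lra. Qed.

Lemma path_cat1 f g : path_cat f g one = g one.
Proof. by rewrite /path_cat I01_oneE ifF ?clamp1//; lra. Qed.

Lemma path_rev0 f : path_rev f zero = f one.
Proof. by rewrite /path_rev I01_zeroE clamp1//; lra. Qed.

Lemma path_rev1 f : path_rev f one = f zero.
Proof. by rewrite /path_rev I01_oneE clamp0//; lra. Qed.

End PathOperations.

Lemma path_catP (R : realType) (X : Type) (f g : I01 R -> X) (P : X -> Prop) :
  (forall t, P (f t)) -> (forall t, P (g t)) -> forall t, P (path_cat f g t).
Proof. by move=> Pf Pg t; rewrite /path_cat; case: ifP. Qed.

Lemma path_cat_comp (R : realType) (X Y : Type) (F : X -> Y) (f g : I01 R -> X) :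
  F \o path_cat f g = path_cat (F \o f) (F \o g).
Proof. by apply/funext => t; rewrite /path_cat /=; case: ifP. Qed.

Section Paths.
Context (R : realType) (X : topologicalType).

Local Notation I := (I01 R).
Implicit Types (f g h : I -> X).

Definition path_homotopic f g : Prop :=
  exists H : I * I -> X,
    [/\ continuous H,
        forall t, H (zero, t) = f t,
        forall t, H (one, t) = g t &
        forall s, H (s, zero) = f zero /\ H (s, one) = f one].

Lemma clamp_comp_cont (T : topologicalType) f (k : T -> R) :
  continuous f -> continuous k -> continuous (fun t => f (clamp (k t))).
Proof.
by move=> cf ck t; apply: continuous_comp; [exact: clamp_cont|exact: cf].
Qed.

Lemma affine_I01_cont (a b : R) : continuous (fun t : I => a * I01val t + b).
Proof. by apply: affine_cont; exact: I01val_continuous. Qed.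

Lemma scale_I01_cont (a : R) : continuous (fun t : I => a * I01val t).
Proof.
rewrite (_ : (fun t : I => a * I01val t) = (fun t : I => a * I01val t + 0)).
  exact: affine_I01_cont.
by apply/funext => t; rewrite addr0.
Qed.

Lemma clamp_zero : clamp 0 = zero :> I.
Proof. by rewrite clamp0. Qed.

Lemma clamp_one : clamp 1 = one :> I.
Proof. by rewrite clamp1. Qed.

Lemma path_cat_cont f g : continuous f -> continuous g -> f one = g zero ->
  continuous (path_cat f g).
Proof.
move=> cf cg fg; apply: continuous_paste; first exact: I01val_continuous.
- by apply: clamp_comp_cont => //; exact: scale_I01_cont.
- by apply: clamp_comp_cont => //; exact: affine_I01_cont.
- by move=> t ->; rewrite clamp1 ?clamp0//; lra.
Qed.

Lemma path_rev_cont f : continuous f -> continuous (path_rev f).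
Proof. by move=> cf; apply: clamp_comp_cont => //; exact: affine_I01_cont. Qed.

Lemma path_seg_cont f a b : continuous f -> continuous (path_seg f a b).
Proof. by move=> cf; apply: clamp_comp_cont => //; exact: affine_I01_cont. Qed.

Lemma path_seg0 f a b : path_seg f a b zero = f (clamp a).
Proof. by rewrite /path_seg I01_zeroE mulr0 add0r. Qed.

Lemma path_seg1 f a b : path_seg f a b one = f (clamp b).
Proof. by rewrite /path_seg I01_oneE mulr1 subrK. Qed.

Lemma path_homotopic_ends f g : path_homotopic f g ->
  g zero = f zero /\ g one = f one.
Proof.
by move=> [H [_ _ H1 He]]; rewrite -!H1 (He one).1 (He one).2.
Qed.

Lemma path_homotopic_refl f : continuous f -> path_homotopic f f.
Proof.
move=> cf; exists (fun st => f st.2); split=> // st.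
by apply: continuous_comp; [exact: cvg_snd|exact: cf].
Qed.

Lemma path_homotopic_sym f g : path_homotopic f g -> path_homotopic g f.
Proof.
move=> fg; have [g0 g1] := path_homotopic_ends fg.
move: fg => [H [cH H0 H1 He]].
exists (fun st => H (clamp (- 1 * I01val st.1 + 1), st.2)); split.
- have c : continuous (fun st : I * I => (clamp (- 1 * I01val st.1 + 1) : I, st.2)).
    apply: pair_cont; last by move=> ?; exact: cvg_snd.
    apply: clamp_cont; apply: affine_cont.
    by apply: I01val_cont => ?; exact: cvg_fst.
  by move=> st; apply: continuous_comp; [exact: c|exact: cH].
- by move=> t /=; rewrite I01_zeroE clamp1//; lra.
- by move=> t /=; rewrite I01_oneE clamp0//; lra.
- by move=> s /=; rewrite g0 g1.
Qed.

Lemma path_homotopic_trans g f h :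
  path_homotopic f g -> path_homotopic g h -> path_homotopic f h.
Proof.
move=> fg; have [g0 g1] := path_homotopic_ends fg.
move: fg => [H [cH H0 H1 He]] [K [cK K0 K1 Ke]].
have c1 : continuous (fun st : I * I => I01val st.1).
  by apply: I01val_cont => ?; exact: cvg_fst.
have c2 b : continuous (fun st : I * I => (clamp (2 * I01val st.1 + b) : I, st.2)).
  by apply: pair_cont; [exact/clamp_cont/affine_cont|move=> ?; exact: cvg_snd].
exists (fun st => if I01val st.1 <= 1 / 2
  then H (clamp (2 * I01val st.1 + 0), st.2)
  else K (clamp (2 * I01val st.1 + (- 1)), st.2)); split.
- apply: (continuous_paste c1).
  + by move=> st; apply: continuous_comp; [exact: c2|exact: cH].
  + by move=> st; apply: continuous_comp; [exact: c2|exact: cK].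
  + by move=> st ->; rewrite clamp1 ?clamp0 ?H1 ?K0//; lra.
- by move=> t /=; rewrite I01_zeroE ifT ?clamp0 ?H0//; lra.
- by move=> t /=; rewrite I01_oneE ifF ?clamp1 ?K1//; lra.
- by move=> s /=; rewrite (Ke _).1 (Ke _).2 (He _).1 (He _).2 g0 g1; case: ifP.
Qed.

Lemma path_homotopic_cat f f' g g' : f one = g zero ->
  path_homotopic f f' -> path_homotopic g g' ->
  path_homotopic (path_cat f g) (path_cat f' g').
Proof.
move=> fg [H [cH H0 H1 He]] [K [cK K0 K1 Ke]].
have c1 : continuous (fun st : I * I => I01val st.2).
  by apply: I01val_cont => ?; exact: cvg_snd.
have c2 b : continuous (fun st : I * I => (st.1, clamp (2 * I01val st.2 + b) : I)).
  by apply: pair_cont; [move=> ?; exact: cvg_fst|exact/clamp_cont/affine_cont].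
exists (fun st => if I01val st.2 <= 1 / 2
  then H (st.1, clamp (2 * I01val st.2 + 0))
  else K (st.1, clamp (2 * I01val st.2 + (- 1)))); split.
- apply: (continuous_paste c1).
  + by move=> st; apply: continuous_comp; [exact: c2|exact: cH].
  + by move=> st; apply: continuous_comp; [exact: c2|exact: cK].
  + move=> [s t] /= ->; rewrite clamp1; last lra.
    by rewrite clamp0 ?(He _).2 ?(Ke _).1//; lra.
- by move=> t /=; rewrite H0 K0 addr0.
- by move=> t /=; rewrite H1 K1 addr0.
- move=> s /=; rewrite path_cat0 path_cat1 I01_zeroE I01_oneE.
  rewrite ifT; last lra.
  rewrite ifF; last lra.
  rewrite clamp0; last lra.
  by rewrite clamp1 ?(He _).1 ?(Ke _).2//; lra.
Qed.

Lemma path_homotopic_catl g f f' : continuous g -> f one = g zero ->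
  path_homotopic f f' -> path_homotopic (path_cat f g) (path_cat f' g).
Proof.
by move=> cg fg ff'; apply: path_homotopic_cat => //; exact: path_homotopic_refl.
Qed.

Lemma path_homotopic_catr f g g' : continuous f -> f one = g zero ->
  path_homotopic g g' -> path_homotopic (path_cat f g) (path_cat f g').
Proof.
by move=> cf fg gg'; apply: path_homotopic_cat => //; exact: path_homotopic_refl.
Qed.

(* The real line is convex: two paths that factor through one map from it, with
   the same end points there, are homotopic. *)
Lemma path_homotopic_factor (F : R -> X) (phi psi : I -> R) f g :
  continuous F -> continuous phi -> continuous psi ->
  phi zero = psi zero -> phi one = psi one ->
  (forall t, f t = F (phi t)) -> (forall t, g t = F (psi t)) ->
  path_homotopic f g.
Proof.
move=> cF cphi cpsi e0 e1 fE gE.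
exists (fun st => F ((1 - I01val st.1) * phi st.2 + I01val st.1 * psi st.2)).
have c1 : continuous (fun st : I * I => I01val st.1).
  by apply: I01val_cont => ?; exact: cvg_fst.
have c2 (k : I -> R) : continuous k -> continuous (fun st : I * I => k st.2).
  by move=> ck st; apply: continuous_comp; [exact: cvg_snd|exact: ck].
split.
- move=> st; apply: continuous_comp; last exact: cF.
  apply: cvgD; apply: cvgM.
  + by apply: cvgB; [exact: cvg_cst|exact: c1].
  + exact: c2.
  + exact: c1.
  + exact: c2.
- by move=> t /=; rewrite I01_zeroE subr0 mul1r mul0r addr0 fE.
- by move=> t /=; rewrite I01_oneE subrr mul1r mul0r add0r gE.
- by move=> s /=; rewrite -e0 -e1 -!mulrDl subrK !mul1r !fE.
Qed.

Let track f g h (r : R) : X :=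
  if r <= 1 then f (clamp r)
  else if r <= 2 then g (clamp (1 * r + (- 1))) else h (clamp (1 * r + (- 2))).

Let track_cont f g h : continuous f -> continuous g -> continuous h ->
  f one = g zero -> g one = h zero -> continuous (track f g h).
Proof.
move=> cf cg ch fg gh.
have ci : continuous (@id R) by move=> t; exact: cvg_id.
apply: (continuous_paste ci).
- exact: clamp_comp_cont.
- apply: (continuous_paste ci).
  + by apply: clamp_comp_cont => //; exact: affine_cont.
  + by apply: clamp_comp_cont => //; exact: affine_cont.
  + by move=> t ->; rewrite clamp1 ?clamp0 ?gh//; lra.
- move=> t ->; rewrite clamp1 ?lexx// ifT; last lra.
  by rewrite clamp0//; lra.
Qed.

(** Both bracketings run along [track], where [f], [g], [h] occupy [[0, 1]], [[1, 2]], [[2, 3]].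
    Their piecewise affine time changes are a maximum and a minimum of two affine functions, so
    their continuity is immediate. *)
Lemma path_catA f g h : continuous f -> continuous g -> continuous h ->
  f one = g zero -> g one = h zero ->
  path_homotopic (path_cat f (path_cat g h)) (path_cat (path_cat f g) h).
Proof.
move=> cf cg ch fg gh.
apply: (@path_homotopic_factor (track f g h)
  (fun t => Num.max (2 * I01val t) (4 * I01val t + (- 1)))
  (fun t => Num.min (4 * I01val t) (2 * I01val t + 1))).
- exact: track_cont.
- apply: (@max_fun_continuous _ I R (fun t => 2 * I01val t)).
    exact: scale_I01_cont.
  exact: affine_I01_cont.
- apply: (@min_fun_continuous _ I R (fun t => 4 * I01val t)).
    exact: scale_I01_cont.
  exact: affine_I01_cont.
- by rewrite I01_zeroE /Num.min /Num.max; do !case: ifP => /=; lra.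
- by rewrite I01_oneE /Num.min /Num.max; do !case: ifP => /=; lra.
- move=> t; have /andP[t0 t1] := I01P t; rewrite /path_cat /track.
  have [th|th] /= := lerP (I01val t) (1 / 2).
    rewrite (max_idPl _); last lra.
    by rewrite ifT//; lra.
  rewrite (max_idPr _); last lra.
  rewrite clampK; last lra.
  have [tq|tq] /= := lerP (2 * I01val t + (- 1)) (1 / 2).
    rewrite ifF; last lra.
    by rewrite ifT; last lra; congr (g (clamp _)); lra.
  rewrite ifF; last lra.
  by rewrite ifF; last lra; congr (h (clamp _)); lra.
- move=> t; have /andP[t0 t1] := I01P t; rewrite /path_cat /track.
  have [th|th] /= := lerP (I01val t) (1 / 2).
    rewrite (min_idPl _); last lra.
    rewrite clampK; last lra.
    have [tq|tq] /= := lerP (2 * I01val t) (1 / 2).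
      by rewrite ifT; last lra; congr (f (clamp _)); lra.
    rewrite ifF; last lra.
    by rewrite ifT; last lra; congr (g (clamp _)); lra.
  rewrite (min_idPr _); last lra.
  rewrite ifF; last lra.
  rewrite ifF; last lra.
  by congr (h (clamp _)); lra.
Qed.

Lemma path_homotopic_reparam f g (phi psi : I -> R) h : continuous f ->
  continuous phi -> continuous psi ->
  phi zero = psi zero -> phi one = psi one ->
  (forall t, g t = f (clamp (phi t))) -> (forall t, h t = f (clamp (psi t))) ->
  path_homotopic g h.
Proof.
move=> cf cphi cpsi e0 e1; apply: (path_homotopic_factor (F := f \o @clamp R)) => //.
by apply: clamp_comp_cont => // t; exact: cvg_id.
Qed.

Lemma path_cat1f f : continuous f ->
  path_homotopic (path_cat (cst (f zero)) f) f.
Proof.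
move=> cf; apply: (@path_homotopic_reparam f _
  (fun t => Num.max 0 (2 * I01val t + (- 1))) (@I01val R)) => //.
- apply: (@max_fun_continuous _ I R (cst 0)); first exact: cst_continuous.
  exact: affine_I01_cont.
- exact: I01val_continuous.
- by rewrite I01_zeroE /Num.max; case: ifP => /=; lra.
- by rewrite I01_oneE /Num.max; case: ifP => /=; lra.
- move=> t; rewrite /path_cat; have [th|th] /= := lerP (I01val t) (1 / 2).
    by rewrite (max_idPl _) ?clamp_zero//; lra.
  by rewrite (max_idPr _)//; lra.
- by move=> t; rewrite I01valK.
Qed.

Lemma path_catf1 f : continuous f ->
  path_homotopic (path_cat f (cst (f one))) f.
Proof.
move=> cf; apply: (@path_homotopic_reparam f _
  (fun t => Num.min 1 (2 * I01val t)) (@I01val R)) => //.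
- apply: (@min_fun_continuous _ I R (cst 1)); first exact: cst_continuous.
  exact: scale_I01_cont.
- exact: I01val_continuous.
- by rewrite I01_zeroE /Num.min; case: ifP => /=; lra.
- by rewrite I01_oneE /Num.min; case: ifP => /=; lra.
- move=> t; rewrite /path_cat; have [th|th] /= := lerP (I01val t) (1 / 2).
    by rewrite (min_idPr _)//; lra.
  by rewrite (min_idPl _) ?clamp_one//; lra.
- by move=> t; rewrite I01valK.
Qed.

Lemma path_catfV f : continuous f ->
  path_homotopic (path_cat f (path_rev f)) (cst (f zero)).
Proof.
move=> cf; apply: (@path_homotopic_reparam f _
  (fun t => Num.min (2 * I01val t) (- 2 * I01val t + 2)) (cst 0)) => //.
- apply: (@min_fun_continuous _ I R (fun t => 2 * I01val t)).
    exact: scale_I01_cont.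
  exact: affine_I01_cont.
- exact: cst_continuous.
- by rewrite I01_zeroE /Num.min; case: ifP => /=; lra.
- by rewrite I01_oneE /Num.min; case: ifP => /=; lra.
- move=> t; have /andP[t0 t1] := I01P t; rewrite /path_cat.
  have [th|th] /= := lerP (I01val t) (1 / 2).
    by rewrite (min_idPl _)//; lra.
  rewrite (min_idPr _) /path_rev; last lra.
  by rewrite clampK; [congr (f (clamp _)); lra|lra].
Qed.

Lemma path_revK f : path_rev (path_rev f) = f.
Proof.
apply/funext => t; have /andP[t0 t1] := I01P t; rewrite /path_rev.
rewrite clampK; last lra.
by rewrite -[in RHS](I01valK t); congr (f (clamp _)); lra.
Qed.

Lemma path_catVf f : continuous f ->
  path_homotopic (path_cat (path_rev f) f) (cst (f one)).
Proof.
move=> cf; rewrite -[in X in path_cat _ X](path_revK f) -path_rev0.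
exact/path_catfV/path_rev_cont.
Qed.

Lemma path_cat_seg f a b c : continuous f ->
  path_homotopic (path_cat (path_seg f a b) (path_seg f b c)) (path_seg f a c).
Proof.
move=> cf; apply: (@path_homotopic_reparam f _
  (fun t => if I01val t <= 1 / 2 then ((b - a) * 2) * I01val t + a
            else ((c - b) * 2) * I01val t + (b + b - c))
  (fun t => (c - a) * I01val t + a)) => //.
- apply: continuous_paste; first exact: I01val_continuous.
  + exact: affine_I01_cont.
  + exact: affine_I01_cont.
  + by move=> t ->; field.
- exact: affine_I01_cont.
- by rewrite I01_zeroE ifT; [ring|lra].
- by rewrite I01_oneE ifF; [ring|lra].
- move=> t; have /andP[t0 t1] := I01P t; rewrite /path_cat /path_seg.
  case: (lerP (I01val t) (1 / 2)) => th /=;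
    by rewrite clampK; [congr (f (clamp _)); ring|lra].
Qed.

End Paths.

Section PathMap.
Context (R : realType) (X Y : topologicalType) (F : X -> Y).
Hypothesis cF : continuous F.

Lemma path_homotopic_comp (f g : I01 R -> X) :
  path_homotopic f g -> path_homotopic (F \o f) (F \o g).
Proof.
move=> [H [cH H0 H1 He]]; exists (F \o H); split=> /=.
- by move=> st; apply: continuous_comp; [exact: cH|exact: cF].
- by move=> t; rewrite H0.
- by move=> t; rewrite H1.
- by move=> s; rewrite (He s).1 (He s).2.
Qed.

End PathMap.

Section LoopClass.
Context (R : realType) (X : topologicalType) (x : X).

Local Notation I := (I01 R).

Definition is_loop (f : I -> X) : Prop :=
  [/\ continuous f, f zero = x & f one = x].

(* Junk value: the trivial class if f is not a loop. *)
Definition fun_class (f : I -> X) : pi1 R x :=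
  match pselect (is_loop f) with
  | left fP => let: And3 cf f0 f1 := fP in
      loop_class (mk_path cf f0 f1 : loop R x)
  | right _ => pi1_one R x
  end.

Lemma loop_is_loop (l : loop R x) : is_loop l.
Proof. by split; [exact: cts_fun|exact: path_zero|exact: path_one]. Qed.

Lemma fun_classE (l : loop R x) : fun_class l = loop_class l.
Proof.
rewrite /fun_class; case: pselect => [[cf f0 f1]|/(_ (loop_is_loop l))//].
by congr loop_class; apply/path_eqP.
Qed.

Lemma is_loopP (f : I -> X) : is_loop f -> exists l : loop R x, l = f :> (I -> X).
Proof. by move=> [cf f0 f1]; exists (mk_path cf f0 f1). Qed.

Lemma path_homotopic_loop (f g : I -> X) :
  path_homotopic f g -> is_loop f -> continuous g -> is_loop g.
Proof.
by move=> /path_homotopic_ends[g0 g1] [_ f0 f1] cg; split; rewrite ?g0 ?g1.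
Qed.

Lemma homotopicE (f g : loop R x) : homotopic f g <-> path_homotopic f g.
Proof.
split=> -[H [cH H0 H1 He]]; exists H; split=> // s.
- by have [-> ->] := He s; rewrite path_zero path_one.
- by have [-> ->] := He s; rewrite path_zero path_one.
Qed.

Lemma fun_class_homotopic (f g : I -> X) : is_loop f -> continuous g ->
  path_homotopic f g -> fun_class f = fun_class g.
Proof.
move=> lf cg fg; have /is_loopP[l' gE] := path_homotopic_loop fg lf cg.
move: lf => /is_loopP[l fE]; rewrite -fE -gE !fun_classE.
by apply/loop_classP/homotopicE; rewrite fE gE.
Qed.

Lemma fun_class_cat (f g : I -> X) : is_loop f -> is_loop g ->
  fun_class (path_cat f g) = (fun_class f * fun_class g)%g.
Proof.
move=> /is_loopP[l <-] /is_loopP[l' <-]; rewrite !fun_classE.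
rewrite [RHS](pi1_mulE l l') -fun_classE; congr fun_class.
Qed.

Lemma fun_class_cst : fun_class (cst x) = 1%g.
Proof. by rewrite (fun_classE (const_loop R x)). Qed.

End LoopClass.

(** * A local criterion for generating the fundamental group *)

Section LocalToGlobal.
Context (R : realType) (X : topologicalType) (x : X).
Local Notation I := (I01 R).

(* gamma u joins the base point x to u, for u in U; paths with ends in U are
   closed up with it. *)
Context (U : set X) (gamma : X -> I -> X).
Hypothesis Ux : U x.
Hypothesis gamma_cont : forall u, U u -> continuous (gamma u).
Hypothesis gamma0 : forall u, U u -> gamma u zero = x.
Hypothesis gamma1 : forall u, U u -> gamma u one = u.
Hypothesis gamma_base : gamma x = cst x.

Definition is_Upath (h : I -> X) : Prop :=
  [/\ continuous h, U (h zero) & U (h one)].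

Definition close_up (h : I -> X) : I -> X :=
  path_cat (gamma (h zero)) (path_cat h (path_rev (gamma (h one)))).

Definition closed_class (h : I -> X) : pi1 R x := fun_class x (close_up h).

Let tail_cont h : is_Upath h ->
  continuous (path_cat h (path_rev (gamma (h one)))).
Proof.
move=> [ch _ U1]; apply: path_cat_cont => //.
  exact/path_rev_cont/gamma_cont.
by rewrite path_rev0 gamma1.
Qed.

Lemma close_up_loop h : is_Upath h -> is_loop x (close_up h).
Proof.
move=> hP; have [ch U0 U1] := hP; split.
- apply: path_cat_cont; [exact: gamma_cont|exact: tail_cont|].
  by rewrite path_cat0 gamma1.
- by rewrite /close_up path_cat0 gamma0.
- by rewrite /close_up !path_cat1 path_rev1 gamma0.
Qed.

Lemma closed_class_homotopic h h' : is_Upath h -> is_Upath h' ->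
  path_homotopic h h' -> closed_class h = closed_class h'.
Proof.
move=> hP h'P hh'; apply: fun_class_homotopic.
- exact: close_up_loop.
- by have [] := close_up_loop h'P.
have [e0 e1] := path_homotopic_ends hh'; have [ch U0 U1] := hP.
rewrite /close_up e0 e1; apply: path_homotopic_catr.
- exact: gamma_cont.
- by rewrite path_cat0 gamma1.
apply: path_homotopic_catl => //; last by rewrite path_rev0 gamma1.
exact/path_rev_cont/gamma_cont.
Qed.

(** At the common end point the connecting path is run back to [x] and then forth again; these two
    pieces cancel. *)
Lemma closed_class_cat h h' : is_Upath h -> is_Upath h' ->
  h one = h' zero ->
  closed_class (path_cat h h') = (closed_class h * closed_class h')%g.
Proof.
move=> hP h'P hh'; have [ch U0 U1] := hP; have [ch' U0' U1'] := h'P.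
have hh'P : is_Upath (path_cat h h').
  by split; [exact: path_cat_cont|rewrite path_cat0|rewrite path_cat1].
rewrite -fun_class_cat; [|exact: close_up_loop..].
apply: fun_class_homotopic; first exact: close_up_loop.
  apply: path_cat_cont.
  - by have [] := close_up_loop hP.
  - by have [] := close_up_loop h'P.
  - by rewrite /close_up !path_cat1 path_rev1 path_cat0 !gamma0.
rewrite /close_up path_cat0 path_cat1 -hh'.
set g := gamma (h zero); set m := gamma (h one); set k := path_rev (gamma (h' one)).
have cg : continuous g by exact: gamma_cont.
have cm : continuous m by exact: gamma_cont.
have cmV := path_rev_cont cm.
have ck : continuous k by exact/path_rev_cont/gamma_cont.
have g1 : g one = h zero by rewrite /g gamma1.
have m1 : m one = h one by rewrite /m gamma1.
have k0 : h' one = k zero by rewrite /k path_rev0 gamma1.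
have ch'k : continuous (path_cat h' k) by exact: path_cat_cont.
have cmh'k : continuous (path_cat m (path_cat h' k)).
  by apply: path_cat_cont => //; rewrite path_cat0 m1.
have chmV : continuous (path_cat h (path_rev m)).
  by apply: path_cat_cont => //; rewrite path_rev0 m1.
have e1 : path_rev m one = path_cat m (path_cat h' k) zero.
  by rewrite path_rev1 path_cat0.
apply: path_homotopic_sym.
apply: (path_homotopic_trans (g := path_cat g (path_cat (path_cat h (path_rev m))
   (path_cat m (path_cat h' k))))).
  apply/path_homotopic_sym/path_catA => //; first by rewrite path_cat0.
  by rewrite path_cat1.
apply: path_homotopic_catr => //; first by rewrite !path_cat0.
apply: (path_homotopic_trans (g := path_cat h (path_cat (path_rev m)
   (path_cat m (path_cat h' k))))).
  by apply/path_homotopic_sym/path_catA => //; rewrite path_rev0.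
apply: (path_homotopic_trans (g := path_cat h (path_cat h' k))); last first.
  by apply: path_catA.
apply: path_homotopic_catr => //; first by rewrite path_cat0 path_rev0.
apply: (path_homotopic_trans (g := path_cat (path_cat (path_rev m) m)
   (path_cat h' k))).
  by apply: path_catA => //; rewrite ?path_rev1// path_cat0 m1.
apply: (path_homotopic_trans (g := path_cat (cst (m one)) (path_cat h' k))).
  apply: path_homotopic_catl => //; first by rewrite path_cat1 path_cat0 m1.
  exact: path_catVf.
have -> : m one = path_cat h' k zero by rewrite path_cat0 m1.
exact: path_cat1f.
Qed.

Lemma closed_class_cst u : U u -> closed_class (cst u) = 1%g.
Proof.
move=> Uu; have uP : is_Upath (cst u) by split=> //; exact: cst_continuous.
rewrite -(fun_class_cst R x); apply: fun_class_homotopic.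
- exact: close_up_loop.
- exact: cst_continuous.
have cg := gamma_cont Uu; rewrite /close_up /= -(gamma0 Uu).
apply: (path_homotopic_trans (g := path_cat (gamma u) (path_rev (gamma u)))).
  apply: path_homotopic_catr => //; first by rewrite path_cat0 gamma1.
  rewrite -[in X in cst X](gamma1 Uu) -path_rev0.
  exact/path_cat1f/path_rev_cont.
exact: path_catfV.
Qed.

Lemma closed_class_rev h : is_Upath h ->
  closed_class (path_rev h) = ((closed_class h)^-1)%g.
Proof.
move=> hP; have [ch U0 U1] := hP.
have hVP : is_Upath (path_rev h).
  by split; [exact: path_rev_cont|rewrite path_rev0|rewrite path_rev1].
apply/esym/mulg1_eq; rewrite -closed_class_cat ?path_rev0// -(closed_class_cst U0).
apply: closed_class_homotopic; last exact: path_catfV.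
- split; first by apply: path_cat_cont; rewrite ?path_rev0//; case: hVP.
  + by rewrite path_cat0.
  + by rewrite path_cat1 path_rev1.
- by split=> //; exact: cst_continuous.
Qed.

Lemma closed_class_loop (l : loop R x) : closed_class l = loop_class l.
Proof.
have [cl l0 l1] := loop_is_loop l.
have lP : is_Upath l by split=> //; rewrite ?l0 ?l1.
rewrite -fun_classE; apply: fun_class_homotopic => //; first exact: close_up_loop.
have revx : path_rev (cst x : I -> X) = cst x by apply/funext.
have cx : continuous (cst x : I -> X) by exact: cst_continuous.
rewrite /close_up l0 l1 gamma_base revx.
apply: (path_homotopic_trans (g := path_cat (cst x) l)).
  apply: path_homotopic_catr => //; first by rewrite path_cat0 l0.
  by rewrite -[in X in cst X]l1; exact: path_catf1.
by rewrite -[in X in cst X]l0; exact: path_cat1f.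
Qed.

Context (H : set (pi1 R x)).
Hypothesis HM : forall a b, H a -> H b -> H (a * b)%g.
Hypothesis local : forall c : X, exists N : set X,
  [/\ open N, N c &
      forall h, is_Upath h -> (forall s, N (h s)) -> H (closed_class h)].
Hypothesis dense : forall (c : X) (N : set X), nbhs c N ->
  exists g : I -> X,
    [/\ continuous g, g zero = c, U (g one) & forall s, N (g s)].

(** As [f t] need not lie in [U], the path stopped at time [t] cannot be closed up directly. It is
    prolonged by any short path [g] from [f t] into [U], and the class must lie in [H] for all such
    [g]. *)
Let reaches (f : I -> X) (t : I) : Prop :=
  exists2 M : set X, nbhs (f t) M &
    forall g : I -> X, continuous g -> g zero = f t -> U (g one) ->
      (forall s, M (g s)) ->
      H (closed_class (path_cat (path_seg f 0 (I01val t)) g)).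

(** A detour [g] from [f t] into [U] and back is inserted. Up to homotopy, the path up to [t']
    followed by [g'] is then the product of the path up to [t] followed by [g], which is in [H] by
    assumption, and of a path with ends in [U] that stays in [N]. *)
Let reaches_step f (N : set X) t t' : continuous f -> f zero = x -> open N ->
  (forall h, is_Upath h -> (forall s, N (h s)) -> H (closed_class h)) ->
  (forall s, N (path_seg f (I01val t) (I01val t') s)) ->
  reaches f t -> reaches f t'.
Proof.
move=> cf f0 oN HN segN [M Mt HM'].
set seg := path_seg f (I01val t) (I01val t').
have cseg : continuous seg by exact: path_seg_cont.
have seg0 : seg zero = f t by rewrite /seg path_seg0 I01valK.
have seg1 : seg one = f t' by rewrite /seg path_seg1 I01valK.
exists N; first by apply: open_nbhs_nbhs; split=> //; rewrite -seg1.
move=> g' cg' g'0 Ug' Ng'.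
have Nt : nbhs (f t) N by apply: open_nbhs_nbhs; split=> //; rewrite -seg0.
have [g [cg g0 Ug MNg]] := dense (filterI Mt Nt).
set p := path_seg f 0 (I01val t).
have cp : continuous p by exact: path_seg_cont.
have p0 : p zero = x by rewrite /p path_seg0 clamp_zero.
have p1 : p one = g zero by rewrite /p path_seg1 I01valK g0.
set p' := path_seg f 0 (I01val t').
have cp' : continuous p' by exact: path_seg_cont.
have p'1 : p' one = g' zero by rewrite /p' path_seg1 I01valK g'0.
have p'0 : p' zero = x by rewrite /p' path_seg0 clamp_zero.
have cgV := path_rev_cont cg.
have cgg' : continuous (path_cat seg g') by apply: path_cat_cont; rewrite ?seg1.
have cpg : continuous (path_cat p g) by exact: path_cat_cont.
set k := path_cat (path_rev g) (path_cat seg g').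
have ck : continuous k.
  by apply: path_cat_cont => //; rewrite path_rev1 path_cat0 seg0.
have kP : is_Upath k.
  by split; rewrite /k ?path_cat0 ?path_cat1 ?path_rev0.
have [_ _ Uk1] := kP.
have k0 : g one = k zero by rewrite /k path_cat0 path_rev0.
have pgP : is_Upath (path_cat p g).
  by split; rewrite ?path_cat0 ?path_cat1 ?p0.
have Nk s : N (k s).
  rewrite /k; apply: path_catP => [u|]; first exact: (MNg _).2.
  exact: path_catP.
rewrite (_ : closed_class _ = (closed_class (path_cat p g) * closed_class k)%g).
  by apply: HM; [apply: HM' => // s; case: (MNg s)|exact: HN].
rewrite -closed_class_cat//; last by rewrite path_cat1.
apply: esym; apply: closed_class_homotopic.
- split; rewrite ?path_cat0 ?path_cat1 ?p0//.
  by apply: path_cat_cont => //; rewrite path_cat1.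
- split; rewrite ?path_cat0 ?path_cat1 ?p'0//.
  exact: path_cat_cont.
apply: (path_homotopic_trans (g := path_cat p (path_cat g k))).
  exact/path_homotopic_sym/path_catA.
apply: (path_homotopic_trans (g := path_cat p (path_cat seg g'))).
  apply: path_homotopic_catr => //; first by rewrite path_cat0.
  apply: (path_homotopic_trans
    (g := path_cat (path_cat g (path_rev g)) (path_cat seg g'))).
    apply: path_catA => //; first by rewrite path_rev0.
    by rewrite path_rev1 path_cat0 seg0.
  apply: (path_homotopic_trans (g := path_cat (cst (g zero)) (path_cat seg g'))).
    apply: path_homotopic_catl => //; last exact: path_catfV.
    by rewrite path_cat1 path_rev1 path_cat0 seg0.
  have -> : g zero = path_cat seg g' zero by rewrite path_cat0 seg0.
  exact: path_cat1f.
apply: (path_homotopic_trans (g := path_cat (path_cat p seg) g')).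
  by apply: path_catA => //; rewrite ?seg1// p1 g0 seg0.
apply: path_homotopic_catl => //; first by rewrite path_cat1 seg1.
exact: path_cat_seg.
Qed.

(** Connectedness of the interval replaces a subdivision of the loop: the set of times reached is
    open, closed and contains [zero]. At time [one] the constant path serves as prolongation, since
    the loop ends in [U]. *)
Lemma local_to_global (a : pi1 R x) : H a.
Proof.
elim/pi1_ind: a => l; have [cl l0 l1] := loop_is_loop l.
have near_reaches t : \forall t' \near t, reaches l t <-> reaches l t'.
  have [N [oN Nc HN]] := local (l t).
  have : \forall r \near I01val t, N (l (clamp r)).
    apply: (clamp_comp_cont cl (fun r => @cvg_id R (nbhs r))).
    by rewrite I01valK; exact: open_nbhs_nbhs.
  case/nbhs_ballP => e /= e0 eN.
  have : \forall t' \near t, ball (I01val t) e (I01val t').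
    exact/I01val_continuous/nbhsx_ballx.
  apply: filterS => t'; rewrite /ball/= => tt'.
  (* The piece of [l] between [t] and [t'] stays in [N] in either direction, so reachability passes
     from [t] to [t'] and back: this yields openness and closedness at once. *)
  have seg_e (s : I) : 0 <= I01val s <= 1 ->
      N (l (clamp ((I01val t' - I01val t) * I01val s + I01val t))) /\
      N (l (clamp ((I01val t - I01val t') * I01val s + I01val t'))).
    move=> s01; split; apply: eN; rewrite /ball/=.
    - rewrite opprD addrCA subrr addr0 normrN normrM distrC.
      apply: le_lt_trans tt'; rewrite ler_piMr//.
      by case/andP: s01 => ? ?; rewrite ger0_norm.
    - rewrite (_ : _ - _ = (I01val t - I01val t') * (1 - I01val s)); last by ring.
      rewrite normrM; apply: le_lt_trans tt'; rewrite ler_piMr//.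
      by case/andP: s01 => ? ?; rewrite ger0_norm; lra.
  split; apply: (reaches_step cl l0 oN HN) => s; rewrite /path_seg.
  - exact: (seg_e s (I01P s)).1.
  - exact: (seg_e s (I01P s)).2.
have reaches0 : reaches l zero.
  have [N [oN Nc HN]] := local (l zero).
  exists N; first exact: open_nbhs_nbhs.
  move=> g cg g0 Ug Ng.
  have gP : is_Upath g by split=> //; rewrite g0 l0.
  have segE : path_seg l 0 (I01val (zero : I)) = cst x.
    by apply/funext => s; rewrite /path_seg I01_zeroE subrr mul0r add0r clamp_zero.
  have cx : continuous (cst x : I -> X) by exact: cst_continuous.
  rewrite segE closed_class_cat//; last by rewrite g0 l0.
  by rewrite closed_class_cst// mul1g; exact: HN.
have : reaches l one.
  suff -> : reaches l = setT by [].
  have conn : connected [set: I].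
    rewrite (_ : setT = @clamp R @` `[0, 1]).
      apply: connected_continuous_connected; first exact: segment_connected.
      exact/continuous_subspaceT/clamp_continuous.
    apply/seteqP; split=> // t _; exists (I01val t); last exact: I01valK.
    by rewrite /= in_itv /= I01P.
  have oreach : open (reaches l).
    rewrite openE => t rt; rewrite /interior /=.
    by apply: filterS (near_reaches t) => t' <-.
  apply: conn.
  - by exists zero.
  - by exists (reaches l) => //; rewrite setTI.
  - exists (reaches l); last by rewrite setTI.
    rewrite -[reaches l]setCK; apply: open_closedC.
    rewrite openE => t rt; rewrite /interior /=.
    by apply: filterS (near_reaches t) => t' [_ tt'] /tt'.
move=> [M M1 HM'].
have := HM' (cst x); rewrite -closed_class_loop /=.
rewrite (_ : path_cat _ _ = path_cat l (cst (l one))).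
  have cx : continuous (cst x : I -> X) by exact: cst_continuous.
  have lP : is_Upath l by split; rewrite ?l0 ?l1.
  rewrite (_ : closed_class (path_cat l (cst (l one))) = closed_class l).
    by apply=> // _; rewrite -l1; exact: nbhs_singleton.
  apply: closed_class_homotopic => //; last exact: path_catf1.
  split; rewrite ?path_cat0 ?path_cat1 ?l0 ?l1//.
  by apply: path_cat_cont; rewrite ?l1.
congr path_cat; last by rewrite l1.
by apply/funext => s; rewrite /path_seg I01_oneE subr0 mul1r addr0 I01valK.
Qed.

End LocalToGlobal.

(** * Configuration spaces *)

Section ConfTheory.
Context (X : topologicalType) (D : X -> X -> Prop) (n : nat).
Local Notation OC := (ordered_conf D n).
Local Notation UC := (unordered_conf D n).

Lemma conf_fun_continuous k : continuous (fun p : OC => p k).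
Proof.
have cv : continuous (fun p : OC => val p : {ptws 'I_n -> X}).
  exact: (@initial_continuous _ _
    (set_val : [set p : {ptws 'I_n -> X} | forall i j, i != j -> D (p i) (p j)] ->
       {ptws 'I_n -> X})).
move=> p; apply: (@continuous_comp _ _ _ (fun p : OC => val p : {ptws 'I_n -> X})
  (fun f => f k)); first exact: cv.
exact: (@proj_continuous 'I_n (fun=> X) k).
Qed.

Lemma ordered_conf_continuous (T : topologicalType) (f : T -> OC) :
  (forall k, continuous (fun t => f t k)) -> continuous f.
Proof. by move=> cf; apply: continuous_set_type; exact: ptws_continuous. Qed.

Lemma forget_order_surj (u : UC) : exists p : OC, forget_order p = u.
Proof. by exists (repr u); rewrite /forget_order reprK. Qed.

Lemma permuted_conf_proof (p : OC) (s : 'S_n) i j :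
  i != j -> D (p (s i)) (p (s j)).
Proof.
by move=> ij; apply: ordered_confP; rewrite (inj_eq perm_inj).
Qed.

(** The preimage of the image of an open set is the union of its translates under the symmetric
    group. *)
Lemma forget_order_open (p : OC) (B : set OC) :
  nbhs p B -> nbhs (forget_order p) (@forget_order _ D n @` B).
Proof.
move=> Bp; apply: (@filterS _ _ _ (@forget_order _ D n @` B^°)).
  by move=> _ [q Bq <-]; exists q => //; exact: interior_subset.
apply: open_nbhs_nbhs; split; last by exists p.
pose g (s : 'S_n) (q : OC) : OC := mk_conf (@permuted_conf_proof q s).
have -> : open (@forget_order _ D n @` B^°) =
    open (@forget_order _ D n @^-1` (@forget_order _ D n @` B^°)) by [].
rewrite (_ : _ @^-1` _ = \bigcup_(s in [set: 'S_n]) (g s @^-1` B^°)).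
  apply: bigcup_open => s _; apply: open_comp; last exact: open_interior.
  by move=> q _; apply: ordered_conf_continuous => k; exact: conf_fun_continuous.
apply/seteqP; split=> q /=.
  move=> [q' Bq' /esym/forget_orderP[s sE]]; exists s => //=.
  by rewrite (_ : g s q = q') //; apply: ordered_conf_inj => i; rewrite sE.
move=> [s _ /= Bs]; exists (g s q) => //; apply/esym/forget_orderP.
by exists s.
Qed.

(** The product of a quotient map with an identity map need not be a quotient map. Here the quotient
    map is open, which lets homotopies of ordered configurations descend to unordered ones. *)
Lemma descend_continuous (T Y : topologicalType) (G : T * OC -> Y) :
  continuous G ->
  (forall t p q, forget_order p = forget_order q -> G (t, p) = G (t, q)) ->
  continuous (fun tu : T * UC => G (tu.1, repr tu.2)).
Proof.
move=> cG Gq [t u] W /=.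
have [p <-] := forget_order_surj u.
have -> : G (t, repr (forget_order p)) = G (t, p).
  by apply: Gq; rewrite /forget_order reprK.
move=> /cG [[A B] /= [At Bp] ABW].
exists (A, @forget_order _ D n @` B) => /=; first by split=> //; exact: forget_order_open.
move=> [t' u'] /= [At' [q Bq <-]].
have -> : G (t', repr (forget_order q)) = G (t', q).
  by apply: Gq; rewrite /forget_order reprK.
exact: (ABW (t', q)).
Qed.

Context (b : UC).

Definition is_conf (p : 'I_n -> X) : Prop := forall i j, i != j -> D (p i) (p j).

(* Junk value: b if p is not a configuration. *)
Definition to_conf (p : 'I_n -> X) : UC :=
  match pselect (is_conf p) with
  | left pP => forget_order (mk_conf pP)
  | right _ => b
  end.

Lemma ordered_is_conf (p : OC) : is_conf p.
Proof. exact: ordered_confP. Qed.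

Lemma to_confE (p : OC) : to_conf p = forget_order p.
Proof.
rewrite /to_conf; case: pselect => [pP|/(_ (ordered_is_conf p))//].
by congr forget_order; exact: ordered_conf_inj.
Qed.

Lemma is_confP (p : 'I_n -> X) : is_conf p -> exists q : OC, q = p :> ('I_n -> X).
Proof. by move=> pP; exists (mk_conf pP). Qed.

Lemma to_conf_surj (u : UC) : exists2 p, is_conf p & to_conf p = u.
Proof.
have [p <-] := forget_order_surj u.
by exists p; [exact: ordered_is_conf|exact: to_confE].
Qed.

Lemma to_conf_eqP (p q : 'I_n -> X) : is_conf p -> is_conf q ->
  to_conf p = to_conf q <-> exists s : 'S_n, forall i, q i = p (s i).
Proof.
move=> /is_confP[p' <-] /is_confP[q' <-]; rewrite !to_confE.
exact: forget_orderP.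
Qed.

Lemma is_conf_perm (p : 'I_n -> X) (s : 'S_n) : is_conf p -> is_conf (p \o s).
Proof. by move=> pP i j ij; apply: pP; rewrite (inj_eq perm_inj). Qed.

Lemma to_conf_perm (p : 'I_n -> X) (s : 'S_n) : is_conf p ->
  to_conf (p \o s) = to_conf p.
Proof.
move=> pP; apply/esym/to_conf_eqP => //; first exact: is_conf_perm.
by exists s.
Qed.

Lemma to_conf_continuous (T : topologicalType) (v : T -> 'I_n -> X) :
  (forall t, is_conf (v t)) -> (forall k, continuous (v^~ k)) ->
  continuous (to_conf \o v).
Proof.
move=> vP cv; pose w t : OC := mk_conf (vP t).
have -> : to_conf \o v = @forget_order _ D n \o w.
  by apply/funext => t /=; rewrite -to_confE.
move=> t; apply: continuous_comp; last exact: forget_order_continuous.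
by apply: ordered_conf_continuous => k; exact: cv.
Qed.

Definition conf_box (V : 'I_n -> set X) : set UC :=
  to_conf @` [set p | is_conf p /\ forall k, V k (p k)].

Lemma conf_box_open (V : 'I_n -> set X) :
  (forall k, open (V k)) -> open (conf_box V).
Proof.
move=> oV; rewrite openE => _ [p [/is_confP[q <-] Vp] <-].
rewrite to_confE /interior /=.
apply: (@filterS _ _ _ (@forget_order _ D n @` [set q : OC | forall k, V k (q k)])).
  move=> _ [q' /= Vq' <-]; exists q'; last exact: to_confE.
  by split=> //; exact: ordered_is_conf.
apply: forget_order_open.
apply: (@filter_forall _ _ (fun k => [set q' : OC | V k (q' k)]) _ (nbhs_filter q)) => k.
apply: (@conf_fun_continuous k q).
by apply: open_nbhs_nbhs; split.
Qed.

(** Since the cells are pairwise disjoint, the cell that contains a point determines its label. The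
    labelling is thus forced, and any pointwise choice of it is continuous. *)
Lemma conf_box_lift (T : topologicalType) (V : 'I_n -> set X) (h : T -> UC) :
  (forall k, open (V k)) ->
  (forall j k a, V j a -> V k a -> j = k) ->
  continuous h -> (forall t, conf_box V (h t)) ->
  exists v : T -> 'I_n -> X,
    [/\ forall k, continuous (v^~ k),
        forall t, is_conf (v t),
        forall t k, V k (v t k) &
        forall t, to_conf (v t) = h t].
Proof.
move=> oV dV ch hV.
have /choice[v vP] t : exists p,
    (is_conf p /\ forall k, V k (p k)) /\ to_conf p = h t.
  by have [p pP pE] := hV t; exists p.
exists v; split=> [k t W Wvt|t|t k|t]; last 3 first.
- exact: (vP t).1.1.
- exact: (vP t).1.2.
- exact: (vP t).2.
(* Continuity of coordinate [k] is tested by shrinking the [k]-th cell to [W]: the smaller box is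
   still open and contains [h t], hence [h t'] for [t'] near [t]. *)
pose V' j := if j == k then V j `&` W^° else V j.
have oV' j : open (V' j).
  by rewrite /V'; case: ifP => // _; apply: openI => //; exact: open_interior.
have : conf_box V' (h t).
  have [[cvt Vvt] <-] := vP t; exists (v t) => //; split=> // j.
  by rewrite /V'; case: eqP => [->|//]; split.
move=> h't; have : \forall t' \near t, conf_box V' (h t').
  by apply: ch; apply: open_nbhs_nbhs; split=> //; exact: conf_box_open.
apply: filterS => t' [p [cp V'p] pE] /=.
have [[cvt Vvt] vE] := vP t'.
have Vp j : V j (p j) by move: (V'p j); rewrite /V'; case: ifP => // _ [].
have /to_conf_eqP[//|//|s sE] : to_conf p = to_conf (v t') by rewrite vE.
have -> : v t' k = p k.
  by rewrite sE; congr p; apply: (dV _ _ (p (s k))) => //; rewrite -sE.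
by move: (V'p k); rewrite /V' eqxx => -[_]; exact: interior_subset.
Qed.

End ConfTheory.

(** * Exchanges of two consecutive points *)

Section Convex.
Context (R : realType) (X : topologicalType) (D : X -> X -> Prop) (n : nat).
Local Notation I := (I01 R).
Context (cmb : I -> X -> X -> X).
Hypothesis cmb_cont : continuous (fun p : I * (X * X) => cmb p.1 p.2.1 p.2.2).
Hypothesis cmb0 : forall a b, cmb zero a b = a.
Hypothesis cmb1 : forall a b, cmb one a b = b.
Hypothesis cmbaa : forall s a, cmb s a a = a.
Context (b : unordered_conf D n).

Lemma convex_homotopic (v w : I -> 'I_n -> X) :
  (forall k, continuous (v^~ k)) -> (forall k, continuous (w^~ k)) ->
  v zero = w zero -> v one = w one ->
  (forall s t, is_conf D (fun k => cmb s (v t k) (w t k))) ->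
  path_homotopic (to_conf b \o v) (to_conf b \o w).
Proof.
move=> cv cw vw0 vw1 C.
exists (to_conf b \o fun st : I * I => fun k => cmb st.1 (v st.2 k) (w st.2 k)).
split.
- apply: to_conf_continuous => [st|k st]; first exact: C.
  apply: (@continuous_comp _ _ _
    (fun st : I * I => (st.1, (v st.2 k, w st.2 k)))
    (fun p : I * (X * X) => cmb p.1 p.2.1 p.2.2)); last exact: cmb_cont.
  have c2 (u : I -> 'I_n -> X) : continuous (u^~ k) ->
      continuous (fun st : I * I => u st.2 k).
    move=> cu st'; apply: (@continuous_comp _ _ _ snd (u^~ k)).
      exact: cvg_snd.
    exact: cu.
  by apply: pair_cont; [move=> ?; exact: cvg_fst|apply: pair_cont; exact: c2].
- by move=> t /=; congr (to_conf b _); apply/funext => k; rewrite cmb0.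
- by move=> t /=; congr (to_conf b _); apply/funext => k; rewrite cmb1.
- move=> s /=; split; congr (to_conf b _); apply/funext => k.
    by rewrite vw0 cmbaa.
  by rewrite vw1 cmbaa.
Qed.

Context (xi : X -> R) (cross : X -> X -> Prop).

Definition xsorted (p : 'I_n -> X) : Prop :=
  forall j k : 'I_n, (j < k)%N -> xi (p j) < xi (p k).

Definition swap (i : 'I_n.-1) : 'S_n := tperm (lo i) (hi i).

Definition meeting (i : 'I_n.-1) (p : 'I_n -> X) : Prop :=
  [/\ xi (p (lo i)) = xi (p (hi i)), cross (p (lo i)) (p (hi i)) &
      forall j k : 'I_n, (j < k)%N -> (j, k) != (lo i, hi i) ->
        xi (p j) < xi (p k)].

(* The conditions on an exchange loop, up to deformation: between the ends, the
   points other than the two that are exchanged may move. *)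
Definition exchange (base : 'I_n -> X) (i : 'I_n.-1) (v : I -> 'I_n -> X) : Prop :=
  [/\ forall k, continuous (v^~ k), v zero = base, v one = base \o swap i &
      exists t0,
        [/\ forall t, I01val t < I01val t0 -> xsorted (v t),
            forall t, I01val t0 < I01val t -> xsorted (v t \o swap i) &
            meeting i (v t0)]].

Hypothesis xi_disjoint : forall p q, xi p <> xi q -> D p q.
Hypothesis cross_disjoint :
  forall p q, xi p = xi q -> cross p q -> D p q /\ D q p.

Lemma lo_lt_hi (i : 'I_n.-1) : (lo i < hi i)%N.
Proof. by []. Qed.

Lemma xsorted_neq (p : 'I_n -> X) (j k : 'I_n) :
  xsorted p -> j != k -> xi (p j) <> xi (p k).
Proof.
move=> ps; rewrite neq_ltn => /orP[] /ps pjk e; move: pjk; rewrite e ltxx//.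
Qed.

Lemma xsorted_conf (p : 'I_n -> X) : xsorted p -> is_conf D p.
Proof. by move=> ps j k jk; apply: xi_disjoint; exact: xsorted_neq. Qed.

Lemma swapK (i : 'I_n.-1) (p : 'I_n -> X) : (p \o swap i) \o swap i = p.
Proof. by apply/funext => k /=; rewrite tpermK. Qed.

Lemma xsorted_swap_conf i (p : 'I_n -> X) : xsorted (p \o swap i) -> is_conf D p.
Proof.
by move=> ps; rewrite -(swapK i p); apply: is_conf_perm; exact: xsorted_conf.
Qed.

Lemma meeting_conf i (p : 'I_n -> X) : meeting i p -> is_conf D p.
Proof.
move=> [e c s] j k jk.
have [d1 d2] := cross_disjoint e c.
have [/eqP [-> ->]//|n1] := boolP ((j, k) == (lo i, hi i)).
have [/eqP [-> ->]//|n2] := boolP ((k, j) == (lo i, hi i)).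
apply: xi_disjoint => e'; move: jk; rewrite neq_ltn => /orP[] /s.
- by move/(_ n1); rewrite e' ltxx.
- by move/(_ n2); rewrite e' ltxx.
Qed.

Lemma exchange_conf base i v t : exchange base i v -> is_conf D (v t).
Proof.
move=> [_ _ _ [t0 [s1 s2 m]]].
have [/s1/xsorted_conf//|/s2/xsorted_swap_conf//|] := ltgtP (I01val t) (I01val t0).
by move=> /(congr1 (@clamp R)); rewrite !I01valK => ->; exact: meeting_conf m.
Qed.

(** A meeting at either end would give two equal abscissas in [base]. Strict bounds are what allows
    dividing by the meeting time and by its complement when time is rescaled. *)
Lemma exchange_time base i v : xsorted base -> exchange base i v ->
  exists t0, 0 < I01val t0 < 1 /\
    [/\ forall t, I01val t < I01val t0 -> xsorted (v t),
        forall t, I01val t0 < I01val t -> xsorted (v t \o swap i) &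
        meeting i (v t0)].
Proof.
move=> bs [_ v0 v1 [t0 tP]]; exists t0; split=> //.
have [_ _ [e _ _]] := tP.
have lohi : lo i != hi i by rewrite neq_ltn lo_lt_hi.
have /andP[le0 le1] := I01P t0; rewrite !lt_neqAle le0 le1 !andbT.
apply/andP; split; apply/eqP => t0E.
- have t0z : t0 = zero by rewrite -[LHS]I01valK -t0E clamp_zero.
  by move: e; rewrite t0z v0; exact: xsorted_neq.
- have t0z : t0 = one by rewrite -[LHS]I01valK t0E clamp_one.
  move: e; rewrite t0z v1 /= tpermL tpermR => /esym; exact: xsorted_neq.
Qed.

Hypothesis xi_cmb : forall s p q,
  xi (cmb s p q) = (1 - I01val s) * xi p + I01val s * xi q.
Hypothesis cross_cmb : forall s p p' q q',
  xi p = xi p' -> xi q = xi q' -> cross p p' -> cross q q' ->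
  cross (cmb s p q) (cmb s p' q').

Lemma ltr_convex (s : I) (x y x' y' : R) : x < y -> x' < y' ->
  (1 - I01val s) * x + I01val s * x' < (1 - I01val s) * y + I01val s * y'.
Proof.
have /andP[] := I01P s; rewrite le_eqVlt => /predU1P[<- _ xy _|s0 s1 xy xy'].
  by rewrite subr0 !mul1r !mul0r !addr0.
by rewrite ler_ltD// ?ltr_pM2l// ler_wpM2l ?subr_ge0// ltW.
Qed.

Lemma xsorted_cmb s (p q : 'I_n -> X) : xsorted p -> xsorted q ->
  xsorted (fun k => cmb s (p k) (q k)).
Proof.
by move=> sp sq j k jk; rewrite !xi_cmb; apply: ltr_convex; [exact: sp|exact: sq].
Qed.

Lemma meeting_cmb s i (p q : 'I_n -> X) : meeting i p -> meeting i q ->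
  meeting i (fun k => cmb s (p k) (q k)).
Proof.
move=> [e c m] [e' c' m']; split.
- by rewrite !xi_cmb e e'.
- exact: cross_cmb.
- move=> j k jk jk'; rewrite !xi_cmb.
  by apply: ltr_convex; [exact: m|exact: m'].
Qed.

(* Slowing v down so that both exchanges meet at the same time, all the points
   of the two configurations can be joined by segments. *)
Lemma exchange_homotopic base i v w : xsorted base ->
  exchange base i v -> exchange base i w ->
  path_homotopic (to_conf b \o v) (to_conf b \o w).
Proof.
move=> bs vP wP; have [t0 [/andP[t00 t01] [vs1 vs2 vm]]] := exchange_time bs vP.
have [u0 [/andP[u00 u01] [ws1 ws2 wm]]] := exchange_time bs wP.
have [cv v0 v1 _] := vP; have [cw w0 w1 _] := wP.
(* The piecewise affine time change with values 0, [t0], 1 at 0, [u0], 1: after it, [v] meets at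
   [u0], as [w] does. *)
pose phi (t : I) : R := if I01val t <= I01val u0
  then (I01val t0 / I01val u0) * I01val t + 0
  else ((1 - I01val t0) / (1 - I01val u0)) * I01val t
    + (I01val t0 - I01val u0) / (1 - I01val u0).
have phi_lt t : I01val t < I01val u0 -> 0 <= phi t < I01val t0.
  move=> tu; have /andP[tt0 tt1] := I01P t.
  rewrite /phi (ltW tu) addr0 mulrAC -mulrA; apply/andP; split.
    by rewrite mulr_ge0 ?divr_ge0// ltW.
  by rewrite gtr_pMr// ltr_pdivrMr ?mul1r.
have phi_gt t : I01val u0 < I01val t -> I01val t0 < phi t <= 1.
  move=> tu; have /andP[tt0 tt1] := I01P t.
  have u1 : 0 < 1 - I01val u0 by rewrite subr_gt0.
  rewrite /phi leNgt tu /= mulrAC -mulrDl ltr_pdivlMr// ler_pdivrMr//.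
  by apply/andP; split; nra.
have phi_u0 : phi u0 = I01val t0.
  by rewrite /phi lexx addr0 divfK// gt_eqF.
have phi_cont : continuous phi.
  apply: continuous_paste; first exact: I01val_continuous.
  - exact: affine_I01_cont.
  - exact: affine_I01_cont.
  - move=> t ->; have u1 : 1 - I01val u0 != 0 by rewrite gt_eqF// subr_gt0.
    have u2 : I01val u0 != 0 by rewrite gt_eqF.
    by field; rewrite u1 u2.
have phi0 : phi zero = 0 by rewrite /phi I01_zeroE (ltW u00) mulr0 addr0.
have phi1 : phi one = 1.
  rewrite /phi I01_oneE leNgt u01 /= mulr1 -mulrDl addrA subrK divff//.
  by rewrite gt_eqF// subr_gt0.
pose v' (t : I) := v (clamp (phi t)).
have phi01 t : 0 <= phi t <= 1.
  have [/phi_lt|/phi_gt|] := ltgtP (I01val t) (I01val u0); first by lra.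
    by lra.
  move=> /(congr1 (@clamp R)); rewrite !I01valK => ->; rewrite phi_u0.
  exact: I01P.
apply: (path_homotopic_trans (g := to_conf b \o v')).
  apply: (@path_homotopic_reparam _ _ (to_conf b \o v) _ (@I01val R) phi) => //.
  - by apply: to_conf_continuous => // t; exact: exchange_conf vP.
  - exact: I01val_continuous.
  - by rewrite phi0 I01_zeroE.
  - by rewrite phi1 I01_oneE.
  - by move=> t; rewrite I01valK.
apply: convex_homotopic => //.
- by move=> k; apply: (clamp_comp_cont (cv k)).
- by rewrite /v' phi0 clamp_zero v0 w0.
- by rewrite /v' phi1 clamp_one v1 w1.
move=> s t; have [tu|tu|tu] := ltgtP (I01val t) (I01val u0).
- apply/xsorted_conf/xsorted_cmb; last exact: ws1.
  by apply: vs1; rewrite clampK//; have /andP[] := phi_lt _ tu.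
- apply: (@xsorted_swap_conf i).
  apply: (xsorted_cmb _ (p := v' t \o swap i) (q := w t \o swap i)); last exact: ws2.
  by apply: vs2; rewrite clampK//; have /andP[] := phi_gt _ tu.
- have -> : t = u0 by rewrite -[LHS]I01valK tu I01valK.
  apply: (@meeting_conf i); apply: meeting_cmb => //.
  by rewrite /v' phi_u0 I01valK.
Qed.

End Convex.

(** * Sorting configurations of points by abscissa *)

Section Sorting.
Context (R : realType) (n : nat).
Implicit Types (x : 'I_n -> R).

Definition increasing x : Prop := forall j k : 'I_n, (j < k)%N -> x j < x k.

Lemma increasing_ltn x (j k : 'I_n) : increasing x -> (x j < x k) = (j < k)%N.
Proof.
move=> ix; have [/ix//|/ix/ltW|/ord_inj ->] := ltngtP j k; last by rewrite ltxx.
by rewrite leNgt => /negbTE.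
Qed.

(** The permutation is the inverse of the rank, which counts the smaller values. *)
Lemma sorting_perm x : injective x -> exists s : 'S_n, increasing (x \o s).
Proof.
move=> xi; pose below k := [set l | x l < x k]%SET.
have rank_lt k : (#|below k| < n)%N.
  rewrite -[n in X in (_ < X)%N]card_ord -cardsT; apply: proper_card.
  apply/properP; split; first by apply/fintype.subsetP => l; rewrite inE.
  by exists k; rewrite !inE ?ltxx.
pose rank k : 'I_n := Ordinal (rank_lt k).
have rankP k l : x k < x l -> (rank k < rank l)%N.
  move=> kl; apply: proper_card; apply/properP; split.
    by apply/fintype.subsetP => m; rewrite !inE => /lt_trans; apply.
  by exists k; rewrite !inE ?ltxx.
have rank_inj : injective rank.
  move=> k l kl; apply: xi.
  by have [/rankP|/rankP|//] := ltgtP (x k) (x l); rewrite kl ltnn.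
exists (perm rank_inj)^-1%g => j k jk /=.
set j' := _ j; set k' := _ k.
have jE : rank j' = j by rewrite -[LHS](permE rank_inj) permKV.
have kE : rank k' = k by rewrite -[LHS](permE rank_inj) permKV.
move: jk; rewrite -jE -kE => jk.
have [//|/rankP|/xi e] := ltgtP (x j') (x k').
  by move=> /(ltn_trans jk); rewrite ltnn.
by move: jk; rewrite e ltnn.
Qed.

(** A strictly increasing self-map of ['I_n] never goes below the identity; this applies to [s] and
    to its inverse. *)
Lemma increasing_perm x (s : 'S_n) : increasing x -> increasing (x \o s) -> s = 1%g.
Proof.
have above (t : 'S_n) : (forall j k : 'I_n, (j < k)%N -> (t j < t k)%N) ->
    forall k : 'I_n, (k <= t k)%N.
  move=> tm; suff : forall m (k : 'I_n), k = m :> nat -> (m <= t k)%N.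
    by move=> h k; exact: (h k k).
  elim=> // m IH k kE.
  have mn : (m < n)%N by apply: leq_ltn_trans (ltn_ord k); rewrite kE.
  by apply: leq_ltn_trans (IH (Ordinal mn) erefl) _; apply: tm; rewrite /= kE.
move=> ix ixs; apply/permP => k; rewrite perm1; apply/ord_inj/eqP.
rewrite eqn_leq; apply/andP; split.
  rewrite -[in X in (_ <= X)%N](permK s k); apply: (above s^-1%g) => j l jl.
  by rewrite -(increasing_ltn _ _ ixs) /= !permKV increasing_ltn.
apply: above => j l jl.
by rewrite -(increasing_ltn _ _ ix) -[_ < _]/((x \o s) j < (x \o s) l) increasing_ltn.
Qed.

(* Bubble sort: exchanging the closest pair that y orders the other way leaves
   one inversion less. *)
Lemma bubble_ind (y : 'I_n -> R) (Q : ('I_n -> R) -> Prop) : injective y ->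
  (forall x, injective x -> (forall j k, x j < x k -> y j < y k) -> Q x) ->
  (forall x j k, injective x -> x j < x k ->
     (forall l, ~~ (x j < x l < x k)) -> y k < y j ->
     Q (x \o tperm j k) -> Q x) ->
  forall x, injective x -> Q x.
Proof.
move=> yi Q0 QS x.
pose inverted x (jk : 'I_n * 'I_n) := (x jk.1 < x jk.2) && (y jk.2 < y jk.1).
pose inv x := [set jk | inverted x jk]%SET.
have [m] := ubnP #|inv x|; elim: m => // m IH in x * => xm xi.
have [[[j0 k0] jk0]|inv0] := pselect (exists jk, inverted x jk); last first.
  apply: Q0 => // j k jk; rewrite ltNge; apply/negP => yjk.
  apply: inv0; exists (j, k); rewrite /inverted /= jk lt_neqAle yjk andbT.
  by apply/eqP => /yi e; rewrite e ltxx in jk.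
case: (arg_minP (fun jk : 'I_n * 'I_n => x jk.2 - x jk.1) jk0) => -[j k] /=.
move=> /[dup] invjk /andP[/= jk yjk] jkmin.
(* A value strictly between would form an inverted pair with [j] or with [k], whichever way [y]
   orders it, and with a smaller gap. *)
have adj l : ~~ (x j < x l < x k).
  apply/negP => /andP[jl lk]; have [yjl|ylj|/yi e] := ltgtP (y j) (y l).
  - have := jkmin (l, k); rewrite /inverted /= lk (lt_trans yjk yjl) => /(_ isT).
    by lra.
  - have := jkmin (j, l); rewrite /inverted /= jl ylj => /(_ isT).
    by lra.
  - by rewrite e ltxx in jl.
apply: (QS _ j k) => //; apply: IH; last exact: inj_comp xi perm_inj.
rewrite -ltnS; apply: leq_ltn_trans xm; apply: proper_card.
have outside l : l <> j -> l <> k -> x l < x j \/ x k < x l.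
  move=> lj lk; have [?|jl|/xi//] := ltgtP (x l) (x j); first by left.
  have [?|//|/xi//] := ltgtP (x l) (x k); last by right.
  by move: (adj l); rewrite jl => /negP.
(* With no value between [x j] and [x k], exchanging them does not alter their order relative to any
   third one. So the new inverted pairs of indices are among the old ones, and [(j, k)] is lost. *)
have inv_sub a c : x (tperm j k a) < x (tperm j k c) -> y c < y a ->
    x a < x c /\ (a, c) <> (j, k).
  case: tpermP => [->|->|aj ak]; case: tpermP => [->|->|cj ck];
    rewrite ?ltxx// => h1 h2.
  - by exfalso; lra.
  - by split; [lra|case].
  - by exfalso; lra.
  - by split; [have [] := outside _ cj ck; lra|case=> kj; rewrite kj ltxx in jk].
  - by split; [have [] := outside _ aj ak; lra|case].
  - by split; [lra|case].
  - by split=> //; case.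
apply/properP; split.
  apply/fintype.subsetP => -[a c]; rewrite !inE => /andP[/= h1 h2].
  by apply/andP; split=> //=; case: (inv_sub a c).
exists (j, k); rewrite !inE//; apply/negP => /andP[/= h1 h2].
by case: (inv_sub j k).
Qed.

End Sorting.

(** * Generation of the braid group by exchanges *)

Section Coordinates.
Context (R : realType) (X : topologicalType) (n : nat).
Local Notation I := (I01 R).
Implicit Types (v w : I -> 'I_n -> X).

Lemma coord_path_cat v w :
  (forall k, continuous (v^~ k)) -> (forall k, continuous (w^~ k)) ->
  v one = w zero -> forall k, continuous ((path_cat v w)^~ k).
Proof.
move=> cv cw vw k.
rewrite (_ : (path_cat v w)^~ k = path_cat (v^~ k) (w^~ k)); last first.
  exact: (path_cat_comp (fun p => p k)).
by apply: path_cat_cont => //; rewrite vw.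
Qed.

Lemma coord_path_rev v :
  (forall k, continuous (v^~ k)) -> forall k, continuous ((path_rev v)^~ k).
Proof. by move=> cv k; exact: (path_rev_cont (cv k)). Qed.

End Coordinates.

Lemma mix_real_cont (R : realType) (V : topologicalType) (f : V -> R) :
  continuous f ->
  continuous (fun a : I01 R * (V * V) =>
    (1 - I01val a.1) * f a.2.1 + I01val a.1 * f a.2.2).
Proof.
move=> cf; have cs : continuous (fun a : I01 R * (V * V) => I01val a.1).
  by apply: I01val_cont => ?; exact: cvg_fst.
have cf2 (g : V * V -> V) : continuous g ->
    continuous (fun a : I01 R * (V * V) => f (g a.2)).
  move=> cg a; apply: (@continuous_comp _ _ _ snd (f \o g)); first exact: cvg_snd.
  by apply: continuous_comp; [exact: cg|exact: cf].
move=> a; apply: cvgD; apply: cvgM.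
- by apply: cvgB; [exact: cvg_cst|exact: cs].
- by apply: (cf2 fst) => ?; exact: cvg_fst.
- exact: cs.
- by apply: (cf2 snd) => ?; exact: cvg_snd.
Qed.

Section Points.
Context (R : realType) (n : nat).
Local Notation I := (I01 R).
Local Notation pt := (R * R)%type.
Local Notation D := (@distinct_points R).
Local Notation UC := (unordered_conf D n).
Local Notation bp := (base_points R n).
Local Notation tc := (to_conf bp).
Implicit Types (p q : 'I_n -> pt).

Definition mix (s : I) (a b : pt) : pt :=
  ((1 - I01val s) * a.1 + I01val s * b.1, (1 - I01val s) * a.2 + I01val s * b.2).

Lemma mix_cont : continuous (fun a : I * (pt * pt) => mix a.1 a.2.1 a.2.2).
Proof.
apply: pair_cont; first exact: (mix_real_cont (fun a => @cvg_fst _ _ _ _ _)).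
exact: (mix_real_cont (fun a => @cvg_snd _ _ _ _ _)).
Qed.

Lemma mix0 a b : mix zero a b = a.
Proof.
by case: a b => ? ? [? ?]; rewrite /mix I01_zeroE /= !subr0 !mul1r !mul0r !addr0.
Qed.

Lemma mix1 a b : mix one a b = b.
Proof.
by case: a b => ? ? [? ?]; rewrite /mix I01_oneE /= !subrr !mul1r !mul0r !add0r.
Qed.

Lemma mixaa s a : mix s a a = a.
Proof. by case: a => ? ?; rewrite /mix /= -!mulrDl subrK !mul1r. Qed.

Lemma fst_disjoint (a c : pt) : a.1 <> c.1 -> D a c.
Proof. by move=> ac e; apply: ac; rewrite e. Qed.

Definition above (a c : pt) : Prop := c.2 < a.2.

Lemma above_disjoint (a c : pt) : a.1 = c.1 -> above a c -> D a c /\ D c a.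
Proof. by move=> _ ac; split=> e; move: ac; rewrite /above e ltxx. Qed.

Definition base_pt (i : 'I_n) : pt := ((i : nat)%:R, 0).

Local Notation xsort p := (xsorted fst p).

Lemma base_pt_sorted : xsort base_pt.
Proof. by move=> j k jk; rewrite /= ltr_nat. Qed.

Lemma base_ptE : tc base_pt = bp.
Proof. exact: (to_confE bp (mk_conf (@base_points_subproof R n))). Qed.

Lemma xsort_conf p : xsort p -> is_conf D p.
Proof. exact: (xsorted_conf fst_disjoint). Qed.

Lemma xinj_conf p : injective (fst \o p) -> is_conf D p.
Proof.
by move=> pi j k jk; apply: fst_disjoint => /pi e; move: jk; rewrite e eqxx.
Qed.

Lemma xsort_inj p : xsort p -> injective (fst \o p).
Proof.
move=> sp j k /= e; have [/sp|/sp|/ord_inj//] := ltngtP j k;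
  by rewrite e ltxx.
Qed.

Definition line p q (t : I) : 'I_n -> pt := fun k => mix t (p k) (q k).

Lemma line_cont p q k : continuous ((line p q)^~ k).
Proof.
move=> t; apply: (@continuous_comp _ _ _ (fun t : I => (t, (p k, q k)))
  (fun a : I * (pt * pt) => mix a.1 a.2.1 a.2.2)); last exact: mix_cont.
by apply: pair_cont; [move=> ?; exact: cvg_id|exact: (@cst_continuous _ _ (p k, q k))].
Qed.

Lemma line0 p q : line p q zero = p.
Proof. by apply/funext => k; exact: mix0. Qed.

Lemma line1 p q : line p q one = q.
Proof. by apply/funext => k; exact: mix1. Qed.

Lemma line_sorted p q t : xsort p -> xsort q -> xsort (line p q t).
Proof. exact: (xsorted_cmb (cmb := mix)). Qed.

Lemma line_rev p q : path_rev (line p q) = line q p.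
Proof.
apply/funext => t; apply/funext => k; have /andP[t0 t1] := I01P t.
rewrite /path_rev /line /mix clampK; last by lra.
by congr (_, _); ring.
Qed.

Lemma line_perm p q t (s : 'S_n) : line p q t \o s = line (p \o s) (q \o s) t.
Proof. by []. Qed.

(** A permutation between two sorted labellings is increasing, hence trivial. So the representative
    that [sorting_path] chooses is the only sorted one. *)
Lemma sorted_conf_inj p q : xsort p -> xsort q -> tc p = tc q -> p = q.
Proof.
move=> sp sq /to_conf_eqP[||s sE]; [exact: xsort_conf..|].
have s1 : s = 1%g.
  by apply: (increasing_perm (x := fst \o p)) => // j k jk /=; rewrite -!sE; exact: sq.
by apply/funext => k; rewrite sE s1 perm1.
Qed.

(** The configurations with pairwise distinct abscissas. This is the set [U] of the local criterion:
    sorted tuples form a convex set, so segments give canonical paths from the base point. *)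
Definition generic_conf : set UC := [set u | exists p, xsort p /\ tc p = u].

Lemma generic_conf_inj p : injective (fst \o p) -> generic_conf (tc p).
Proof.
move=> pi; have [s sP] := sorting_perm pi.
by exists (p \o s); split=> //; apply: to_conf_perm; exact: xinj_conf.
Qed.

Lemma generic_inj p : is_conf D p -> generic_conf (tc p) -> injective (fst \o p).
Proof.
move=> cp [q [sq /to_conf_eqP[||s sE]]] //; first exact: xsort_conf.
move=> j k /=; rewrite !sE => /(xsort_inj sq); exact: perm_inj.
Qed.

(* The segment from the base point to the representative of u that is sorted. *)
Definition sorting_path (u : UC) : I -> UC :=
  match pselect (generic_conf u) with
  | left uP => tc \o line base_pt (projT1 (cid uP))
  | right _ => cst bp
  end.

Lemma sorting_pathE p : xsort p -> sorting_path (tc p) = tc \o line base_pt p.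
Proof.
move=> sp; rewrite /sorting_path; case: pselect => [uP|[]]; last by exists p.
case: cid => q [sq e] /=; congr (_ \o line _ _); exact: sorted_conf_inj.
Qed.

Lemma generic_base : generic_conf bp.
Proof. by exists base_pt; split; [exact: base_pt_sorted|exact: base_ptE]. Qed.

Lemma line_base_sorted p t : xsort p -> xsort (line base_pt p t).
Proof. by apply: line_sorted; exact: base_pt_sorted. Qed.

Lemma sorting_path_cont u : generic_conf u -> continuous (sorting_path u).
Proof.
move=> [p [sp <-]]; rewrite sorting_pathE//; apply: to_conf_continuous.
  by move=> t; apply/xsort_conf/line_base_sorted.
exact: line_cont.
Qed.

Lemma sorting_path0 u : generic_conf u -> sorting_path u zero = bp.
Proof. by move=> [p [sp <-]]; rewrite sorting_pathE//= line0 base_ptE. Qed.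

Lemma sorting_path1 u : generic_conf u -> sorting_path u one = u.
Proof. by move=> [p [sp <-]]; rewrite sorting_pathE//= line1. Qed.

Lemma sorting_path_base : sorting_path bp = cst bp.
Proof.
rewrite -[in LHS]base_ptE sorting_pathE; last exact: base_pt_sorted.
apply/funext => t /=; rewrite -[in RHS]base_ptE; congr (tc _).
by apply/funext => k; exact: mixaa.
Qed.

Local Notation K := (closed_class bp sorting_path).

(** A labelled lift of [close_up]. The return path [r] is a parameter because [w one] may be sorted
    only after relabelling, and [r] must end with the labels of [w]. *)
Definition closed_track p (r w : I -> 'I_n -> pt) : I -> 'I_n -> pt :=
  path_cat (line base_pt p) (path_cat w (path_rev r)).

Lemma closed_classE (w r : I -> 'I_n -> pt) :
  xsort (w zero) -> sorting_path (tc (w one)) = tc \o r ->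
  K (tc \o w) = fun_class bp (tc \o closed_track (w zero) r w).
Proof.
move=> s0 rE; rewrite /closed_class /close_up /= sorting_pathE// rE.
by rewrite -[path_rev (tc \o r)]/(tc \o path_rev r) -!path_cat_comp.
Qed.

(** The closed track stays in the convex set of sorted tuples and contracts linearly to
    [base_pt]. *)
Lemma sorted_track_class (w : I -> 'I_n -> pt) :
  (forall k, continuous (w^~ k)) -> (forall t, xsort (w t)) -> K (tc \o w) = 1%g.
Proof.
move=> cw sw; rewrite (closed_classE (r := line base_pt (w one)))//; last first.
  exact: sorting_pathE.
set v := closed_track _ _ _.
have cv k : continuous (v^~ k).
  apply: coord_path_cat; [exact: line_cont| |by rewrite path_cat0 line1].
  apply: coord_path_cat; [exact: cw| |by rewrite path_rev0 line1].
  by apply: coord_path_rev; exact: line_cont.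
have sv t : xsort (v t).
  apply: path_catP => [t'|]; first exact: line_base_sorted.
  by apply: path_catP => // t'; exact: line_base_sorted.
have v0 : v zero = base_pt by rewrite /v /closed_track path_cat0 line0.
have v1 : v one = base_pt by rewrite /v /closed_track !path_cat1 path_rev1 line0.
rewrite -(fun_class_cst R bp); apply: fun_class_homotopic.
- split; rewrite /= ?v0 ?v1 ?base_ptE//.
  by apply: to_conf_continuous => // t; exact: xsort_conf.
- exact: cst_continuous.
rewrite (_ : cst bp = tc \o cst base_pt); last first.
  by apply/funext => t /=; rewrite base_ptE.
apply: (convex_homotopic mix_cont mix0 mix1 mixaa) => //.
- by move=> k; exact: cst_continuous.
- move=> s t; apply: xsort_conf; apply: line_sorted => //; exact: base_pt_sorted.
Qed.

End Points.

Section Generation.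
Context (R : realType) (n : nat).
Local Notation I := (I01 R).
Local Notation pt := (R * R)%type.
Local Notation D := (@distinct_points R).
Local Notation UC := (unordered_conf D n).
Local Notation bp := (base_points R n).
Local Notation tc := (to_conf bp).
Local Notation xsort p := (xsorted fst p).
Local Notation K := (closed_class bp (@sorting_path R n)).
Implicit Types (p q : 'I_n -> pt).

(** Labels keep their ordinates, so the segment from [p] to this tuple is a horizontal motion and
    the ordinates alone decide which point passes above. *)
Definition swap_abscissas p (j k : 'I_n) : 'I_n -> pt :=
  fun l => ((p (tperm j k l)).1, (p l).2).

Lemma swap_ltn (i : 'I_n.-1) (j k : 'I_n) : (j < k)%N -> (j, k) != (lo i, hi i) ->
  (swap i j < swap i k)%N.
Proof.
rewrite /swap xpair_eqE; case: tpermP => [->|->|/eqP jlo /eqP jhi];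
  case: tpermP => [->|->|/eqP klo /eqP khi]; rewrite ?eqxx ?ltnn//=.
- move=> ik _; move: khi; rewrite -val_eqE /= => khi.
  by rewrite ltn_neqAle eq_sym khi.
- by move=> /ltnW.
- by move=> /leqW.
- move=> ji _; move: jlo; rewrite -val_eqE /= => jlo.
  by rewrite ltn_neqAle jlo -ltnS.
Qed.

Section Adjacent.
Context (p : 'I_n -> pt) (i : 'I_n.-1).
Hypothesis sp : xsort p.
Let q := swap_abscissas p (lo i) (hi i).

Let swapped_le (u : R) (j k : 'I_n) : 0 <= u <= 1 -> (j < k)%N ->
  (j, k) != (lo i, hi i) ->
  (1 - u) * (p j).1 + u * (p (swap i j)).1 <
  (1 - u) * (p k).1 + u * (p (swap i k)).1.
Proof.
move=> u01 jk /(swap_ltn jk) sjk.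
by rewrite -(clampK u01); apply: ltr_convex; exact: sp.
Qed.

Let swapped_lt (u : R) (j k : 'I_n) : 0 <= u < 1 / 2 -> (j < k)%N ->
  (1 - u) * (p j).1 + u * (p (swap i j)).1 <
  (1 - u) * (p k).1 + u * (p (swap i k)).1.
Proof.
move=> u01 jk; have [|] := boolP ((j, k) == (lo i, hi i)); last first.
  by apply: swapped_le => //; lra.
rewrite xpair_eqE => /andP[/eqP -> /eqP ->]; rewrite /swap tpermL tpermR.
by have := sp (lo_lt_hi i); nra.
Qed.

Lemma swapping_sorted (t : I) : I01val t < 1 / 2 -> xsort (line p q t).
Proof.
by move=> t2 j k jk; apply: swapped_lt => //; have := I01P t; lra.
Qed.

Lemma swapping_sorted' (t : I) : 1 / 2 < I01val t -> xsort (line p q t \o swap i).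
Proof.
move=> t2 j k jk; rewrite /= !tpermK.
(* Reversing time amounts to relabelling by [swap i]; the second half of the motion reduces to the
   first at time [1 - t]. *)
have u01 : 0 <= 1 - I01val t < 1 / 2 by have := I01P t; lra.
by have := swapped_lt u01 jk; rewrite /swap; lra.
Qed.

Lemma swapping_meeting (t : I) : (p (hi i)).2 < (p (lo i)).2 ->
  I01val t = 1 / 2 -> meeting fst (@above R) i (line p q t).
Proof.
move=> pi t2; split.
- by rewrite /= t2 tpermL tpermR; lra.
- by rewrite /above /= t2; lra.
- by move=> j k jk jk'; apply: swapped_le => //; exact: I01P.
Qed.

Lemma swapped_sorted : xsort (q \o swap i).
Proof. by move=> j k jk; rewrite /= !tpermK; exact: sp. Qed.

Let r := line (@base_pt R n \o swap i) q.

Let r_sorted t : xsort (r t \o swap i).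
Proof.
rewrite [_ \o _](_ : _ = line (@base_pt R n) (q \o swap i) t).
  exact/line_base_sorted/swapped_sorted.
by apply/funext => k; rewrite /r /line /= tpermK.
Qed.

Lemma swapping_exchange : (p (hi i)).2 < (p (lo i)).2 ->
  exchange fst (@above R) (@base_pt R n) i (closed_track p r (line p q)).
Proof.
move=> pi; split.
- move=> k; apply: coord_path_cat; [exact: line_cont| |by rewrite path_cat0 line1 line0].
  apply: coord_path_cat; [exact: line_cont| |by rewrite path_rev0 /r !line1].
  by apply: coord_path_rev; exact: line_cont.
- by rewrite /closed_track path_cat0 line0.
- by rewrite /closed_track !path_cat1 path_rev1 /r line0.
(* In the closed track the exchange itself occupies the times from 1/2 to 3/4; the two points meet
   halfway, at 5/8. *)
have t0E : I01val (clamp (5 / 8) : I) = 5 / 8 by rewrite clampK//; lra.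
exists (clamp (5 / 8)); rewrite t0E.
have late t : I01val t > 1 / 2 -> closed_track p r (line p q) t =
    path_cat (line p q) (path_rev r) (clamp (2 * I01val t + (- 1))).
  by move=> t2; rewrite {1}/closed_track {1}/path_cat ifF//; lra.
have middle t : 1 / 2 < I01val t <= 3 / 4 -> closed_track p r (line p q) t =
    line p q (clamp (4 * I01val t - 2)).
  move=> t2; have := I01P t => t01; rewrite late; last lra.
  rewrite /path_cat clampK; last lra.
  rewrite ifT; last lra.
  by congr (line p q (clamp _)); ring.
split.
- move=> t tlt; have [t2|t2] := lerP (I01val t) (1 / 2).
    by rewrite /closed_track /path_cat t2; exact: line_base_sorted.
  have := I01P t => t01; rewrite middle; last lra.
  by apply: swapping_sorted; rewrite clampK; lra.
- move=> t tlt; have := I01P t => t01; have [t3|t3] := lerP (I01val t) (3 / 4).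
    rewrite middle; last lra.
    by apply: swapping_sorted'; rewrite clampK; lra.
  rewrite late; last lra.
  rewrite /path_cat ifF; first exact: r_sorted.
  by rewrite clampK; lra.
- rewrite middle t0E; last lra.
  by apply: swapping_meeting => //; rewrite clampK; lra.
Qed.

Lemma swapping_conf t : (p (hi i)).2 < (p (lo i)).2 -> is_conf D (line p q t).
Proof.
move=> pi; have [t2|t2|t2] := ltgtP (I01val t) (1 / 2).
- exact/xsort_conf/swapping_sorted.
- exact/(xsorted_swap_conf (@fst_disjoint R))/swapping_sorted'.
- exact/(meeting_conf (@fst_disjoint R) (@above_disjoint R))/swapping_meeting.
Qed.

Lemma swapping_class : (p (hi i)).2 < (p (lo i)).2 ->
  K (tc \o line p q) = fun_class bp (tc \o closed_track p r (line p q)).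
Proof.
move=> pi; have qs : is_conf D q by rewrite -(line1 p q); exact: swapping_conf.
rewrite (closed_classE (r := r)) ?line0// line1.
rewrite -(to_conf_perm bp (swap i) qs) sorting_pathE; last exact: swapped_sorted.
apply/funext => t /=.
rewrite -(to_conf_perm bp (swap i) (p := r t)); last first.
  exact/(xsorted_swap_conf (@fst_disjoint R))/r_sorted.
by congr (tc _); apply/funext => k; rewrite /r /line /= tpermK.
Qed.

End Adjacent.

Context (H : set (pi1 R bp)).
Hypothesis H1 : H 1%g.
Hypothesis HM : forall a b, H a -> H b -> H (a * b)%g.
Hypothesis HV : forall a, H a -> H (a^-1)%g.
Hypothesis H_exchange : forall i v,
  exchange fst (@above R) (@base_pt R n) i v -> H (fun_class bp (tc \o v)).

(** Relabelling by the sorting permutation leaves the unordered path unchanged and makes the two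
    labels consecutive, since a label between them would have its abscissa between theirs. *)
Let swapping_above p (j k : 'I_n) :
  injective (fst \o p) -> (p j).1 < (p k).1 ->
  (forall l, ~~ ((p j).1 < (p l).1 < (p k).1)) -> (p k).2 < (p j).2 ->
  H (K (tc \o line p (swap_abscissas p j k))).
Proof.
move=> pi jk adj yjk; have [s ps] := sorting_perm pi.
have {}ps : xsort (p \o s) by [].
pose j' := (s^-1)%g j; pose k' := (s^-1)%g k.
have jE : s j' = j by exact: permKV.
have kE : s k' = k by exact: permKV.
have jk' : (j' < k')%N.
  by rewrite -(increasing_ltn j' k' ps) /= jE kE.
have j1 : (j'.+1 < n)%N by exact: leq_ltn_trans jk' (ltn_ord k').
have kj : k' = j'.+1 :> nat.
  apply/eqP; rewrite eqn_leq jk' andbT leqNgt; apply/negP => jk1.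
  have jl : (p (s j')).1 < (p (s (Ordinal j1))).1 by exact: ps.
  have lk : (p (s (Ordinal j1))).1 < (p (s k')).1 by exact: ps.
  by move: (adj (s (Ordinal j1))); rewrite -jE -kE jl lk.
have j0 : (j' < n.-1)%N by rewrite ltn_predRL.
pose i : 'I_n.-1 := Ordinal j0.
have loE : lo i = j' by exact/ord_inj.
have hiE : hi i = k' by apply/ord_inj; rewrite kj.
have qE : swap_abscissas p j k \o s = swap_abscissas (p \o s) (lo i) (hi i).
  apply/funext => l; rewrite /swap_abscissas /= loE hiE.
  by rewrite (inj_tperm _ _ _ (@perm_inj _ s)) jE kE.
have yi : ((p \o s) (hi i)).2 < ((p \o s) (lo i)).2 by rewrite /= loE hiE jE kE.
rewrite (_ : tc \o _ = tc \o line (p \o s) (swap_abscissas (p \o s) (lo i) (hi i))).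
  rewrite swapping_class//; apply: H_exchange; exact: swapping_exchange.
apply/funext => t /=; rewrite -qE -line_perm to_conf_perm//.
rewrite -[line _ _ t](_ : (line p (swap_abscissas p j k) t \o s) \o (s^-1)%g = _).
  by apply: is_conf_perm; rewrite line_perm qE; exact: swapping_conf.
by apply/funext => l /=; rewrite permKV.
Qed.

Lemma swapping_generic p (j k : 'I_n) :
  injective (fst \o p) -> injective (fst \o swap_abscissas p j k).
Proof. by move=> pi l m /pi /perm_inj. Qed.

(** If the point starting on the left is the lower one, the reversed motion has the upper point
    starting on the left. Its class is in [H], and inverting gives the claim: one kind of half twist
    suffices. *)
Let swapping_H p (j k : 'I_n) :
  injective (fst \o p) -> (p j).1 < (p k).1 ->
  (forall l, ~~ ((p j).1 < (p l).1 < (p k).1)) -> (p k).2 <> (p j).2 ->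
  (forall t, is_conf D (line p (swap_abscissas p j k) t)) ->
  H (K (tc \o line p (swap_abscissas p j k))).
Proof.
move=> pi jk adj yjk C; have [yjk'|yjk'|//] := ltgtP (p k).2 (p j).2.
  exact: swapping_above.
set q := swap_abscissas p j k; have qi : injective (fst \o q) by exact: swapping_generic.
have pE : p = swap_abscissas q k j.
  apply/funext => l; rewrite /q /swap_abscissas /= tpermC tpermK.
  exact: surjective_pairing.
rewrite -(line_rev q p) -[tc \o _]/(path_rev (tc \o line q p)).
have qp t : is_conf D (line q p t) by rewrite -line_rev; exact: C.
rewrite (closed_class_rev (U := @generic_conf R n) (@sorting_path_cont R n)
  (@sorting_path0 R n) (@sorting_path1 R n)); last first.
  split => /=.
  - by apply: to_conf_continuous => //; exact: line_cont.
  - by rewrite line0; exact: generic_conf_inj.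
  - by rewrite line1; exact: generic_conf_inj.
apply: HV; rewrite [X in line q X]pE; apply: swapping_above => //.
- by rewrite /q /= tpermL tpermR.
- move=> l; rewrite /q /= tpermL tpermR.
  exact: adj.
Qed.

(** Applied to coordinate differences of a configuration. The factor 2 ensures that coordinates
    moved by less than [e] keep their order whenever they were different. *)
Lemma separated (T : finType) (F : T -> R) :
  exists2 e, 0 < e & forall a, F a != 0 -> 2 * e <= `|F a|.
Proof.
have sep : \forall e \near (0 : R)^'+, forall a, F a != 0 -> 2 * e <= `|F a|.
  apply: filter_forall => a; have [->|Fa] := eqVneq (F a) 0.
    by apply: nearW => e /=; move=> /negP; rewrite ?eqxx.
  have Fa2 : 0 < `|F a| / 2 by rewrite divr_gt0// normr_gt0.
  apply: filterS (nbhs_right_le Fa2) => e eF _.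
  by rewrite mulrC -ler_pdivlMr.
have [e [e0 eP]] := filter_ex (filterI (nbhs_right_gt (0 : R)) sep).
by exists e.
Qed.

(** * Sorting inside a small box around a configuration *)

Section Box.
Context (c : 'I_n -> pt) (e : R).
Hypothesis cc : is_conf D c.
Hypothesis e0 : 0 < e.
Hypothesis sep1 : forall j k, (c j).1 != (c k).1 -> 2 * e <= `|(c j).1 - (c k).1|.
Hypothesis sep2 : forall j k, (c j).2 != (c k).2 -> 2 * e <= `|(c j).2 - (c k).2|.

Definition cell (k : 'I_n) : set pt :=
  [set a | `|(c k).1 - a.1| < e /\ `|(c k).2 - a.2| < e].

Definition boxed p : Prop := forall k, cell k (p k).

Lemma cell_open k : open (cell k).
Proof.
rewrite (_ : cell k = fst @^-1` ball (c k).1 e `&` snd @^-1` ball (c k).2 e)//.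
by apply: openI; apply: open_comp; try exact: ball_open;
  move=> a _; [exact: cvg_fst|exact: cvg_snd].
Qed.

Lemma separated_lt (x y a b : R) : 2 * e <= `|x - y| ->
  `|x - a| < e -> `|y - b| < e -> (a < b) = (x < y).
Proof.
rewrite !ltr_norml => xy /andP[xa ax] /andP[yb bY].
have [yx|xy'] := lerP 0 (x - y); move: xy.
  by rewrite ger0_norm// => xy; apply/idP/idP; lra.
by rewrite ltr0_norm// => xy; apply/idP/idP; lra.
Qed.

Lemma boxed_lt1 p j k : boxed p -> (c j).1 != (c k).1 ->
  ((p j).1 < (p k).1) = ((c j).1 < (c k).1).
Proof.
by move=> pb jk; apply: separated_lt (sep1 jk) (pb j).1 (pb k).1.
Qed.

Lemma separated_neq (x y a b : R) : 2 * e <= `|x - y| ->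
  `|x - a| < e -> `|y - b| < e -> a <> b.
Proof.
move=> xy xa yb ab; have := separated_lt xy xa yb.
have := separated_lt; move: (xy); rewrite distrC => yx /(_ _ _ _ _ yx yb xa).
rewrite ab ltxx => /esym/negbT; rewrite -leNgt => le1 /esym/negbT.
rewrite -leNgt => le2.
have xyE : x = y by apply/eqP; rewrite eq_le le1 le2.
by move: xy; rewrite xyE subrr normr0; move: e0; lra.
Qed.

Lemma cell_disjoint j k a : cell j a -> cell k a -> j = k.
Proof.
move=> [ja1 ja2] [ka1 ka2]; apply/eqP; apply/negPn/negP => /cc; apply.
have [jk1|/sep1 jk1] := eqVneq (c j).1 (c k).1; last first.
  by case: (separated_neq jk1 ja1 ka1).
have [jk2|/sep2 jk2] := eqVneq (c j).2 (c k).2; last first.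
  by case: (separated_neq jk2 ja2 ka2).
by rewrite [LHS]surjective_pairing [RHS]surjective_pairing jk1 jk2.
Qed.

Lemma boxed_conf p : boxed p -> is_conf D p.
Proof.
move=> pb j k jk pjk; move: jk; rewrite (@cell_disjoint j k (p j)) ?eqxx//.
by rewrite pjk.
Qed.

Lemma boxed_line p q t : boxed p -> boxed q -> boxed (line p q t).
Proof.
move=> pb qb k; have [[p1 p2] [q1 q2]] := (pb k, qb k).
have conv (x a b : R) : `|x - a| < e -> `|x - b| < e ->
    `|x - ((1 - I01val t) * a + I01val t * b)| < e.
  rewrite !ltr_norml => /andP[a1 a2] /andP[b1 b2].
  rewrite (_ : x - _ = (1 - I01val t) * (x - a) + I01val t * (x - b)); last by ring.
  have ue u : u = (1 - I01val t) * u + I01val t * u by ring.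
  by apply/andP; split; [rewrite [ltLHS]ue|rewrite [ltRHS]ue]; exact: ltr_convex.
by split=> /=; exact: conv.
Qed.

(** The ordinates of [p] are kept while its abscissas are exchanged until they are ordered like
    those of [q]. The last segment to [q] is then sorted for a common relabelling and contributes
    the trivial class. *)
Lemma bubble_path p q : injective (fst \o p) -> injective (fst \o q) ->
  boxed p -> boxed q ->
  exists w : I -> 'I_n -> pt,
    [/\ forall k, continuous (w^~ k), w zero = p, w one = q,
        forall t, boxed (w t) & H (K (tc \o w))].
Proof.
move=> pi qi pb qb.
pose P (x : 'I_n -> R) : 'I_n -> pt := fun k => (x k, (p k).2).
have pE : P (fst \o p) = p.
  by apply/funext => k; rewrite /P [RHS]surjective_pairing.
suff bubble x : injective x -> boxed (P x) -> exists w : I -> 'I_n -> pt,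
    [/\ forall k, continuous (w^~ k), w zero = P x, w one = q,
        forall t, boxed (w t) & H (K (tc \o w))].
  by rewrite -pE; apply: bubble => //; rewrite pE.
move: x; apply: (bubble_ind qi) => x.
- move=> xi xq xb; exists (line (P x) q); split.
  + exact: line_cont.
  + exact: line0.
  + exact: line1.
  + by move=> t; exact: boxed_line.
  have [s sx] := sorting_perm xi.
  have sq : xsort (q \o s) by move=> j k jk; apply: xq; exact: sx.
  have sP : xsort (P x \o s) by [].
  rewrite (_ : tc \o _ = tc \o line (P x \o s) (q \o s)).
    rewrite sorted_track_class//; first exact: line_cont.
    by move=> t; exact: line_sorted.
  apply/funext => t; rewrite /= -line_perm to_conf_perm//.
  exact/boxed_conf/boxed_line.
- move=> j k xi jk adj qkj IH xb; set x' := x \o tperm j k.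
  (* Both orders of [j] and [k] occur in the box, so the two centers share their abscissa. Hence
     trading abscissas does not leave the box, and the ordinates, whose centers differ, stay
     apart. *)
  have cjk : (c j).1 = (c k).1.
    apply/eqP/negPn/negP => cjk; move: (boxed_lt1 xb cjk).
    rewrite /= jk => /esym; rewrite -(boxed_lt1 qb cjk) => qjk.
    by move: (lt_trans qkj qjk); rewrite ltxx.
  have x'b : boxed (P x').
    move=> l; split; last exact: (xb l).2.
    rewrite /= /x' /=; case: tpermP => [->|->|_ _]; last exact: (xb l).1.
    + by rewrite cjk; exact: (xb k).1.
    + by rewrite -cjk; exact: (xb j).1.
  have yjk : (P x k).2 <> (P x j).2.
    move=> /= yjk; have : c j <> c k.
      by apply: cc; apply/eqP => jk'; rewrite jk' ltxx in jk.
    apply; rewrite [LHS]surjective_pairing [RHS]surjective_pairing cjk.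
    have [/eqP cjk2|/sep2 s2] := boolP ((c j).2 == (c k).2); first by rewrite cjk2.
    by case: (separated_neq s2 (xb j).2 (xb k).2).
  have lb t : boxed (line (P x) (P x') t) by exact: boxed_line.
  have Hl : H (K (tc \o line (P x) (P x'))).
    apply: (@swapping_H (P x) j k) => //.
    by move=> t; exact/boxed_conf/lb.
  have [w [cw w0 w1 wb Hw]] := IH x'b.
  exists (path_cat (line (P x) (P x')) w); split.
  + by apply: coord_path_cat; [exact: line_cont|exact: cw|rewrite line1 w0].
  + by rewrite path_cat0 line0.
  + by rewrite path_cat1.
  + exact: path_catP.
  rewrite path_cat_comp.
  rewrite (closed_class_cat (U := @generic_conf R n) (@sorting_path_cont R n)
    (@sorting_path0 R n) (@sorting_path1 R n)); first exact: HM.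
  + split => /=.
    * by apply: to_conf_continuous => [t|]; [exact/boxed_conf/lb|exact: line_cont].
    * by rewrite line0; exact: generic_conf_inj.
    * by rewrite line1; apply: generic_conf_inj; exact: inj_comp xi perm_inj.
  + split => /=.
    * by apply: to_conf_continuous => // t; exact/boxed_conf/wb.
    * by rewrite w0; apply: generic_conf_inj; exact: inj_comp xi perm_inj.
    * by rewrite w1; exact: generic_conf_inj.
  + by rewrite /= line1 w0.
Qed.

(** After lifting to labelled points the box is convex, so any path in it is homotopic to the bubble
    path with the same ends. *)
Lemma box_local (h : I -> UC) : is_Upath (@generic_conf R n) h ->
  (forall t, conf_box bp cell (h t)) -> H (K h).
Proof.
move=> [ch U0 U1] hb.
have [v [cv vc vb vh]] := conf_box_lift cell_open cell_disjoint ch hb.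
have hE : h = tc \o v by apply/funext => t; rewrite /= vh.
have v0 : injective (fst \o v zero) by apply: generic_inj; rewrite ?vh.
have v1 : injective (fst \o v one) by apply: generic_inj; rewrite ?vh.
have [w [cw w0 w1 wb Hw]] := bubble_path v0 v1 (vb zero) (vb one).
rewrite (closed_class_homotopic (U := @generic_conf R n) (@sorting_path_cont R n)
    (@sorting_path0 R n) (@sorting_path1 R n) (h' := tc \o w)) => //.
- split => /=.
  + by apply: to_conf_continuous => // t; exact/boxed_conf/wb.
  + by rewrite w0 vh.
  + by rewrite w1 vh.
- rewrite hE.
  apply: (convex_homotopic (@mix_cont R) (@mix0 R) (@mix1 R) (@mixaa R)) => //.
  by move=> s t; exact/boxed_conf/boxed_line.
Qed.

Lemma box_dense (N : set UC) : nbhs (tc c) N ->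
  exists g : I -> UC,
    [/\ continuous g, g zero = tc c, generic_conf (g one) & forall t, N (g t)].
Proof.
(* Point [k] is shifted to the right at speed [d * k]. As [k < n.+1], it moves by less than [e] and
   stays in its cell. *)
move=> Nc; pose d := e / n.+1%:R.
have d0 : 0 < d by rewrite divr_gt0.
pose v (t : I) : 'I_n -> pt := fun k => ((c k).1 + d * (I01val t * k%:R), (c k).2).
have vb t : boxed (v t).
  move=> k; have /andP[t0 t1] := I01P t; split=> /=; last by rewrite subrr normr0.
  rewrite opprD addrA subrr add0r normrN ger0_norm; last first.
    by rewrite !mulr_ge0// ltW.
  rewrite /d -mulrA gtr_pMr// mulrC ltr_pdivrMr// mul1r.
  apply: (@le_lt_trans _ _ k%:R); first by rewrite ler_piMl.
  by rewrite ltr_nat ltnS ltnW.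
have cv : continuous (tc \o v).
  apply: to_conf_continuous => [t|k]; first exact: boxed_conf.
  apply: pair_cont; last exact: cst_continuous.
  rewrite (_ : (fun t : I => _) = (fun t : I => (d * k%:R) * I01val t + (c k).1)).
    exact: affine_I01_cont.
  by apply/funext => t; ring.
have v0 : tc (v zero) = tc c.
  congr (tc _); apply/funext => k; rewrite /v I01_zeroE mul0r mulr0 addr0.
  by rewrite [RHS]surjective_pairing.
have : \forall r \near (0 : R), N (tc (v (clamp r))).
  apply: (clamp_comp_cont cv (fun r => @cvg_id R (nbhs r))).
  by rewrite clamp_zero /= v0.
case/nbhs_ballP => u /= u0 uN.
(* A positive time early enough for the path to be still in [N]; points with equal initial abscissas
   are separated at every positive time, having different speeds. *)
pose m := Num.min 1 (u / 2).
have m0 : 0 < m by rewrite lt_min ltr01 divr_gt0.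
have m1 : m <= 1 by rewrite ge_min lexx.
have mu : m < u by rewrite gt_min; apply/orP; right; lra.
exists (path_seg (tc \o v) 0 m); split.
- exact: path_seg_cont.
- by rewrite path_seg0 clamp_zero /= v0.
- rewrite path_seg1 /=; apply: generic_conf_inj => j k /=.
  have [jk|jk] := eqVneq (c j).1 (c k).1; last first.
    by move=> vjk; case: (separated_neq (sep1 jk) (vb _ j).1 (vb _ k).1 vjk).
  rewrite jk clampK ?(ltW m0)// => /addrI /mulfI; rewrite gt_eqF// => /(_ isT).
  by move=> /mulfI; rewrite gt_eqF// => /(_ isT) /eqP; rewrite eqr_nat => /eqP/ord_inj.
- move=> t; have /andP[t0 t1] := I01P t; apply: uN; rewrite /ball/= subr0 sub0r addr0.
  rewrite normrN ger0_norm; last by rewrite mulr_ge0// ltW.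
  by apply: le_lt_trans mu; rewrite ler_piMr// ltW.
Qed.

End Box.

Lemma box_exists (u : UC) : exists (c : 'I_n -> pt) (e : R),
  [/\ is_conf D c, tc c = u, 0 < e,
      forall j k, (c j).1 != (c k).1 -> 2 * e <= `|(c j).1 - (c k).1| &
      forall j k, (c j).2 != (c k).2 -> 2 * e <= `|(c j).2 - (c k).2|].
Proof.
have [c cc cu] := to_conf_surj bp u.
have [e1 e10 s1] := separated (fun jk : 'I_n * 'I_n => (c jk.1).1 - (c jk.2).1).
have [e2 e20 s2] := separated (fun jk : 'I_n * 'I_n => (c jk.1).2 - (c jk.2).2).
have m1 : Num.min e1 e2 <= e1 by rewrite ge_min lexx.
have m2 : Num.min e1 e2 <= e2 by rewrite ge_min lexx orbT.
exists c, (Num.min e1 e2); split=> //; first by rewrite lt_min e10.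
- move=> j k; rewrite -subr_eq0 => jk; apply: le_trans (s1 (j, k) jk).
  by rewrite ler_pM2l.
- move=> j k; rewrite -subr_eq0 => jk; apply: le_trans (s2 (j, k) jk).
  by rewrite ler_pM2l.
Qed.

(** Generation is phrased for an arbitrary subset [H] closed under the group operations, to be
    applied to preimages of subgroups of [wicket_group]. *)
Lemma exchanges_generate (a : pi1 R bp) : H a.
Proof.
apply: (local_to_global (@generic_base R n) (@sorting_path_cont R n)
  (@sorting_path0 R n) (@sorting_path1 R n) (@sorting_path_base R n)) => //.
- move=> u; have [c [e [cc <- e0 s1 s2]]] := box_exists u.
  exists (conf_box bp (cell c e)); split.
  + by apply: conf_box_open; exact: cell_open.
  + by exists c => //; split=> // k; split; rewrite subrr normr0.
  + by move=> h hU hb; exact: box_local hU hb.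
- move=> u N; have [c [e [cc <- e0 s1 s2]]] := box_exists u.
  exact: (@box_dense c e).
Qed.

End Generation.

(** * Wickets *)

Section InducedMap.
Context (R : realType) (X Y : topologicalType) (x : X) (y : Y) (F : X -> Y).
Context (cF : continuous F) (Fx : F x = y).

Lemma comp_is_loop (f : I01 R -> X) : is_loop x f -> is_loop y (F \o f).
Proof.
move=> [cf f0 f1]; split; rewrite /= ?f0 ?f1//.
by move=> t; apply: continuous_comp; [exact: cf|exact: cF].
Qed.

Definition pi1_map (cF : continuous F) (Fx : F x = y) (a : pi1 R x) : pi1 R y :=
  fun_class y (F \o (repr a : loop R x)).

Lemma pi1_mapE (f : I01 R -> X) : is_loop x f ->
  pi1_map cF Fx (fun_class x f) = fun_class y (F \o f).
Proof.
move=> /[dup] lf /is_loopP[l <-]; rewrite fun_classE.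
apply: fun_class_homotopic; first exact/comp_is_loop/loop_is_loop.
  by case: (comp_is_loop (loop_is_loop l)).
apply: path_homotopic_comp => //.
by apply/homotopicE/loop_classP; rewrite /loop_class reprK.
Qed.

Lemma pi1_mapM : {morph pi1_map cF Fx : a b / (a * b)%g}.
Proof.
elim/pi1_ind => f; elim/pi1_ind => g; rewrite -!fun_classE.
have lf := loop_is_loop f; have lg := loop_is_loop g.
rewrite -fun_class_cat// !pi1_mapE//; last first.
  by rewrite -[path_cat f g]/(concat f g : I01 R -> X); exact: loop_is_loop.
by rewrite path_cat_comp fun_class_cat//; exact: comp_is_loop.
Qed.

HB.instance Definition _ :=
  isMultiplicative.Build (pi1 R x) (pi1 R y) (pi1_map cF Fx) pi1_mapM.

End InducedMap.

Lemma fun_class_surj (R : realType) (X : topologicalType) (x : X) (a : pi1 R x) :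
  exists2 f, is_loop x f & fun_class x f = a.
Proof.
elim/pi1_ind: a => l; exists l; [exact: loop_is_loop|exact: fun_classE].
Qed.

Lemma fun_class_eqP (R : realType) (X : topologicalType) (x : X)
    (f g : I01 R -> X) : is_loop x f -> is_loop x g ->
  fun_class x f = fun_class x g <-> path_homotopic f g.
Proof.
move=> lf lg; split=> [|fg]; last first.
  by apply: fun_class_homotopic => //; case: lg.
move: lf lg => /is_loopP[l <-] /is_loopP[l' <-]; rewrite !fun_classE.
by move=> /loop_classP/homotopicE.
Qed.

(** * Segments between wickets, and numerical forms of the two crossings *)

Section WicketPaths.
Context (R : realType).
Local Notation I := (I01 R).
Local Notation W := (wicket R).

Lemma wr_gt0 (w : W) : 0 < wr w.
Proof. by case: w => -[[a b] c] wP; exact: (set_mem wP). Qed.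

Lemma wicket_val_cont : continuous (fun w : W => val w : R * R * R).
Proof.
exact: (@initial_continuous _ _ (set_val : [set w : R * R * R | 0 < w.2] -> R * R * R)).
Qed.

Lemma wx_cont : continuous (@wx R).
Proof.
move=> w; apply: (@continuous_comp _ _ _ (fun w : W => (val w).1) fst);
  last exact: cvg_fst.
apply: (@continuous_comp _ _ _ (fun w : W => val w : R * R * R) fst); last exact: cvg_fst.
exact: wicket_val_cont.
Qed.

Lemma wy_cont : continuous (@wy R).
Proof.
move=> w; apply: (@continuous_comp _ _ _ (fun w : W => (val w).1) snd);
  last exact: cvg_snd.
apply: (@continuous_comp _ _ _ (fun w : W => val w : R * R * R) fst); last exact: cvg_fst.
exact: wicket_val_cont.
Qed.

Lemma wr_cont : continuous (@wr R).
Proof.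
move=> w; apply: (@continuous_comp _ _ _ (fun w : W => val w : R * R * R) snd);
  last exact: cvg_snd.
exact: wicket_val_cont.
Qed.

Lemma mix_radius_gt0 (s : I) (r r' : R) : 0 < r -> 0 < r' ->
  0 < (1 - I01val s) * r + I01val s * r'.
Proof. by move=> r0 r'0; have := ltr_convex s r0 r'0; rewrite !mulr0 addr0. Qed.

Definition mix_wicket (s : I) (v w : W) : W :=
  mk_wicket ((1 - I01val s) * wx v + I01val s * wx w)
    ((1 - I01val s) * wy v + I01val s * wy w)
    (mix_radius_gt0 s (wr_gt0 v) (wr_gt0 w)).

Lemma mix_wicketE s v w :
  [/\ wx (mix_wicket s v w) = (1 - I01val s) * wx v + I01val s * wx w,
      wy (mix_wicket s v w) = (1 - I01val s) * wy v + I01val s * wy w &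
      wr (mix_wicket s v w) = (1 - I01val s) * wr v + I01val s * wr w].
Proof. by []. Qed.

Lemma mix_wicket_cont :
  continuous (fun a : I * (W * W) => mix_wicket a.1 a.2.1 a.2.2).
Proof.
apply: wicket_continuous; [exact: (mix_real_cont wx_cont)
  |exact: (mix_real_cont wy_cont)|exact: (mix_real_cont wr_cont)].
Qed.

Lemma mix_wicket0 v w : mix_wicket zero v w = v.
Proof.
have [ex ey er] := mix_wicketE zero v w.
by apply: wicket_inj; rewrite ?ex ?ey ?er I01_zeroE subr0 mul1r mul0r addr0.
Qed.

Lemma mix_wicket1 v w : mix_wicket one v w = w.
Proof.
have [ex ey er] := mix_wicketE one v w.
by apply: wicket_inj; rewrite ?ex ?ey ?er I01_oneE subrr mul1r mul0r add0r.
Qed.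

Lemma mix_wicketvv s v : mix_wicket s v v = v.
Proof.
have [ex ey er] := mix_wicketE s v v.
by apply: wicket_inj; rewrite ?ex ?ey ?er -mulrDl subrK mul1r.
Qed.

(* Numerical forms of sigma_crossing and rho_crossing, which are convex. *)
Definition beside (v w : W) : Prop := wr v + wr w < wy v - wy w.

Definition inside (v w : W) : Prop :=
  wy w - wr w < wy v - wr v /\ wy v + wr v < wy w + wr w.

Lemma circle_bound (a z r : R) : 0 < r -> a ^+ 2 + z ^+ 2 = r ^+ 2 ->
  - r <= a <= r.
Proof.
move=> r0 e; rewrite -ler_norml -[X in _ <= X](gtr0_norm r0) -ler_sqr ?nnegrE//.
by rewrite !real_normK ?num_real// -e lerDl sqr_ge0.
Qed.

Lemma beside_disjoint v w : beside v w -> disjoint_wickets v w.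
Proof.
rewrite /beside => vw; apply/seteqP; split=> // -[[x y] z].
move=> [[_ /= /(circle_bound (wr_gt0 v)) e1 _] [_ /= /(circle_bound (wr_gt0 w)) e2 _]].
by lra.
Qed.

Lemma disjoint_wickets_sym (v w : W) : disjoint_wickets v w -> disjoint_wickets w v.
Proof. by rewrite /disjoint_wickets setIC. Qed.

(** It is enough to look at the two end points of [v] in the plane [z = 0]. *)
Lemma nested_inside v w : nested v w -> inside v w.
Proof.
move=> vw; have v0 := wr_gt0 v; have w0 := wr_gt0 w.
have [] : half_disc w (wx v, wy v + wr v, 0).
  by apply: vw; split=> //=; ring.
have [] : half_disc w (wx v, wy v - wr v, 0).
  by apply: vw; split=> //=; ring.
move=> /= _ h1 _ _ h2 _; split; nra.
Qed.

(** Along the semicircle [v], the squared distance to the center of [w] is affine in the horizontal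
    coordinate [a], so it is largest at an end point. *)
Lemma inside_nested v w : wx v = wx w -> inside v w -> nested v w.
Proof.
move=> xvw [vw1 vw2] [[x y] z] [/= -> e z0]; split=> //=.
have v0 := wr_gt0 v; have w0 := wr_gt0 w.
have := circle_bound v0 e; set a := y - wy v in e *; set d := wy v - wy w => av.
have -> : y - wy w = a + d by rewrite /a /d; ring.
have -> : (a + d) ^+ 2 + z ^+ 2 = wr v ^+ 2 + 2 * (a * d) + d ^+ 2.
  by rewrite -e; ring.
have [d1 d2] : d < wr w - wr v /\ - d < wr w - wr v by rewrite /d; split; lra.
by have [d0|d0] := lerP 0 d; nra.
Qed.

Lemma inside_disjoint v w : wx v = wx w -> inside v w -> disjoint_wickets v w.
Proof.
move=> xvw /(inside_nested xvw) vw; apply/seteqP; split=> // p [/vw[_ h _] [_ e _]].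
by rewrite e ltxx in h.
Qed.

(** Otherwise the distance of the centers is at most the sum of the radii and, neither wicket being
    nested in the other, at least their difference. Such circles meet, against disjointness. *)
Lemma beside_crossing v w : wx v = wx w -> disjoint_wickets v w ->
  sigma_crossing v w -> beside v w.
Proof.
move=> xvw dvw [nvw nwv yvw]; rewrite /beside ltNge; apply/negP => le1.
have v0 := wr_gt0 v; have w0 := wr_gt0 w.
have le2 : wr v - wr w <= wy v - wy w.
  rewrite leNgt; apply/negP => lt; apply: nwv; apply: inside_nested => //.
  by split; lra.
have le3 : wr w - wr v <= wy v - wy w.
  rewrite leNgt; apply/negP => lt; apply: nvw; apply: inside_nested => //.
  by split; lra.
(* The two circles would meet at the height z below. *)
pose d := wy v - wy w; have d0 : 0 < d by rewrite subr_gt0.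
(* The position of the radical axis of the two circles, measured from the center of [w]. *)
pose u := (d ^+ 2 + wr w ^+ 2 - wr v ^+ 2) / (2 * d).
have uE : u * (2 * d) = d ^+ 2 + wr w ^+ 2 - wr v ^+ 2.
  by rewrite divfK// mulf_neq0// gt_eqF.
pose z2 := wr w ^+ 2 - u ^+ 2.
have z20 : 0 <= z2.
  have d20 : 0 < (2 * d) ^+ 2 by rewrite exprn_gt0// mulr_gt0.
  rewrite -(pmulr_rge0 _ d20) /z2.
  have -> : (2 * d) ^+ 2 * (wr w ^+ 2 - u ^+ 2) =
    (2 * d) ^+ 2 * wr w ^+ 2 - (u * (2 * d)) ^+ 2 by ring.
  (* Heron's formula for the triangle with sides [d], [wr v], [wr w]; the factors are nonnegative by
     [le1], [le2] and [le3]. *)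
  rewrite uE; have -> : (2 * d) ^+ 2 * wr w ^+ 2 - (d ^+ 2 + wr w ^+ 2 - wr v ^+ 2) ^+ 2 =
    ((wr v - wr w + d) * (wr v + wr w - d)) * ((d + wr w - wr v) * (d + wr w + wr v)).
    by ring.
  by rewrite !mulr_ge0// /d; lra.
have : (wicket_set v `&` wicket_set w) (wx w, wy w + u, Num.sqrt z2).
  split; split=> //=; rewrite ?sqrtr_ge0// sqr_sqrtr// /z2.
  - have -> : wy w + u - wy v = u - d by rewrite /d; ring.
    have -> : (u - d) ^+ 2 + (wr w ^+ 2 - u ^+ 2) = d ^+ 2 + wr w ^+ 2 - u * (2 * d).
      by ring.
    by rewrite uE; ring.
  - by ring.
by rewrite dvw.
Qed.

Lemma beside_mix s v v' w w' : beside v v' -> beside w w' ->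
  beside (mix_wicket s v w) (mix_wicket s v' w').
Proof.
have [_ ey er] := mix_wicketE s v w; have [_ ey' er'] := mix_wicketE s v' w'.
rewrite /beside ey er ey' er' => h h'; have := ltr_convex s h h'; lra.
Qed.

Lemma inside_mix s v v' w w' : inside v v' -> inside w w' ->
  inside (mix_wicket s v w) (mix_wicket s v' w').
Proof.
move=> [h1 h2] [h1' h2'].
have [_ ey er] := mix_wicketE s v w; have [_ ey' er'] := mix_wicketE s v' w'.
have := ltr_convex s h1 h1'; have := ltr_convex s h2 h2'.
by rewrite /inside ey er ey' er'; split; lra.
Qed.

End WicketPaths.

(** * From exchange loops to exchanges with ordered abscissas *)

Section ExchangeLoops.
Context (R : realType) (n : nat).
Local Notation I := (I01 R).
Local Notation W := (wicket R).
Local Notation bw := (base_wickets R n).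
Local Notation base := (@base_wicket R n).

Lemma sign_constant (g : I -> R) (a b : I) : continuous g ->
  I01val a <= I01val b ->
  (forall t, I01val a <= I01val t <= I01val b -> g t <> 0) ->
  (0 < g a) = (0 < g b).
Proof.
move=> cg ab g0.
have ga : g a != 0 by apply/eqP/g0; rewrite lexx.
have gb : g b != 0 by apply/eqP/g0; rewrite lexx andbT.
have cgc : continuous (g \o @clamp R).
  by apply: clamp_comp_cont => // r; exact: cvg_id.
have noroot : ~ (exists2 r, r \in `[I01val a, I01val b] & (g \o @clamp R) r = 0).
  move=> [r]; rewrite in_itv /= => /andP[r1 r2]; apply: g0; rewrite clampK ?r1//.
  by have := I01P a; have := I01P b; lra.
have h := IVT ab (continuous_subspaceT cgc).
apply/idP/idP => [a0|b0]; rewrite lt_neqAle eq_sym ?ga ?gb leNgt; apply/negP => lt0.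
- by apply/noroot/h; rewrite /= !I01valK ge_min le_max (ltW lt0) (ltW a0) orbT.
- by apply/noroot/h; rewrite /= !I01valK ge_min le_max (ltW lt0) (ltW b0) orbT.
Qed.

Section Outer.
Context (i : 'I_n.-1).

(* The wickets lo i and hi i stay between the planes of their neighbours, and
   the other wickets are at their base positions. *)
Let apart (p : 'I_n -> W) : Prop := forall k, k != lo i -> k != hi i ->
  [/\ p k = base k,
      (0 < wx (p (lo i)) - wx (base k)) = (k < lo i)%N &
      (0 < wx (p (hi i)) - wx (base k)) = (k < lo i)%N].

Let wx_base (j k : 'I_n) : (wx (base j) < wx (base k)) = (j < k)%N.
Proof. by rewrite /wx /= ltr_pM2l// ltr_nat. Qed.

Let apart_lt (p : 'I_n -> W) : apart p ->
  (forall k, k != lo i -> k != hi i -> wx (p (lo i)) <> wx (base k) /\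
     wx (p (hi i)) <> wx (base k)) ->
  forall j k : 'I_n, (j < k)%N -> (j, k) != (lo i, hi i) -> wx (p j) < wx (p k).
Proof.
move=> pa pn j k jk; rewrite xpair_eqE.
have loE : lo i = i :> nat by [].
have hiE : hi i = i.+1 :> nat by [].
have neq (m l : 'I_n) : m != l -> m <> l :> nat by move=> /eqP ml /ord_inj.
have left_of m l : m = lo i \/ m = hi i -> l != lo i -> l != hi i -> (m < l)%N ->
    wx (p m) < wx (p l).
  move=> mE l1 l2 ml; have [-> e1 e2] := pa l l1 l2; have [n1 n2] := pn l l1 l2.
  have nl : (l < lo i)%N = false by case: mE ml => ->; lia.
  by case: mE => ->; rewrite lt_neqAle leNgt -subr_gt0 ?e1 ?e2 nl andbT; apply/eqP.
have right_of m l : m = lo i \/ m = hi i -> l != lo i -> l != hi i -> (l < m)%N ->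
    wx (p l) < wx (p m).
  move=> mE l1 l2 lm; have [-> e1 e2] := pa l l1 l2.
  have ll : (l < lo i)%N by have := neq _ _ l1; case: mE lm => ->; lia.
  by case: mE => ->; rewrite -subr_gt0 ?e1 ?e2.
have [jlo|j1] := eqVneq j (lo i); have [khi|k2] := eqVneq k (hi i) => //= _.
- apply: left_of => //; first by left.
  by apply/eqP => klo; rewrite jlo klo ltnn in jk.
- have [jhi|j2] := eqVneq j (hi i); first by rewrite jhi khi ltnn in jk.
  by apply: right_of => //; right.
have [jhi|j2] := eqVneq j (hi i).
  apply: left_of => //; first by right.
  by apply/eqP => klo; rewrite jhi klo /= in jk; lia.
have [klo|k1] := eqVneq k (lo i); first by apply: right_of => //; left.
by have [-> _ _] := pa j j1 j2; have [-> _ _] := pa k k1 k2; rewrite wx_base.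
Qed.

(** An exchange loop only tells when planes coincide. By the intermediate value theorem each
    difference of abscissas keeps its sign as long as it does not vanish, and the signs are known at
    the two ends; this gives the order of all planes at every time. *)
Lemma exchange_loop_exchange (crossing cross : W -> W -> Prop) (f : loop R bw) :
  (forall v w : W, wx v = wx w -> disjoint_wickets v w -> crossing v w -> cross v w) ->
  exchange_loop crossing i f ->
  exists2 v, exchange (@wx R) cross base i v & f = to_conf bw \o v :> (I -> _).
Proof.
move=> crossP [w [cw wf w0 [w1lo w1hi] [wother wneq [t0 [t0P wcross]]]]].
have cwk k : continuous (fun t => w t k).
  by move=> t; apply: (@continuous_comp _ _ _ w
    (fun p : ordered_conf (@disjoint_wickets R) n => p k));
    [exact: cw|exact: conf_fun_continuous].
have cwx k : continuous (fun t => wx (w t k)).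
  by move=> t; apply: (@continuous_comp _ _ _ (fun t => w t k) (@wx R));
    [exact: cwk|exact: wx_cont].
have lohi : lo i != hi i by rewrite neq_ltn lo_lt_hi.
pose gap t := wx (w t (hi i)) - wx (w t (lo i)).
have cgap : continuous gap by move=> t; exact: cvgB (cwx (hi i) t) (cwx (lo i) t).
have gapP t : gap t = 0 <-> t = t0.
  rewrite -t0P /gap; split=> [/eqP|->]; last by rewrite subrr.
  by rewrite subr_eq0 => /eqP.
have gap0 : 0 < gap zero by rewrite /gap w0 subr_gt0 [_ < _]wx_base.
have gap1 : (0 < gap one) = false.
  by rewrite /gap w1lo w1hi subr_gt0 wx_base; apply/negbTE; rewrite -leqNgt leqnSn.
have zero_le (t : I) : I01val (zero : I) <= I01val t.
  by rewrite I01_zeroE; have /andP[] := I01P t.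
have le_one (t : I) : I01val t <= I01val (one : I).
  by rewrite I01_oneE; have /andP[] := I01P t.
have before t : I01val t < I01val t0 -> 0 < gap t.
  move=> tt0; rewrite -(sign_constant cgap (zero_le t))// => u /andP[_ ut].
  by move=> /gapP ut0; move: ut; rewrite ut0 leNgt tt0.
have after t : I01val t0 < I01val t -> gap t < 0.
  move=> tt0; have gt : gap t <> 0 by move=> /gapP e; rewrite e ltxx in tt0.
  rewrite lt_neqAle leNgt (sign_constant cgap (le_one t)) ?gap1 ?andbT; first exact/eqP.
  by move=> u /andP[tu _] /gapP ut0; move: tu; rewrite ut0 leNgt tt0.
have wapart t : apart (w t).
  move=> k klo khi; split; first exact: wother.
  - pose g u := wx (w u (lo i)) - wx (base k).
    have cg : continuous g.
      by move=> u; exact: cvgB (cwx (lo i) u) (cvg_cst _).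
    rewrite -[LHS]/(0 < g t) -(sign_constant cg (zero_le t)); last first.
      move=> u _ /eqP; rewrite subr_eq0 => /eqP e.
      by have [] := wneq u k klo khi; rewrite (wother u k klo khi).
    by rewrite /g w0 subr_gt0 [_ < _]wx_base.
  - pose g u := wx (w u (hi i)) - wx (base k).
    have cg : continuous g.
      by move=> u; exact: cvgB (cwx (hi i) u) (cvg_cst _).
    rewrite -[LHS]/(0 < g t) -(sign_constant cg (zero_le t)); last first.
      move=> u _ /eqP; rewrite subr_eq0 => /eqP e.
      by have [] := wneq u k klo khi; rewrite (wother u k klo khi).
    rewrite /g w0 subr_gt0 [_ < _]wx_base /= ltnS leq_eqVlt.
    by have -> : (val k == i) = false by apply/negbTE.
have wn t k : k != lo i -> k != hi i -> wx (w t (lo i)) <> wx (base k) /\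
    wx (w t (hi i)) <> wx (base k).
  by move=> klo khi; rewrite -{1 2}(wother t k klo khi); exact: wneq.
exists (fun t => w t).
  split.
  - exact: cwk.
  - by apply/funext => k; rewrite w0.
  - apply/funext => k /=; rewrite /swap.
    case: tpermP => [->//|->//|/eqP klo /eqP khi]; exact: wother.
  exists t0; split.
  - move=> t tt0 j k jk.
    have [/eqP[-> ->]|jk'] := boolP ((j, k) == (lo i, hi i)).
      by rewrite -subr_gt0; exact: before.
    exact: (apart_lt (wapart t) (wn t)).
  - move=> t tt0 j k jk.
    have [/eqP[-> ->]|jk'] := boolP ((j, k) == (lo i, hi i)).
      by rewrite /= tpermL tpermR -subr_lt0; exact: after.
    pose p := w t \o swap i.
    have plo : p (lo i) = w t (hi i) by rewrite /p /= tpermL.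
    have phi : p (hi i) = w t (lo i) by rewrite /p /= tpermR.
    apply: (@apart_lt p) => // l llo lhi; rewrite plo phi.
      have [e1 e2 e3] := wapart t l llo lhi.
      by split=> //; rewrite /p /= tpermD 1?eq_sym.
    by have [] := wn t l llo lhi.
  - split.
    + exact/t0P.
    + apply: crossP => //; [exact/t0P|exact: ordered_confP].
    + move=> j k jk jk'; exact: (apart_lt (wapart t0) (wn t0)).
by apply/funext => t; rewrite wf /= to_confE.
Qed.

End Outer.

End ExchangeLoops.

(** * Embedding the braid group *)

Section ConfMap.
Context (X Y : topologicalType) (D : X -> X -> Prop) (D' : Y -> Y -> Prop) (n : nat).
Context (b : unordered_conf D n) (b' : unordered_conf D' n).
Context (G : ('I_n -> X) -> 'I_n -> Y).
Hypothesis G_perm : forall p (s : 'S_n), G (p \o s) = G p \o s.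
Hypothesis G_conf : forall p, is_conf D p -> is_conf D' (G p).
Hypothesis G_cont : forall (T : topologicalType) (v : T -> 'I_n -> X),
  (forall t, is_conf D (v t)) -> (forall k, continuous (v^~ k)) ->
  forall k, continuous (fun t => G (v t) k).

Definition conf_map (u : unordered_conf D n) : unordered_conf D' n :=
  to_conf b' (G (repr u : ordered_conf D n)).

(** The representative picked by [repr] is some relabelling of [p], which [G_perm] carries to a
    relabelling of [G p]. *)
Lemma conf_mapE p : is_conf D p -> conf_map (to_conf b p) = to_conf b' (G p).
Proof.
move=> /[dup] cp /is_confP[q qp]; rewrite -qp to_confE /conf_map.
have : forget_order (repr (forget_order q)) = forget_order q.
  by rewrite /forget_order reprK.
move=> /forget_orderP[s sE].
set r : ordered_conf D n := repr (forget_order q) in sE *.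
rewrite (_ : (q : 'I_n -> X) = r \o s); last exact/funext.
by rewrite (G_perm r s) to_conf_perm//; apply: G_conf; exact: ordered_is_conf.
Qed.

Lemma conf_map_cont : continuous conf_map.
Proof.
apply/quotient_continuous.
rewrite (_ : _ \o _ = to_conf b' \o (fun p : ordered_conf D n => G p)).
  apply: to_conf_continuous => [p|]; first by apply: G_conf; exact: ordered_is_conf.
  apply: G_cont => [p|k]; first exact: ordered_is_conf.
  exact: conf_fun_continuous.
apply/funext => p; rewrite /= -[\pi_ _ p]/(forget_order p) -(to_confE b).
by rewrite conf_mapE//; exact: ordered_is_conf.
Qed.

End ConfMap.

Section Embedding.
Context (R : realType) (n : nat).
Local Notation I := (I01 R).
Local Notation W := (wicket R).
Local Notation pt := (R * R)%type.
Local Notation D := (@distinct_points R).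
Local Notation DW := (@disjoint_wickets R).
Local Notation bp := (base_points R n).
Local Notation bw := (base_wickets R n).

Context (cross : W -> W -> Prop) (G : ('I_n -> pt) -> 'I_n -> W) (E : W -> pt).
Hypothesis cross_disjoint :
  forall v w, wx v = wx w -> cross v w -> DW v w /\ DW w v.
Hypothesis cross_mix : forall s v v' w w',
  wx v = wx v' -> wx w = wx w' -> cross v v' -> cross w w' ->
  cross (mix_wicket s v w) (mix_wicket s v' w').
Hypothesis G_perm : forall p (s : 'S_n), G (p \o s) = G p \o s.
Hypothesis G_conf : forall p, is_conf D p -> is_conf DW (G p).
Hypothesis G_cont : forall (T : topologicalType) (v : T -> 'I_n -> pt),
  (forall t, is_conf D (v t)) -> (forall k, continuous (v^~ k)) ->
  forall k, continuous (fun t => G (v t) k).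
Hypothesis G_wx : forall p k, is_conf D p -> wx (G p k) = 4 * (p k).1 + 4.
Hypothesis G_cross : forall p j k, is_conf D p -> (p j).1 = (p k).1 ->
  above (p j) (p k) -> cross (G p j) (G p k).
Hypothesis G_base : G (@base_pt R n) = @base_wicket R n.
Hypothesis E_cont : continuous E.
Hypothesis E_disjoint : forall v w, DW v w -> D (E v) (E w).
Hypothesis E_wx : forall v, (E v).1 = wx v / 4 - 1.
Hypothesis E_cross : forall v w, cross v w -> above (E v) (E w).
Hypothesis E_base : forall k, E (@base_wicket R n k) = base_pt R k.
(* E o G is isotopic to the identity along segments. *)
Hypothesis EG_mix : forall s p, is_conf D p ->
  is_conf D (fun k => mix s (p k) (E (G p k))).

Let Gu : unordered_conf D n -> unordered_conf DW n := conf_map bw G.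
Let cGu : continuous Gu.
Proof. exact: (conf_map_cont bp). Qed.

Let Gbase : Gu bp = bw.
Proof.
rewrite -(base_ptE R n) /Gu conf_mapE//; last exact/xsort_conf/base_pt_sorted.
rewrite G_base; exact: (to_confE bw (base_ordered R n)).
Qed.

Let base_wicket_sorted : xsorted (@wx R) (@base_wicket R n).
Proof. by move=> j k jk; rewrite /wx /= ltr_pM2l// ltr_nat. Qed.

Let exchange_G i v : exchange fst (@above R) (@base_pt R n) i v ->
  exchange (@wx R) cross (@base_wicket R n) i (G \o v).
Proof.
move=> vP; have cv t : is_conf D (v t).
  exact: (exchange_conf (@fst_disjoint R) (@above_disjoint R) t vP).
have lift (p : 'I_n -> pt) j k : is_conf D p -> (p j).1 < (p k).1 ->
    wx (G p j) < wx (G p k).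
  by move=> cp jk; rewrite !G_wx// ltrD2r ltr_pM2l.
have [cvk v0 v1 [t0 [s1 s2 [e c m]]]] := vP; split.
- exact: G_cont.
- by rewrite /= v0.
- by rewrite /= v1 G_perm G_base.
exists t0; split.
- by move=> t /s1 sv j k jk; apply: lift => //; exact: sv.
- by move=> t /s2 sv j k jk; apply: lift => //; exact: sv.
- split.
  + by rewrite /= !G_wx// e.
  + exact: G_cross.
  + by move=> j k jk jk'; apply: lift => //; exact: m.
Qed.

Let exchange_E i v : exchange (@wx R) cross (@base_wicket R n) i v ->
  exchange fst (@above R) (@base_pt R n) i (fun t => E \o v t).
Proof.
have lift (u w : W) : wx u < wx w -> (E u).1 < (E w).1.
  by move=> uw; rewrite !E_wx ltrD2r ltr_pM2r// invr_gt0.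
move=> [cvk v0 v1 [t0 [s1 s2 [e c m]]]]; split.
- move=> k t; apply: (@continuous_comp _ _ _ (v^~ k) E); first exact: cvk.
  exact: E_cont.
- by apply/funext => k; rewrite /= v0 E_base.
- by apply/funext => k; rewrite /= v1 /= E_base.
exists t0; split.
- by move=> t /s1 sv j k jk; apply: lift; exact: sv.
- by move=> t /s2 sv j k jk; apply: lift; exact: sv.
- split.
  + by rewrite /= !E_wx e.
  + exact: E_cross.
  + by move=> j k jk jk'; apply: lift; exact: m.
Qed.

Let exchange_wicket_loop i v : exchange (@wx R) cross (@base_wicket R n) i v ->
  is_loop bw (to_conf bw \o v).
Proof.
move=> vP; have cv t : is_conf DW (v t).
  exact: (exchange_conf (@disjoint_wx R) cross_disjoint t vP).
have [cvk v0 v1 _] := vP; have bE := to_confE bw (base_ordered R n).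
split; first exact: to_conf_continuous.
  by rewrite /= v0; exact: bE.
rewrite /= v1 to_conf_perm; first exact: bE.
exact: ordered_is_conf (base_ordered R n).
Qed.

Let exchange_point_loop i v : exchange fst (@above R) (@base_pt R n) i v ->
  is_loop bp (to_conf bp \o v).
Proof.
move=> vP; have cv t : is_conf D (v t).
  exact: (exchange_conf (@fst_disjoint R) (@above_disjoint R) t vP).
have [cvk v0 v1 _] := vP; split; first exact: to_conf_continuous.
  by rewrite /= v0 base_ptE.
by rewrite /= v1 to_conf_perm ?base_ptE//; exact/xsort_conf/base_pt_sorted.
Qed.

Let Gpi : {multiplicative braid_group R n -> wicket_group R n} := pi1_map cGu Gbase.

Let GpiE f : is_loop bp f -> Gpi (fun_class bp f) = fun_class bw (Gu \o f).
Proof. exact: (pi1_mapE cGu Gbase). Qed.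

(** [G] turns [v] into an exchange of wickets, and two exchanges with the same [i] and the same
    [cross] are homotopic. So the choice of loops in the statement is immaterial. *)
Let Gpi_exchange i v w : exchange fst (@above R) (@base_pt R n) i v ->
  exchange (@wx R) cross (@base_wicket R n) i w ->
  Gpi (fun_class bp (to_conf bp \o v)) = fun_class bw (to_conf bw \o w).
Proof.
move=> vP wP; rewrite GpiE; last exact: exchange_point_loop vP.
have GvP := exchange_G vP.
rewrite (_ : Gu \o _ = to_conf bw \o (G \o v)); last first.
  apply/funext => t; rewrite /= /Gu conf_mapE//.
  exact: (exchange_conf (@fst_disjoint R) (@above_disjoint R) t vP).
apply/fun_class_eqP; [exact: exchange_wicket_loop GvP|exact: exchange_wicket_loop wP|].
apply: (exchange_homotopic (@mix_wicket_cont R) (@mix_wicket0 R) (@mix_wicket1 R)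
  (@mix_wicketvv R) bw (@disjoint_wx R) cross_disjoint _ cross_mix
  base_wicket_sorted GvP wP).
by move=> s p q; have [] := mix_wicketE s p q.
Qed.

Let Eu : unordered_conf DW n -> unordered_conf D n :=
  conf_map bp (fun p : 'I_n -> W => E \o p).
Let E_conf (p : 'I_n -> W) : is_conf DW p -> is_conf D (E \o p).
Proof. by move=> cp j k jk; apply: E_disjoint; exact: cp. Qed.

Let cEu : continuous Eu.
Proof.
apply: (conf_map_cont bw) => // T v cv ck k t.
by apply: (@continuous_comp _ _ _ (v^~ k) E); [exact: ck|exact: E_cont].
Qed.

(** The segments from [p] to its image under [E] after [G] commute with relabelling, so they define
    a homotopy of unordered configurations. It is constant at the base point, so loops stay
    based. *)
Let EG_homotopic (f : I -> unordered_conf D n) : is_loop bp f ->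
  path_homotopic f (Eu \o Gu \o f).
Proof.
move=> [cf f0 f1].
pose H (a : I * ordered_conf D n) : unordered_conf D n :=
  to_conf bp (fun k => mix a.1 (a.2 k) (E (G a.2 k))).
have HE (s : I) (p : 'I_n -> pt) : is_conf D p ->
    forall q : ordered_conf D n, forget_order q = to_conf bp p ->
    H (s, q) = to_conf bp (fun k => mix s (p k) (E (G p k))).
  move=> /[dup] cp /is_confP[p' pE] q; rewrite -pE to_confE => /forget_orderP[t tE].
  rewrite (_ : (p' : 'I_n -> pt) = q \o t); last exact/funext.
  rewrite G_perm -[in RHS](to_conf_perm bp t^-1%g); last first.
    move: (@EG_mix s _ (is_conf_perm t (ordered_is_conf q))); rewrite G_perm; exact.
  rewrite /H; congr (to_conf bp _); apply/funext => k /=.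
  by rewrite permKV.
have cpk k : continuous (fun a : I * ordered_conf D n => a.2 k).
  move=> a; apply: (@continuous_comp _ _ _ snd (fun p : ordered_conf D n => p k)).
    exact: cvg_snd.
  exact: conf_fun_continuous.
have cH : continuous H.
  apply: to_conf_continuous => [a|k]; first by apply: EG_mix; exact: ordered_is_conf.
  move=> a; apply: (@continuous_comp _ _ _
    (fun a : I * ordered_conf D n => (a.1, (a.2 k, E (G a.2 k))))
    (fun b : I * (pt * pt) => mix b.1 b.2.1 b.2.2)); last exact: mix_cont.
  apply: pair_cont; first by move=> ?; exact: cvg_fst.
  apply: pair_cont; first exact: cpk.
  move=> a'; apply: (@continuous_comp _ _ _
    (fun a : I * ordered_conf D n => G a.2 k) E); last exact: E_cont.
  by apply: (G_cont (v := fun a : I * ordered_conf D n => a.2 : 'I_n -> pt)) => // a'';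
    exact: ordered_is_conf.
have Hq (s : I) (p q : ordered_conf D n) :
    forget_order p = forget_order q -> H (s, p) = H (s, q).
  move=> pq; rewrite (HE s p (ordered_is_conf p) q) ?to_confE//.
have cHf := descend_continuous cH Hq.
have HfE (s : I) u (p : 'I_n -> pt) : is_conf D p -> to_conf bp p = u ->
    H (s, repr u) = to_conf bp (fun k => mix s (p k) (E (G p k))).
  by move=> cp pu; apply: HE => //; rewrite pu /forget_order reprK.
have Hbase s : H (s, repr bp) = bp.
  rewrite (HfE _ _ (@base_pt R n)) ?base_ptE//; last exact/xsort_conf/base_pt_sorted.
  rewrite -[RHS]base_ptE; congr (to_conf bp _); apply/funext => k.
  by rewrite G_base E_base mixaa.
exists (fun st => H (st.1, repr (f st.2))); split.
- move=> st; apply: (@continuous_comp _ _ _ (fun st : I * I => (st.1, f st.2))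
    (fun a : I * unordered_conf D n => H (a.1, repr a.2))); last exact: cHf.
  apply: pair_cont; first by move=> ?; exact: cvg_fst.
  by move=> st'; apply: (@continuous_comp _ _ _ snd f); [exact: cvg_snd|exact: cf].
- move=> t; have [p cp pE] := to_conf_surj bp (f t).
  rewrite (HfE _ _ p)// -pE; congr (to_conf bp _).
  by apply/funext => k; rewrite mix0.
- move=> t; have [p cp pE] := to_conf_surj bp (f t).
  rewrite (HfE _ _ p)// /= -pE /Gu conf_mapE// /Eu conf_mapE//; last exact: G_conf.
  by congr (to_conf bp _); apply/funext => k; rewrite mix1.
- by move=> s; rewrite /= f0 f1 !Hbase.
Qed.

Let Gpi_inj : injective Gpi.
Proof.
move=> a c; have [f lf <-] := fun_class_surj a; have [g lg <-] := fun_class_surj c.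
rewrite !GpiE// => /fun_class_eqP => fg.
have {}fg : path_homotopic (Gu \o f) (Gu \o g).
  by apply: fg; apply: comp_is_loop lf || apply: comp_is_loop lg.
apply/fun_class_eqP => //.
apply: (path_homotopic_trans (EG_homotopic lf)).
apply: (path_homotopic_trans _ (path_homotopic_sym (EG_homotopic lg))).
exact: (path_homotopic_comp cEu fg).
Qed.

Lemma exchanges_subgroup (t : 'I_n.-1 -> wicket_group R n) :
  (forall i, exists2 v, exchange (@wx R) cross (@base_wicket R n) i v &
     t i = fun_class bw (to_conf bw \o v)) ->
  isomorphic_to_subgroup (braid_group R n) (generated (range t)).
Proof.
move=> tP; exists Gpi; split; first exact: Gpi_inj.
have GpiM a c : Gpi (a * c)%g = (Gpi a * Gpi c)%g by exact: gmulfM.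
have Gpi1 : Gpi 1%g = 1%g.
  by apply: (mulgI (Gpi 1%g)); rewrite -GpiM !mulg1.
have GpiV a : Gpi (a^-1)%g = ((Gpi a)^-1)%g.
  by apply/esym/mulg1_eq; rewrite -GpiM mulgV.
apply/seteqP; split.
- move=> _ [a _ <-]; move: a.
  have clo (A : set (wicket_group R n)) : group_closed (mem A) -> 
      [/\ A 1%g, (forall a c, A a -> A c -> A (a * c)%g) & forall a, A a -> A (a^-1)%g].
    move=> gA; have [A1 _] := gA; split; first exact: set_mem.
    + by move=> a c /mem_set aA /mem_set cA; apply/set_mem; exact: (group_closedM gA).
    + by move=> a /mem_set aA; apply/set_mem; exact: (group_closedV gA).
  move=> a A [gA tA]; have [A1 AM AV] := clo A gA.
  (* The preimage of a subgroup [A] that contains all [t i] is closed under the group operations and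
     contains all exchanges, so it is the whole braid group. *)
  apply: (exchanges_generate (H := [set a | A (Gpi a)])).
  + by rewrite /= -[_ 1%g]/(Gpi 1%g) Gpi1.
  + by move=> a' c' aA cA; rewrite /= -[_ (_ * _)%g]/(Gpi _) GpiM; exact: AM.
  + by move=> a' aA; rewrite /= -[_ (_^-1)%g]/(Gpi _) GpiV; exact: AV.
  + move=> i v vP; have [w wP te] := tP i.
    have := Gpi_exchange vP wP; rewrite -te /= => ->; by apply: tA; exists i.
- move=> a /(_ (range Gpi)); apply; split.
  + split; first by apply/mem_set; exists 1%g.
    by move=> b c /set_mem[b' _ <-] /set_mem[c' _ <-]; apply/mem_set;
      exists (b' * c'^-1)%g => //; rewrite GpiM GpiV.
  + move=> _ [i _ <-]; have [w wP ->] := tP i.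
    (* The exchange [w] of wickets, pushed to points by [E], supplies the preimage of [t i]. *)
    by exists (fun_class bp (to_conf bp \o (fun t => E \o w t))) => //;
      exact: (Gpi_exchange (exchange_E wP) wP).
Qed.

End Embedding.

(** * The two concrete pairs of maps, for nested and for small wickets *)

Section ConcreteMaps.
Context (R : realType) (n : nat).
Local Notation W := (wicket R).
Local Notation pt := (R * R)%type.
Local Notation D := (@distinct_points R).
Local Notation DW := (@disjoint_wickets R).
Implicit Types (p : 'I_n -> pt) (v w : W).

Lemma right_end_neq v w : DW v w -> wx v = wx w -> wy v + wr v <> wy w + wr w.
Proof.
move=> vw xE yE.
have : (wicket_set v `&` wicket_set w) (wx v, wy v + wr v, 0).
  by split; split=> //=; [ring|rewrite yE; ring].
by rewrite vw.
Qed.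

Lemma neq_points (a c : pt) : a.1 = c.1 -> a <> c -> a.2 <> c.2.
Proof. by case: a c => a1 a2 [c1 c2] /= -> ac a2E; apply: ac; rewrite a2E. Qed.

Lemma pt_fst_cont (T : topologicalType) (f : T -> pt) :
  continuous f -> continuous (fun t => (f t).1).
Proof. by move=> cf t; apply: (continuous_comp (cf t)); exact: cvg_fst. Qed.

Lemma pt_snd_cont (T : topologicalType) (f : T -> pt) :
  continuous f -> continuous (fun t => (f t).2).
Proof. by move=> cf t; apply: (continuous_comp (cf t)); exact: cvg_snd. Qed.

Lemma abscissa_cont (T : topologicalType) (f : T -> pt) :
  continuous f -> continuous (fun t => 4 * (f t).1 + 4).
Proof. by move=> cf; apply: affine_cont; exact: pt_fst_cont. Qed.

Lemma wx_scaled_cont : continuous (fun w => wx w / 4 - 1).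
Proof.
rewrite (_ : (fun _ => _) = (fun w => 4^-1 * wx w + (- 1))).
  by apply: affine_cont; exact: wx_cont.
by apply/funext => w; rewrite mulrC.
Qed.

Lemma right_end_cont : continuous (fun w => wy w + wr w).
Proof. by move=> w; exact: cvgD (@wy_cont R w) (@wr_cont R w). Qed.

Section Concentric.

(** The radius decreases with the ordinate, so [above] becomes [inside]; ordinate 0 gives the base
    radius 1. *)
Definition concentric p : 'I_n -> W :=
  fun k => mk_wicket (4 * (p k).1 + 4) 0 (expR_gt0 (- (p k).2)).

(** The sign puts the inner wicket, whose right end is smaller, above the outer one; the constant 1
    sends base wickets to ordinate 0. *)
Definition left_shift v : pt := (wx v / 4 - 1, 1 - (wy v + wr v)).

Lemma concentric_inside p j k : (p j).1 = (p k).1 -> above (p j) (p k) ->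
  inside (concentric p j) (concentric p k).
Proof.
rewrite /above => _ jk; have := jk; rewrite -ltrN2 -ltr_expR => h.
by split; rewrite /wy /wr /=; lra.
Qed.

Lemma concentric_conf p : is_conf D p -> is_conf DW (concentric p).
Proof.
move=> cp j k jk; have [xE|xN] := eqVneq (p j).1 (p k).1; last first.
  apply: disjoint_wx; rewrite /wx /= => /addIr /mulfI; rewrite pnatr_eq0.
  by move=> /(_ isT)/eqP; rewrite (negbTE xN).
have xW : wx (concentric p j) = wx (concentric p k) by rewrite /wx /= xE.
have [yjk|yjk|] := ltgtP (p j).2 (p k).2; last by move/(neq_points xE (cp _ _ jk)).
- apply: disjoint_wickets_sym; apply: inside_disjoint => //; exact: concentric_inside.
- by apply: inside_disjoint => //; exact: concentric_inside.
Qed.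

Lemma concentric_cont (T : topologicalType) (v : T -> 'I_n -> pt) :
  (forall k, continuous (v^~ k)) ->
  forall k, continuous (fun t => concentric (v t) k).
Proof.
move=> cv k; apply: wicket_continuous.
- exact: (abscissa_cont (cv k)).
- exact: cst_continuous.
- move=> t; apply: (@continuous_comp _ _ _ (fun t => - (v t k).2) (@expR R)).
    by apply: cvgN; exact: (pt_snd_cont (cv k)).
  exact: continuous_expR.
Qed.

Lemma left_shift_disjoint v w : DW v w -> D (left_shift v) (left_shift w).
Proof.
move=> vw [/addIr /mulIf xE /addrI /oppr_inj]; apply: right_end_neq vw _.
by apply: xE; rewrite invr_eq0 pnatr_eq0.
Qed.

(** Abscissas are unchanged and an ordinate [y] becomes [1 - expR (- y)]. This is strictly
    increasing in [y], as is every convex combination of it with [y], so points on one vertical line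
    stay distinct. *)
Lemma left_shift_concentric (s : I01 R) p : is_conf D p ->
  is_conf D (fun k => mix s (p k) (left_shift (concentric p k))).
Proof.
move=> cp j k jk [].
have xE l : (4 * (p l).1 + 4) / 4 - 1 = (p l).1 by field.
rewrite /left_shift /wx /wy /wr /= !xE -!mulrDl subrK !mul1r !add0r => x_eq.
have mono (l m : 'I_n) : (p l).2 < (p m).2 ->
    (1 - I01val s) * (p l).2 + I01val s * (1 - expR (- (p l).2)) <
    (1 - I01val s) * (p m).2 + I01val s * (1 - expR (- (p m).2)).
  by move=> lm; apply: ltr_convex; rewrite // ltrD2l ltrN2 ltr_expR ltrN2.
have [/mono|/mono|] := ltgtP (p j).2 (p k).2; last by move/(neq_points x_eq (cp _ _ jk)).
- by move=> h e; rewrite e ltxx in h.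
- by move=> h e; rewrite e ltxx in h.
Qed.

Lemma concentric_subgroup (t : 'I_n.-1 -> wicket_group R n) :
  (forall i, exists2 v, exchange (@wx R) (@inside R) (@base_wicket R n) i v &
     t i = fun_class (base_wickets R n) (to_conf (base_wickets R n) \o v)) ->
  isomorphic_to_subgroup (braid_group R n) (generated (range t)).
Proof.
apply: (exchanges_subgroup (G := concentric) (E := left_shift)).
- move=> v w xvw vw; have := inside_disjoint xvw vw.
  by split=> //; exact: disjoint_wickets_sym.
- by move=> s v v' w w' _ _; exact: inside_mix.
- by [].
- exact: concentric_conf.
- by move=> T v _; exact: concentric_cont.
- by [].
- by move=> p j k _; exact: concentric_inside.
- apply/funext => k; apply: wicket_inj; rewrite /wx /wy /wr //=.
    by rewrite -[in RHS](natr1 k); ring.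
  by rewrite oppr0 expR0.
- apply: pair_cont; first exact: wx_scaled_cont.
  rewrite (_ : (fun w => _) = fun w => (- 1) * (wy w + wr w) + 1).
    by apply: affine_cont; exact: right_end_cont.
  by apply/funext => w; rewrite mulN1r addrC.
- exact: left_shift_disjoint.
- by [].
- by move=> v w [_ vw]; rewrite /above /=; lra.
- move=> k; rewrite /left_shift /wx /wy /wr /=; congr (_, _); last by ring.
  by rewrite -(natr1 k); field.
- exact: left_shift_concentric.
Qed.

End Concentric.

Section Small.

(** Positive for distinct points. On a common vertical line it is at most a quarter of their
    distance, so two such radii add up to less than that distance; the weight 8 makes it 1 once
    abscissas differ by 1, as in the base configuration. *)
Definition clearance p (jk : 'I_n * 'I_n) : R :=
  Num.min 1 (8 * `|(p jk.1).1 - (p jk.2).1| + `|(p jk.1).2 - (p jk.2).2| / 4).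

(** One radius for all the wickets, symmetric in the labels. A product of factors in []0, 1]] is
    below each factor and visibly continuous. *)
Definition small_radius p : R :=
  \prod_(jk : 'I_n * 'I_n | jk.1 != jk.2) clearance p jk.

Lemma clearance_gt0 p jk : is_conf D p -> jk.1 != jk.2 -> 0 < clearance p jk.
Proof.
move=> cp jk12; rewrite lt_min ltr01 /=.
have [xE|xN] := eqVneq (p jk.1).1 (p jk.2).1.
  rewrite ltr_wpDl ?mulr_ge0// divr_gt0// normr_gt0 subr_eq0; apply/eqP.
  exact: neq_points (cp _ _ jk12).
by rewrite ltr_pwDl ?divr_ge0// mulr_gt0// normr_gt0 subr_eq0.
Qed.

Lemma clearance_le1 p jk : clearance p jk <= 1.
Proof. by rewrite ge_min lexx. Qed.

Lemma small_radius_gt0 p : is_conf D p -> 0 < small_radius p.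
Proof. by move=> cp; apply: prodr_gt0 => jk; exact: clearance_gt0. Qed.

Lemma small_radius_le p j k : is_conf D p -> j != k -> (p j).1 = (p k).1 ->
  small_radius p <= `|(p j).2 - (p k).2| / 4.
Proof.
move=> cp jk xE; rewrite /small_radius (bigD1 (j, k))//=.
apply: (@le_trans _ _ (clearance p (j, k))).
  rewrite ler_piMr//; first exact/ltW/clearance_gt0.
  apply: prodr_ile1 => l /andP[l12 _].
  by rewrite clearance_le1 (ltW (clearance_gt0 cp l12)).
by rewrite /clearance /= xE subrr normr0 mulr0 add0r ge_min lexx orbT.
Qed.

Lemma small_radius_perm p (s : 'S_n) : small_radius (p \o s) = small_radius p.
Proof.
rewrite /small_radius [RHS](reindex_inj (h := fun jk : 'I_n * 'I_n => (s jk.1, s jk.2))).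
  by apply: eq_big => // jk; rewrite (inj_eq perm_inj).
by move=> [j k] [j' k'] [/perm_inj -> /perm_inj ->].
Qed.

Lemma small_radius_base : small_radius (@base_pt R n) = 1.
Proof.
apply: big1 => -[j k] /= jk; apply/min_idPl.
rewrite subrr normr0 mul0r addr0.
suff : 1 <= `|(j : nat)%:R - (k : nat)%:R| :> R by lra.
have h (a b : nat) : (a < b)%N -> 1 <= `|a%:R - b%:R| :> R.
  move=> ab; rewrite distrC ger0_norm ?subr_ge0 ?ler_nat 1?ltnW//.
  by rewrite -natrB 1?ltnW// ler1n subn_gt0.
by move: jk; rewrite neq_ltn => /orP[/h//|/h]; rewrite distrC.
Qed.

Lemma small_radius_cont (T : topologicalType) (v : T -> 'I_n -> pt) :
  (forall k, continuous (v^~ k)) -> continuous (fun t => small_radius (v t)).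
Proof.
move=> cv; apply: continuous_big; first exact: mul_continuous.
move=> jk _; apply: (@min_fun_continuous _ T R (cst 1)); first exact: cst_continuous.
have cn (f : 'I_n -> T -> R) : (forall k, continuous (f k)) ->
    continuous (fun t => `|f jk.1 t - f jk.2 t|).
  move=> cf t; apply: (@continuous_comp _ _ _ (fun t => f jk.1 t - f jk.2 t) Num.norm).
    exact: cvgB (cf _ t) (cf _ t).
  exact: norm_continuous.
move=> t; apply: cvgD; apply: cvgM; try exact: cvg_cst.
- by apply: (cn (fun k t => (v t k).1)) => k; exact: pt_fst_cont (cv k).
- by apply: (cn (fun k t => (v t k).2)) => k; exact: pt_snd_cont (cv k).
Qed.

(* The radius 1 is a junk value, for tuples that are not configurations. *)
Definition wicket_at (x y r : R) : W :=
  match pselect (0 < r) with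
  | left r0 => mk_wicket x y r0
  | right _ => mk_wicket x y ltr01
  end.

Lemma wicket_atE x y r : [/\ wx (wicket_at x y r) = x, wy (wicket_at x y r) = y &
  0 < r -> wr (wicket_at x y r) = r].
Proof. by rewrite /wicket_at; case: pselect. Qed.

(** The center is chosen so that the right end is [(p k).2 + 1] whatever the radius is. Hence
    [right_shift] recovers [p] exactly, and the isotopy on this side is constant. *)
Definition small p : 'I_n -> W := fun k =>
  wicket_at (4 * (p k).1 + 4) ((p k).2 - small_radius p + 1) (small_radius p).

Lemma smallE p k : [/\ wx (small p k) = 4 * (p k).1 + 4,
  wy (small p k) = (p k).2 - small_radius p + 1 &
  0 < small_radius p -> wr (small p k) = small_radius p].
Proof. exact: wicket_atE. Qed.

Definition right_shift v : pt := (wx v / 4 - 1, wy v + wr v - 1).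

Lemma small_beside p j k : is_conf D p -> (p j).1 = (p k).1 -> above (p j) (p k) ->
  beside (small p j) (small p k).
Proof.
move=> cp xE yjk; have r0 := small_radius_gt0 cp.
have [_ yj rj] := smallE p j; have [_ yk rk] := smallE p k.
have jk : j != k by apply/eqP => e; move: yjk; rewrite /above e ltxx.
have := small_radius_le cp jk xE; rewrite /beside yj yk rj// rk//.
by rewrite gtr0_norm ?subr_gt0//; move: yjk; rewrite /above; lra.
Qed.

Lemma small_wx p k : wx (small p k) = 4 * (p k).1 + 4.
Proof. by case: (smallE p k). Qed.

Lemma small_conf p : is_conf D p -> is_conf DW (small p).
Proof.
move=> cp j k jk; have [xE|xN] := eqVneq (p j).1 (p k).1; last first.
  apply: disjoint_wx; rewrite !small_wx => /addIr /mulfI; rewrite pnatr_eq0.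
  by move=> /(_ isT)/eqP; rewrite (negbTE xN).
have [yjk|yjk|] := ltgtP (p j).2 (p k).2; last by move/(neq_points xE (cp _ _ jk)).
- by apply: disjoint_wickets_sym; apply: beside_disjoint; exact: small_beside.
- by apply: beside_disjoint; exact: small_beside.
Qed.

Lemma small_cont (T : topologicalType) (v : T -> 'I_n -> pt) :
  (forall t, is_conf D (v t)) -> (forall k, continuous (v^~ k)) ->
  forall k, continuous (fun t => small (v t) k).
Proof.
move=> cv cvk k; have cr := small_radius_cont cvk.
have E t := smallE (v t) k.
apply: wicket_continuous.
- rewrite (_ : (fun t => _) = (fun t => 4 * (v t k).1 + 4)).
    exact: (abscissa_cont (cvk k)).
  by apply/funext => t; case: (E t).
- rewrite (_ : (fun t => _) = (fun t => (v t k).2 - small_radius (v t) + 1)).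
    move=> t; apply: cvgD; last exact: cvg_cst.
    by apply: cvgB; [exact: (pt_snd_cont (cvk k))|exact: cr].
  by apply/funext => t; case: (E t).
- rewrite (_ : (fun t => _) = (fun t => small_radius (v t)))//.
  by apply/funext => t; case: (E t) => _ _; apply; exact: small_radius_gt0.
Qed.

Lemma right_shift_disjoint v w : DW v w -> D (right_shift v) (right_shift w).
Proof.
move=> vw [/addIr /mulIf xE /addIr]; apply: right_end_neq vw _.
by apply: xE; rewrite invr_eq0 pnatr_eq0.
Qed.

Lemma right_shift_small p k : is_conf D p -> right_shift (small p k) = p k.
Proof.
move=> cp; have r0 := small_radius_gt0 cp.
have [xE yE rE] := smallE p k; rewrite /right_shift xE yE rE// [RHS]surjective_pairing.
by congr (_, _); [field|ring].
Qed.

Lemma small_subgroup (t : 'I_n.-1 -> wicket_group R n) :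
  (forall i, exists2 v, exchange (@wx R) (@beside R) (@base_wicket R n) i v &
     t i = fun_class (base_wickets R n) (to_conf (base_wickets R n) \o v)) ->
  isomorphic_to_subgroup (braid_group R n) (generated (range t)).
Proof.
apply: (exchanges_subgroup (G := small) (E := right_shift)).
- by move=> v w _ /beside_disjoint vw; split=> //; exact: disjoint_wickets_sym.
- by move=> s v v' w w' _ _; exact: beside_mix.
- by move=> p s; apply/funext => k; rewrite /small small_radius_perm.
- exact: small_conf.
- exact: small_cont.
- by move=> p k _; exact: small_wx.
- exact: small_beside.
- apply/funext => k; rewrite /small small_radius_base.
  have [xE yE rE] := wicket_atE (4 * (base_pt R k).1 + 4) ((base_pt R k).2 - 1 + 1) 1.
  apply: wicket_inj; rewrite ?xE ?yE ?rE// /wx /wy /=.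
    by rewrite -[in RHS](natr1 k); ring.
  by rewrite subrK.
- apply: pair_cont; first exact: wx_scaled_cont.
  rewrite (_ : (fun w => _) = fun w => 1 * (wy w + wr w) + (- 1)).
    by apply: affine_cont; exact: right_end_cont.
  by apply/funext => w; rewrite mul1r.
- exact: right_shift_disjoint.
- by [].
- move=> v w; rewrite /beside /above /= => vw.
  by have := wr_gt0 v; have := wr_gt0 w; lra.
- move=> k; rewrite /right_shift /wx /wy /wr /=; congr (_, _); last by ring.
  by rewrite -(natr1 k); field.
- move=> s p cp; rewrite (_ : (fun k => _) = p)//.
  by apply/funext => k; rewrite right_shift_small// mixaa.
Qed.

End Small.

End ConcreteMaps.

Theorem proposition3p1 (R : realType) (n : nat) (n_ge1 : (1 <= n)%N)
    (sigma rho : 'I_n.-1 -> wicket_group R n)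
    (sigmaP : forall i : 'I_n.-1, is_sigma i (sigma i))
    (rhoP : forall i : 'I_n.-1, is_rho i (rho i)) :
  isomorphic_to_subgroup (braid_group R n) (generated (range sigma)) /\
  isomorphic_to_subgroup (braid_group R n) (generated (range rho)).
Proof.
split.
- apply: small_subgroup => i; have [f fP ->] := sigmaP i.
  have [v vP fE] := exchange_loop_exchange (@beside_crossing R) fP.
  by exists v => //; rewrite -fE fun_classE.
- apply: concentric_subgroup => i; have [f fP ->] := rhoP i.
  have cross (v w : wicket R) : wx v = wx w -> disjoint_wickets v w ->
      rho_crossing v w -> inside v w by move=> _ _; exact: nested_inside.
  have [v vP fE] := exchange_loop_exchange cross fP.
  by exists v => //; rewrite -fE fun_classE.
Qed.
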